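(* Let $V$ be an $S$-bimodule, $T=T_S(V)$, $n\ge2$ an integer, $P$ an $S$-subbimodule of $T^{\le n}$, and let $R$ be the $n$-pure graded subbimodule $R=R^n:=p^n(P)$. Let $A:=A(R)=T/\langle R\rangle$. Assume that $A^1=V$ and $R$ are projective as left $S$-modules and that $\operatorname{Tor}_3^A(S,S)$ is $(n+1)$-pure. Then $U(P)$ is a PBW-deformation of $A(R)$ if and only if there is a morphism of filtered $S$-bimodules $\alpha:R\to T_S(V)$ such that $P=\alpha(R)$ and either $\operatorname{Tor}_3^A(S,S)=0$ or the following conditions are satisfied for any $x\in X:=(R\otimes V)\cap(V\otimes R)$ and all $0<i<n$: $(\mathcal J_0')$ $(V\otimes\alpha_1-\alpha_1\otimes V)(x)\in R$; $(\mathcal J_i')$ $\alpha_i(V\otimes\alpha_1-\alpha_1\otimes V)(x)=(V\otimes\alpha_{i+1}-\alpha_{i+1}\otimes V)(x)$; $(\mathcal J_n')$ $\alpha_n(V\otimes\alpha_1-\alpha_1\otimes V)(x)=0$.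
   Context: $S$ is an associative unital ring, $\otimes=\otimes_S$. $T^m=V^{\otimes m}$, $T^0=S$; $p^m:T\to T^m$ is the projection, $T^{\le m}=\bigoplus_{q\le m}T^q$, $X^{\le m}=X\cap T^{\le m}$, $\langle X\rangle$ the two-sided ideal generated by $X$. A graded module $M$ is $m$-pure if $M=M^m$ (zero is allowed). The grading on $\operatorname{Tor}_3^A(S,S)$ is the internal one induced by $A$. For an $S$-subbimodule $P\subseteq T$: $U(P):=T/\langle P\rangle$, filtered by the images of $T^{\le m}$. Here $R\subseteq R_P:=\bigoplus_mp^m(P^{\le m})$, and $U(P)$ is a PBW-deformation of $A(R)$ if the graded $S$-ring map $A(R)\to\operatorname{gr}U(P)$, $x+\langle R\rangle\mapsto(x+\langle P\rangle)+U(P)^{\le m-1}$ ($x\in T^m$), is an isomorphism. A morphism of filtered bimodules $\alpha:R\to T$ is an $S$-bimodule map $R\to T^{\le n}$; $\alpha_i:=p^{n-i}\alpha:R\to T^{n-i}$ ($0\le i\le n$) is its component of degree $-i$, and by convention $\alpha_0$ is the inclusion, so $\alpha=\sum_{i=0}^n\alpha_i$. $V\otimes\alpha_i:V\otimes R\to T^{n+1-i}$ and $\alpha_i\otimes V:R\otimes V\to T^{n+1-i}$ denote $\mathrm{id}_V\otimes\alpha_i$ and $\alpha_i\otimes\mathrm{id}_V$. The intersection $X$ is formed over $T^{n+1}$: an element $x\in X$ is a pair $(u,w)\in(V\otimes R)\times(R\otimes V)$ with the same image in $T^{n+1}$, and $(V\otimes\alpha_i-\alpha_i\otimes V)(x)$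 means $(V\otimes\alpha_i)(u)-(\alpha_i\otimes V)(w)$; when the canonical maps to $T^{n+1}$ are injective this is literally the intersection of subbimodules. *)

(* Defs.v *)
From HB Require Import structures.
From mathcomp Require Import all_boot all_algebra.
From mathcomp Require Import boolp classical_sets functions cardinality fsbigop.
From mathcomp Require Import freeg.

Set Implicit Arguments.
Unset Strict Implicit.
Unset Printing Implicit Defensive.

Import GRing.Theory.
Local Open Scope ring_scope.
Local Open Scope quotient_scope.
Local Open Scope classical_set_scope.

HB.mixin Record Lmodule_isBimodule (S : pzRingType) M of GRing.Lmodule S M := {
  ract : M -> S -> M;
  ractDl : forall s, {morph ract^~ s : x y / x + y};
  ractDr : forall x, {morph ract x : s t / s + t};
  ract1 : forall x, ract x 1 = x;
  ractM : forall x s t, ract x (s * t) = ract (ract x s) t;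
  ractZ : forall s x t, ract (s *: x) t = s *: ract x t
}.

#[short(type="bimodType")]
HB.structure Definition Bimodule (S : pzRingType) :=
  {M of Lmodule_isBimodule S M & GRing.Lmodule S M}.

HB.instance Definition _ (S : pzRingType) :=
  @Lmodule_isBimodule.Build S S^o (fun x s => (x : S) * s)
    (fun s x y => mulrDl x y s) (fun x s t => mulrDr x s t) (fun x => mulr1 x)
    (fun x s t => mulrA x s t) (fun s x t => esym (mulrA s x t)).

Section BimoduleTheory.
Variables (S : pzRingType) (M : bimodType S).
Implicit Types (x y : M) (s : S).

Lemma ractBl s : {morph (@ract S M)^~ s : x y / x - y}.
Proof.
by move=> x y /=; have := ractDl s (x - y) y; rewrite /= subrK => ->; rewrite addrK.
Qed.

Lemma ract0l s : ract (0 : M) s = 0.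
Proof. by have := ractBl s 0 0; rewrite /= !subrr. Qed.

(* Right S-modules are left modules over the converse ring S^c. *)
Definition rmod : Type := M.
HB.instance Definition _ := GRing.Zmodule.on rmod.

Fact rmod_scalerA (a b : S^c) (x : rmod) :
  ract (ract (x : M) b) a = ract (x : M) (a * b).
Proof. by rewrite -ractM. Qed.

HB.instance Definition _ := @GRing.Zmodule_isLmodule.Build S^c rmod
  (fun s x => ract (x : M) s) rmod_scalerA (@ract1 S M)
  (fun s x y => ractDl s x y) (fun x s t => ractDr x s t).

End BimoduleTheory.

Section QuotientMap.
Variables (M : zmodType) (H : zmodClosed M).

Definition qpi (x : M) : Quotient.quot H := \pi_(Quotient.quot H) x.

Fact qpiB : {morph qpi : x y / x - y}.
Proof. by move=> x y; rewrite /qpi !piE. Qed.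
HB.instance Definition _ :=
  GRing.isZmodMorphism.Build M (Quotient.quot H) qpi qpiB.

Lemma qpiP x y : qpi x = qpi y <-> x - y \in H.
Proof.
by rewrite Quotient.idealrBE; split=> [h|/eqP//]; apply/eqP.
Qed.

Lemma qpi0 x : qpi x = 0 <-> x \in H.
Proof. by rewrite -(raddf0 qpi) qpiP subr0. Qed.

Lemma qreprK (a : Quotient.quot H) : qpi (repr a) = a.
Proof. exact: reprK. Qed.

Lemma qrepr_pi x : repr (qpi x) - x \in H.
Proof. by apply/qpiP; rewrite qreprK. Qed.

End QuotientMap.

Section GeneratedSubgroup.
Variables (G : zmodType) (X : set G).

Inductive zspan : set G :=
  | zspan_in x of X x : zspan x
  | zspan0 : zspan 0
  | zspanB x y of zspan x & zspan y : zspan (x - y).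

Definition zspan_pred : {pred G} := fun x => `[< zspan x >].

Fact zspan_zmod_closed : zmod_closed zspan_pred.
Proof.
split; first by apply/asboolP; exact: zspan0.
by move=> x y /asboolP hx /asboolP hy; apply/asboolP; exact: zspanB.
Qed.
HB.instance Definition _ :=
  GRing.isZmodClosed.Build G zspan_pred zspan_zmod_closed.

End GeneratedSubgroup.

(* Tensor product over B of a right module M and a left module N: the free
   abelian group on M * N modulo the usual relations. *)
Section Tensor.
Variables (B : pzRingType) (M : lmodType B^c) (N : lmodType B).

Inductive tensor_rel : set {freeg (M * N)} :=
  | tensor_relDl x x' y : tensor_rel (<< (x + x', y) >> - << (x, y) >> - << (x', y) >>)
  | tensor_relDr x y y' : tensor_rel (<< (x, y + y') >> - << (x, y) >> - << (x, y') >>)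
  | tensor_relZ x (b : B) y :
      tensor_rel (<< ((b : B^c) *: x, y) >> - << (x, b *: y) >>).

Definition tensor : Type := Quotient.quot (zspan_pred tensor_rel).
HB.instance Definition _ := GRing.Zmodule.on tensor.

Definition tens (x : M) (y : N) : tensor := qpi _ << (x, y) >>.

Record balanced (G : zmodType) (f : M -> N -> G) : Prop := Balanced {
  balDl : forall x x' y, f (x + x') y = f x y + f x' y;
  balDr : forall x y y', f x (y + y') = f x y + f x y';
  balZ : forall x (b : B) y, f ((b : B^c) *: x) y = f x (b *: y)
}.

(* The homomorphism induced by a balanced map [f], see [tlift_tens]; it is
   only meaningful when [f] is balanced. *)
Definition tlift (G : zmodType) (f : M -> N -> G) (t : tensor) : G :=
  fglift (fun xy : M * N => f xy.1 xy.2 : zmodule G) (repr t).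

Lemma tens_balanced : balanced tens.
Proof.
split=> [x x' y|x y y'|x b y].
- refine (etrans _ (raddfD (qpi (zspan_pred tensor_rel)) _ _)); apply/qpiP.
  by rewrite opprD addrA; apply/asboolP/zspan_in; exact: tensor_relDl.
- refine (etrans _ (raddfD (qpi (zspan_pred tensor_rel)) _ _)); apply/qpiP.
  by rewrite opprD addrA; apply/asboolP/zspan_in; exact: tensor_relDr.
- by apply/qpiP; apply/asboolP/zspan_in; exact: tensor_relZ.
Qed.

Section Lift.
Variables (G : zmodType) (f : M -> N -> G) (bf : balanced f).

Let ff : {freeg (M * N)} -> zmodule G := 
  fglift (fun xy : M * N => f xy.1 xy.2 : zmodule G).

Let ffB x y : ff (x - y) = ff x - ff y.
Proof. exact: lift_is_additive. Qed.

Let ffU x y : ff << (x, y) >> = f x y.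
Proof. by rewrite /ff liftU scale1r. Qed.

Let ff_span x : zspan tensor_rel x -> ff x = 0.
Proof.
elim=> {x} [x|| x y _ hx _ hy].
- case=> *; rewrite !ffB !ffU ?(balDl bf) ?(balDr bf) ?(balZ bf) ?subrr //.
    by rewrite addrAC addrK subrr.
  by rewrite addrAC addrK subrr.
- by have := ffB 0 0; rewrite !subrr.
- by rewrite ffB hx hy subrr.
Qed.

Let ffE (x y : {freeg (M * N)}) : x - y \in zspan_pred tensor_rel -> ff x = ff y.
Proof. by move=> /asboolP/ff_span/eqP; rewrite ffB subr_eq0 => /eqP. Qed.

Lemma tlift_tens x y : tlift f (tens x y) = f x y.
Proof. by rewrite -ffU; apply: ffE; apply: qrepr_pi. Qed.

Lemma tliftB : {morph tlift f : t u / t - u}.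
Proof.
move=> t u; rewrite -[RHS]ffB; apply: ffE; apply/qpiP.
by rewrite raddfB /= !qreprK.
Qed.

Lemma tlift0 : tlift f 0 = 0.
Proof. by have := tliftB 0 0; rewrite !subrr. Qed.

Lemma tliftD : {morph tlift f : t u / t + u}.
Proof.
by move=> t u; have := tliftB (t + u) u; rewrite addrK => ->; rewrite subrK.
Qed.

End Lift.

Lemma tensor_ind (Q : tensor -> Prop) :
    (forall x y, Q (tens x y)) -> Q 0 -> (forall t u, Q t -> Q u -> Q (t - u)) ->
  forall t, Q t.
Proof.
move=> Qxy Q0 QB t; rewrite -(qreprK t).
have Qi D : Q (qpi (zspan_pred tensor_rel) D); last exact: Qi.
have QN u : Q u -> Q (- u) by move=> hu; rewrite -sub0r; exact: QB.
have QD u v : Q u -> Q v -> Q (u + v).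
  by move=> hu hv; rewrite -[v]opprK; apply: QB => //; apply: QN.
have Qn u n : Q u -> Q (u *+ n).
  by move=> hu; elim: n => [|n IHn] //; rewrite mulrS; apply: QD.
rewrite -(freeg_sumE D) raddf_sum.
apply: (big_ind (fun u => Q u)) => // z _.
have -> : << coeff z D *g z >> = << z >> *~ coeff z D :> {freeg (M * N)}.
  by rewrite freegU_mulz intz.
case: z => x y; case: (coeff _ _) => n.
  by rewrite -pmulrn raddfMn; apply: Qn; apply: Qxy.
by rewrite NegzE mulrNz raddfN -pmulrn raddfMn; apply/QN/Qn/Qxy.
Qed.

End Tensor.
Arguments tlift {B M N G}.
Arguments tens {B M N}.

Section BimoduleTensor.
Variables (S : pzRingType) (V W : bimodType S).

Definition btensor : Type := tensor (rmod V) W.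
HB.instance Definition _ := GRing.Zmodule.on btensor.

Definition btens (v : V) (w : W) : btensor := tens (v : rmod V) w.

Lemma btensDl v v' w : btens (v + v') w = btens v w + btens v' w.
Proof. exact: (balDl (tens_balanced (rmod V) W)). Qed.

Lemma btensDr v w w' : btens v (w + w') = btens v w + btens v w'.
Proof. exact: (balDr (tens_balanced (rmod V) W)). Qed.

Lemma btensZ v s w : btens (ract v s) w = btens v (s *: w).
Proof. exact: (balZ (tens_balanced (rmod V) W)). Qed.

Definition btensor_scale (s : S) : btensor -> btensor :=
  tlift (fun (v : rmod V) w => btens (s *: (v : V)) w).

Definition btensor_ract (t : btensor) (s : S) : btensor :=
  tlift (fun (v : rmod V) w => btens v (ract w s)) t.

Fact scale_bal s : balanced (fun (v : rmod V) w => btens (s *: (v : V)) w).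
Proof.
split=> [x x' y|x y y'|x b y]; rewrite ?scalerDr ?btensDl ?btensDr //.
by rewrite -btensZ ractZ.
Qed.

Fact ract_bal s : balanced (fun (v : rmod V) w => btens (v : V) (ract w s)).
Proof.
split=> [x x' y|x y y'|x b y]; rewrite ?ractDl ?btensDl ?btensDr //.
by rewrite ractZ -btensZ.
Qed.

Lemma btensor_scaleE s v w : btensor_scale s (btens v w) = btens (s *: v) w.
Proof. exact: (tlift_tens (scale_bal s)). Qed.

Lemma btensor_ractE s v w : btensor_ract (btens v w) s = btens v (ract w s).
Proof. exact: (tlift_tens (ract_bal s)). Qed.

Lemma btensor_scaleB s : {morph btensor_scale s : x y / x - y}.
Proof. exact: (tliftB (scale_bal s)). Qed.

Lemma btensor_scaleD s : {morph btensor_scale s : x y / x + y}.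
Proof. exact: (tliftD (scale_bal s)). Qed.

Lemma btensor_ractB s : {morph btensor_ract^~ s : x y / x - y}.
Proof. exact: (tliftB (ract_bal s)). Qed.

Lemma btensor_ractD s : {morph btensor_ract^~ s : x y / x + y}.
Proof. exact: (tliftD (ract_bal s)). Qed.

Lemma btensor_scale0 s : btensor_scale s 0 = 0.
Proof. by have := btensor_scaleB s 0 0; rewrite !subrr. Qed.

Lemma btensor_ract0 s : btensor_ract 0 s = 0.
Proof. by have := btensor_ractB s 0 0; rewrite /= !subrr. Qed.

Lemma btensor_ind (Q : btensor -> Prop) :
    (forall v w, Q (btens v w)) -> Q 0 -> (forall t u, Q t -> Q u -> Q (t - u)) ->
  forall t, Q t.
Proof. exact: (@tensor_ind S (rmod V) W). Qed.

Fact btensor_scalerA a b t :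
  btensor_scale a (btensor_scale b t) = btensor_scale (a * b) t.
Proof.
elim/btensor_ind: t => [v w||t u ht hu]; first by rewrite !btensor_scaleE scalerA.
  by rewrite !btensor_scale0.
by rewrite !btensor_scaleB ht hu.
Qed.

Fact btensor_scale1 : left_id 1 btensor_scale.
Proof.
move=> t; elim/btensor_ind: t => [v w||t u ht hu].
- by rewrite btensor_scaleE scale1r.
- by rewrite btensor_scale0.
- by rewrite btensor_scaleB ht hu.
Qed.

Fact btensor_scalerDl t : {morph btensor_scale^~ t : a b / a + b}.
Proof.
move=> a b; elim/btensor_ind: t => [v w||t u ht hu].
- by rewrite !btensor_scaleE scalerDl btensDl.
- by rewrite !btensor_scale0 addr0.
- by rewrite !btensor_scaleB ht hu opprD addrACA.
Qed.

HB.instance Definition _ := @GRing.Zmodule_isLmodule.Build S btensor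
  btensor_scale btensor_scalerA btensor_scale1 btensor_scaleD btensor_scalerDl.

Fact btensor_ractDr t : {morph btensor_ract t : a b / a + b}.
Proof.
move=> a b; elim/btensor_ind: t => [v w||t u ht hu].
- by rewrite !btensor_ractE ractDr btensDr.
- by rewrite !btensor_ract0 addr0.
- by rewrite !btensor_ractB ht hu opprD addrACA.
Qed.

Fact btensor_ract1 t : btensor_ract t 1 = t.
Proof.
elim/btensor_ind: t => [v w||t u ht hu]; first by rewrite btensor_ractE ract1.
  by rewrite btensor_ract0.
by rewrite btensor_ractB ht hu.
Qed.

Fact btensor_ractM t a b :
  btensor_ract t (a * b) = btensor_ract (btensor_ract t a) b.
Proof.
elim/btensor_ind: t => [v w||t u ht hu]; first by rewrite !btensor_ractE ractM.
  by rewrite !btensor_ract0.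
by rewrite !btensor_ractB ht hu.
Qed.

Fact btensor_ractZ a t b :
  btensor_ract (a *: t) b = a *: btensor_ract t b.
Proof.
rewrite -[a *: t]/(btensor_scale a t) -[RHS]/(btensor_scale a _).
elim/btensor_ind: t => [v w||t u ht hu].
- by rewrite !(btensor_ractE, btensor_scaleE).
- by rewrite !(btensor_scale0, btensor_ract0).
- by rewrite !(btensor_ractB, btensor_scaleB) ht hu.
Qed.

HB.instance Definition _ := @Lmodule_isBimodule.Build S btensor
  btensor_ract btensor_ractD btensor_ractDr btensor_ract1 btensor_ractM
  btensor_ractZ.

Lemma btens_scale s v w : s *: btens v w = btens (s *: v) w.
Proof. exact: btensor_scaleE. Qed.

Lemma btens_ract s v w : ract (btens v w) s = btens v (ract w s).
Proof. exact: btensor_ractE. Qed.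

End BimoduleTensor.

Section DirectSum.
Variables (I : choiceType) (G : I -> zmodType).

Record dsum := DSum {
  dcoef :> forall i, G i;
  dsum_finite : finite_set [set i | dcoef i != 0]
}.

HB.instance Definition _ := gen_eqMixin dsum.
HB.instance Definition _ := gen_choiceMixin dsum.

Lemma dsumP (x y : dsum) : (forall i, x i = y i) -> x = y.
Proof.
case: x y => [x hx] [y hy] /= xy.
have exy : x = y by apply: functional_extensionality_dep.
by case: _ / exy in hy *; congr DSum; exact: Prop_irrelevance.
Qed.

Fact dsum0_finite : finite_set [set i : I | (0 : G i) != 0].
Proof.
by rewrite (_ : [set i | _] = set0 :> set I) //; apply/seteqP; split=> i //=; rewrite eqxx.
Qed.

Fact dsumN_finite (x : dsum) : finite_set [set i | - x i != 0].
Proof.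
by apply: sub_finite_set (dsum_finite x) => i /=; rewrite oppr_eq0.
Qed.

Fact dsumD_finite (x y : dsum) : finite_set [set i | x i + y i != 0].
Proof.
have : finite_set ([set i | x i != 0] `|` [set i | y i != 0]).
  by rewrite finite_setU; split; exact: dsum_finite.
apply: sub_finite_set => i /=; case: (eqVneq (x i) 0) => [->|]; last by left.
by rewrite add0r; right.
Qed.

Definition dsum0 := DSum dsum0_finite.
Definition dsumN x := DSum (dsumN_finite x).
Definition dsumD x y := DSum (dsumD_finite x y).

Fact dsumDA : associative dsumD.
Proof. by move=> x y z; apply: dsumP => i /=; rewrite addrA. Qed.
Fact dsumDC : commutative dsumD.
Proof. by move=> x y; apply: dsumP => i /=; rewrite addrC. Qed.
Fact dsum0D : left_id dsum0 dsumD.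
Proof. by move=> x; apply: dsumP => i /=; rewrite add0r. Qed.
Fact dsumND : left_inverse dsum0 dsumN dsumD.
Proof. by move=> x; apply: dsumP => i /=; rewrite addNr. Qed.
HB.instance Definition _ :=
  GRing.isZmodule.Build dsum dsumDA dsumDC dsum0D dsumND.

Lemma dcoefD (x y : dsum) i : (x + y) i = x i + y i. Proof. by []. Qed.
Lemma dcoefN (x : dsum) i : (- x) i = - x i. Proof. by []. Qed.
Lemma dcoefB (x y : dsum) i : (x - y) i = x i - y i. Proof. by []. Qed.
Lemma dcoef0 i : (0 : dsum) i = 0. Proof. by []. Qed.

Definition dinj_coef i (g : G i) j : G j :=
  if pselect (i = j) is left e then eq_rect i (fun j => G j : Type) g j e else 0.

Lemma dinj_coef_id i (g : G i) : dinj_coef g i = g.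
Proof.
by rewrite /dinj_coef; case: pselect => // e; rewrite (Prop_irrelevance e (erefl i)).
Qed.

Lemma dinj_coef_neq i (g : G i) j : i <> j -> dinj_coef g j = 0.
Proof. by rewrite /dinj_coef; case: pselect. Qed.

Fact dinj_finite i (g : G i) : finite_set [set j | dinj_coef g j != 0].
Proof.
apply: (sub_finite_set _ (finite_set1 i)) => j /= /eqP h.
by apply: contrapT => ij; apply: h; apply: dinj_coef_neq => /esym.
Qed.

Definition dinj i (g : G i) : dsum := DSum (dinj_finite g).

Lemma dinjE i (g : G i) : dinj g i = g. Proof. exact: dinj_coef_id. Qed.

Lemma dinjNE i (g : G i) j : i <> j -> dinj g j = 0.
Proof. exact: dinj_coef_neq. Qed.

Lemma dinjB i : {morph @dinj i : g h / g - h}.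
Proof.
move=> g h; apply: dsumP => j; rewrite dcoefB.
have [ij|ij] := pselect (i = j); first by case: _ / ij; rewrite !dinjE.
by rewrite !dinjNE // subr0.
Qed.
HB.instance Definition _ i := GRing.isZmodMorphism.Build (G i) dsum (@dinj i) (@dinjB i).

(* The map out of the direct sum induced by a family of maps out of the
   summands, see [dlift_inj]. *)
Definition dlift (H : zmodType) (f : forall i, G i -> H) (x : dsum) : H :=
  \sum_(i \in [set i | x i != 0]) f i (x i).

Section Lift.
Variables (H : zmodType) (f : forall i, G i -> H).
Hypothesis fB : forall i, {morph (@f i) : g h / g - h}.

Let f0 i : f (0 : G i) = 0.
Proof. by have := @fB i 0 0; rewrite !subrr. Qed.

Let dliftE (A : set I) (x : dsum) : finite_set A -> [set i | x i != 0] `<=` A ->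
  dlift (@f) x = \sum_(i \in A) f (x i).
Proof.
move=> fA xA; apply: fsbig_widen => // i [_ /= /negP]; rewrite negbK => /eqP ->.
exact: f0.
Qed.

Lemma dliftB : {morph dlift (@f) : x y / x - y}.
Proof.
move=> x y; pose A := [set i | x i != 0] `|` [set i | y i != 0].
have fA : finite_set A by rewrite finite_setU; split; exact: dsum_finite.
rewrite !(@dliftE A) //; last 3 first.
- by move=> i; right.
- by move=> i; left.
- move=> i /=; case: (eqVneq (x i) 0) => [->|]; last by left.
  by rewrite sub0r oppr_eq0; right.
rewrite !fsbig_finite //= -sumrB; apply: eq_bigr => i _.
exact: fB.
Qed.

Lemma dlift0 : dlift (@f) 0 = 0.
Proof. by have := dliftB 0 0; rewrite !subrr. Qed.

Lemma dliftD : {morph dlift (@f) : x y / x + y}.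
Proof.
by move=> t u; have := dliftB (t + u) u; rewrite addrK => ->; rewrite subrK.
Qed.

Lemma dlift_inj i (g : G i) : dlift (@f) (dinj g) = f g.
Proof.
rewrite (@dliftE [set i]) ?fsbig_set1 ?dinjE //.
move=> j /= /eqP h; apply: contrapT => ij; apply: h; apply: dinjNE.
by move=> /esym.
Qed.

End Lift.

Lemma dsum_sum (x : dsum) : x = dlift (@dinj) x.
Proof.
apply: dsumP => i; rewrite /dlift fsbig_finite; last exact: dsum_finite.
rewrite (big_morph (fun y : dsum => y i) (fun y z => dcoefD y z i) (dcoef0 i)) /=.
have [xi|xi] := eqVneq (x i) 0.
  rewrite xi big1_seq // => j /= _; have [ij|ij] := pselect (j = i).
    by subst j; rewrite dinj_coef_id xi.
  by rewrite dinj_coef_neq.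
rewrite (big_rem i) /=; last by rewrite in_fset_set ?inE //; exact: dsum_finite.
rewrite dinj_coef_id big1_seq ?addr0 // => j /=.
rewrite (rem_filter _ (finmap.fset_uniq _)) mem_filter => /andP[/= /eqP ji _].
by rewrite dinj_coef_neq.
Qed.

Lemma dsum_ind (Q : dsum -> Prop) :
    (forall i (g : G i), Q (dinj g)) -> Q 0 -> (forall x y, Q x -> Q y -> Q (x + y)) ->
  forall x, Q x.
Proof.
move=> Qi Q0 QD x; rewrite (dsum_sum x) /dlift fsbig_finite; last exact: dsum_finite.
exact: (big_ind Q).
Qed.

End DirectSum.
Arguments dinj {I G} i g.
Arguments dlift {I G H}.

(* The tensor algebra T = T_S(V) of an S-bimodule V, as the direct sum of the
   tensor powers T^0 = S, T^(m+1) = V (x) T^m. *)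
Section TensorAlgebra.
Variables (S : pzRingType) (V : bimodType S).

Fixpoint tpow (m : nat) : bimodType S :=
  if m is m'.+1 then btensor V (tpow m') else S^o.

Local Notation TG := (fun m => tpow m : zmodType).

Definition tens_alg : Type := dsum TG.
HB.instance Definition _ := GRing.Zmodule.on tens_alg.

Definition tcoef (x : tens_alg) m : tpow m := dcoef x m.
Definition tinj m (t : tpow m) : tens_alg := @dinj nat TG m t.

Lemma tensalgP (x y : tens_alg) : (forall m, tcoef x m = tcoef y m) -> x = y.
Proof. exact: dsumP. Qed.

Lemma tcoefB m : {morph tcoef^~ m : x y / x - y}. Proof. by []. Qed.
Lemma tcoefD m : {morph tcoef^~ m : x y / x + y}. Proof. by []. Qed.
Lemma tcoef0 m : tcoef 0 m = 0. Proof. by []. Qed.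

Lemma tinjB m : {morph @tinj m : x y / x - y}. Proof. exact: dinjB. Qed.
HB.instance Definition _ m :=
  GRing.isZmodMorphism.Build (tpow m) tens_alg (@tinj m) (@tinjB m).

Lemma tinjE m (t : tpow m) : tcoef (tinj t) m = t.
Proof. exact: dinjE. Qed.

Lemma tinjNE m (t : tpow m) k : m <> k -> tcoef (tinj t) k = 0.
Proof. exact: dinjNE. Qed.

Lemma tens_alg_ind (Q : tens_alg -> Prop) :
    (forall m (t : tpow m), Q (tinj t)) -> Q 0 ->
    (forall x y, Q x -> Q y -> Q (x + y)) ->
  forall x, Q x.
Proof. exact: dsum_ind. Qed.

Fact tscale_finite (s : S) (x : tens_alg) :
  finite_set [set m | s *: tcoef x m != 0].
Proof.
apply: sub_finite_set (dsum_finite x) => m /=.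
by apply: contra_neq => xm; rewrite /tcoef xm scaler0.
Qed.

Fact tract_finite (x : tens_alg) (s : S) :
  finite_set [set m | ract (tcoef x m) s != 0].
Proof.
apply: sub_finite_set (dsum_finite x) => m /=.
by apply: contra_neq => xm; rewrite /tcoef xm ract0l.
Qed.

Definition tscale s x : tens_alg := @DSum nat TG _ (tscale_finite s x).
Definition tract x s : tens_alg := @DSum nat TG _ (tract_finite x s).

Fact tscalerA a b x : tscale a (tscale b x) = tscale (a * b) x.
Proof. by apply: tensalgP => m; apply: scalerA. Qed.
Fact tscale1 : left_id 1 tscale.
Proof. by move=> x; apply: tensalgP => m; apply: scale1r. Qed.
Fact tscalerDr : right_distributive tscale +%R.
Proof. by move=> s x y; apply: tensalgP => m; apply: scalerDr. Qed.
Fact tscalerDl x : {morph tscale^~ x : a b / a + b}.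
Proof. by move=> a b; apply: tensalgP => m; apply: scalerDl. Qed.
HB.instance Definition _ := @GRing.Zmodule_isLmodule.Build S tens_alg
  tscale tscalerA tscale1 tscalerDr tscalerDl.

Fact tractDl s : {morph tract^~ s : x y / x + y}.
Proof. by move=> x y; apply: tensalgP => m; apply: ractDl. Qed.
Fact tractDr x : {morph tract x : s t / s + t}.
Proof. by move=> s t; apply: tensalgP => m; apply: ractDr. Qed.
Fact tract1 x : tract x 1 = x.
Proof. by apply: tensalgP => m; apply: ract1. Qed.
Fact tractM x s t : tract x (s * t) = tract (tract x s) t.
Proof. by apply: tensalgP => m; apply: ractM. Qed.
Fact tractZ s x t : tract (s *: x) t = s *: tract x t.
Proof. by apply: tensalgP => m; apply: ractZ. Qed.
HB.instance Definition _ := @Lmodule_isBimodule.Build S tens_alg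
  tract tractDl tractDr tract1 tractM tractZ.

Lemma tcoefZ s x m : tcoef (s *: x) m = s *: tcoef x m. Proof. by []. Qed.
Lemma tcoef_ract x s m : tcoef (ract x s) m = ract (tcoef x m) s.
Proof. by []. Qed.

Lemma tinjZ m s (t : tpow m) : s *: tinj t = tinj (s *: t).
Proof.
apply: tensalgP => k; rewrite tcoefZ.
have [mk|mk] := pselect (m = k); first by subst k; rewrite !tinjE.
by rewrite !tinjNE // scaler0.
Qed.

Lemma tinj_ract m s (t : tpow m) : ract (tinj t) s = tinj (ract t s).
Proof.
apply: tensalgP => k; rewrite tcoef_ract.
have [mk|mk] := pselect (m = k); first by subst k; rewrite !tinjE.
by rewrite !tinjNE // ract0l.
Qed.

(* Ring structure: [tshift v x] is v (x) x, and the product is the bilinear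
   extension of concatenation of tensors. *)

Definition tshift (v : V) : tens_alg -> tens_alg :=
  @dlift nat TG tens_alg (fun m t => @tinj m.+1 (btens v t)).

Let shiftB_aux v m :
  {morph (fun t : tpow m => @tinj m.+1 (btens v t)) : x y / x - y}.
Proof.
move=> x y; rewrite -tinjB; congr tinj.
by apply/eqP; rewrite eq_sym subr_eq -btensDr subrK.
Qed.

Lemma tshiftB v : {morph tshift v : x y / x - y}.
Proof. exact: dliftB (shiftB_aux v). Qed.

Lemma tshift0 v : tshift v 0 = 0.
Proof. by have := tshiftB v 0 0; rewrite !subrr. Qed.

Lemma tshiftD v : {morph tshift v : x y / x + y}.
Proof. exact: dliftD (shiftB_aux v). Qed.

Lemma tshift_inj v m (t : tpow m) : tshift v (tinj t) = @tinj m.+1 (btens v t).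
Proof. exact: dlift_inj (shiftB_aux v) _ _. Qed.

Lemma tshiftDl v w x : tshift (v + w) x = tshift v x + tshift w x.
Proof.
elim/tens_alg_ind: x => [m t||x y hx hy].
- by rewrite !tshift_inj btensDl raddfD.
- by rewrite !tshift0 addr0.
- by rewrite !tshiftD hx hy addrACA.
Qed.

Lemma tshiftZ v s x : tshift (ract v s) x = tshift v (s *: x).
Proof.
elim/tens_alg_ind: x => [m t||x y hx hy].
- by rewrite tinjZ !tshift_inj btensZ.
- by rewrite scaler0 !tshift0.
- by rewrite scalerDr !tshiftD hx hy.
Qed.

Lemma tshift_scale v s x : tshift (s *: v) x = s *: tshift v x.
Proof.
elim/tens_alg_ind: x => [m t||x y hx hy].
- by rewrite !tshift_inj tinjZ btens_scale.
- by rewrite !tshift0 scaler0.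
- by rewrite !tshiftD hx hy scalerDr.
Qed.

Fixpoint tmul_hom m : tpow m -> tens_alg -> tens_alg :=
  match m with
  | 0 => fun t x => (t : S) *: x
  | m'.+1 => fun t x => tlift (fun (v : rmod V) u => tshift v (tmul_hom u x)) t
  end.

Let tmul_hom_facts m :
  (forall x, {morph (fun t : tpow m => tmul_hom t x) : t u / t + u}) /\
  (forall s (t : tpow m) x, tmul_hom (s *: t) x = s *: tmul_hom t x).
Proof.
elim: m => [|m [IHD IHZ]]; split.
- by move=> x t u; apply: (scalerDl x t u).
- by move=> s t x; rewrite /= scalerA.
all: have bal x : balanced (fun (v : rmod V) (u : tpow m) => tshift v (tmul_hom u x))
  by split=> [v w u|v u w|v s u]; rewrite /= ?tshiftDl ?IHD ?tshiftD ?IHZ -?tshiftZ.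
- by move=> x t u; apply: (tliftD (bal x)).
- move=> s t x /=; elim/btensor_ind: t => [v w||t u ht hu].
  + rewrite btens_scale (tlift_tens (bal x)) tshift_scale.
    by rewrite [in RHS](tlift_tens (bal x)).
  + by rewrite scaler0 (tlift0 (bal x)) scaler0.
  + by rewrite scalerBr !(tliftB (bal x)) scalerBr ht hu.
Qed.

Lemma tmul_homDl m x : {morph (fun t : tpow m => tmul_hom t x) : t u / t + u}.
Proof. by case: (tmul_hom_facts m) => h _; apply: h. Qed.

Lemma tmul_homZ m s (t : tpow m) x : tmul_hom (s *: t) x = s *: tmul_hom t x.
Proof. by case: (tmul_hom_facts m) => _ h; apply: h. Qed.

Lemma tmul_homBl m x : {morph (fun t : tpow m => tmul_hom t x) : t u / t - u}.
Proof.
move=> t u /=; apply: (addIr (tmul_hom u x)).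
by rewrite -tmul_homDl !subrK.
Qed.

Lemma tmul_hom0l m x : tmul_hom (0 : tpow m) x = 0.
Proof. by have := tmul_homBl x (0 : tpow m) 0; rewrite /= !subrr. Qed.

Lemma tmul_homS m v (u : tpow m) x :
  tmul_hom (btens v u : tpow m.+1) x = tshift v (tmul_hom u x).
Proof.
apply: (tlift_tens (f := fun (v : rmod V) (u : tpow m) => tshift v (tmul_hom u x))).
by split=> [v1 w u1|v1 u1 w|v1 s u1];
  rewrite /= ?tshiftDl ?tmul_homDl ?tshiftD ?tmul_homZ -?tshiftZ.
Qed.

Lemma tpow_ind (Q : forall m, tpow m -> Prop) :
    (forall s : S, Q 0%N s) ->
    (forall m v (u : tpow m), Q m u -> Q m.+1 (btens v u)) ->
    (forall m, Q m 0) -> (forall m (t u : tpow m), Q m t -> Q m u -> Q m (t - u)) ->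
  forall m t, Q m t.
Proof.
move=> Qs QS Q0 QB; elim=> [|m IHm] t; first exact: Qs.
elim/btensor_ind: t => [v w||t u ht hu].
- exact: QS.
- exact: (Q0 m.+1).
- exact: (QB m.+1).
Qed.

Lemma tmul_homDr m (t : tpow m) : {morph tmul_hom t : x y / x + y}.
Proof.
move=> x y; elim/tpow_ind: m / t => [s|m v u IH|m|m t u ht hu].
- exact: (scalerDr s x y).
- by rewrite !tmul_homS IH tshiftD.
- by rewrite !tmul_hom0l addr0.
- by rewrite !tmul_homBl ht hu opprD addrACA.
Qed.

Lemma tmul_hom0r m (t : tpow m) : tmul_hom t 0 = 0.
Proof. by apply: (addIr (tmul_hom t 0)); rewrite -tmul_homDr !add0r. Qed.

Definition tmul (x y : tens_alg) : tens_alg :=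
  @dlift nat TG tens_alg (fun m t => tmul_hom t y) x.

Definition tone : tens_alg := @tinj 0 (1 : S).

Lemma tmulDl : left_distributive tmul +%R.
Proof. by move=> x y z; apply: dliftD => m; apply: tmul_homBl. Qed.

Lemma tmul0l x : tmul 0 x = 0.
Proof. by apply: (addIr (tmul 0 x)); rewrite -tmulDl !add0r. Qed.

Lemma tmul_inj m (t : tpow m) x : tmul (tinj t) x = tmul_hom t x.
Proof. by apply: dlift_inj => k; apply: tmul_homBl. Qed.

Lemma tmulDr : right_distributive tmul +%R.
Proof.
move=> x y z; elim/tens_alg_ind: x => [m t||x1 x2 h1 h2].
- by rewrite !tmul_inj tmul_homDr.
- by rewrite !tmul0l addr0.
- by rewrite !tmulDl h1 h2 addrACA.
Qed.

Lemma tmul0r x : tmul x 0 = 0.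
Proof. by apply: (addIr (tmul x 0)); rewrite -tmulDr !add0r. Qed.

Lemma tmulBl x y z : tmul (x - y) z = tmul x z - tmul y z.
Proof. by apply: (addIr (tmul y z)); rewrite -tmulDl !subrK. Qed.

Fact tmul1l : left_id tone tmul.
Proof. by move=> x; rewrite tmul_inj /= scale1r. Qed.

Lemma tmulZ s x y : tmul (s *: x) y = s *: tmul x y.
Proof.
elim/tens_alg_ind: x => [m t||x1 x2 h1 h2].
- by rewrite tinjZ !tmul_inj tmul_homZ.
- by rewrite scaler0 tmul0l scaler0.
- by rewrite scalerDr !tmulDl h1 h2 scalerDr.
Qed.

Lemma tmul_shift v x y : tmul (tshift v x) y = tshift v (tmul x y).
Proof.
elim/tens_alg_ind: x => [m t||x1 x2 h1 h2].
- by rewrite tshift_inj !tmul_inj tmul_homS.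
- by rewrite tshift0 tmul0l tshift0.
- by rewrite tshiftD !tmulDl h1 h2 tshiftD.
Qed.

Lemma tmul_homA m (t : tpow m) x y :
  tmul_hom t (tmul x y) = tmul (tmul_hom t x) y.
Proof.
elim/tpow_ind: m / t => [s|m v u IH|m|m t u ht hu].
- by rewrite /= tmulZ.
- by rewrite !tmul_homS IH tmul_shift.
- by rewrite !tmul_hom0l tmul0l.
- by rewrite !tmul_homBl tmulBl ht hu.
Qed.

Fact tmulA : associative tmul.
Proof.
move=> x y z; elim/tens_alg_ind: x => [m t||x1 x2 h1 h2].
- by rewrite !tmul_inj tmul_homA.
- by rewrite !tmul0l.
- by rewrite !tmulDl h1 h2.
Qed.

Lemma tmul_hom_scalar m (t : tpow m) (s : S) :
  tmul_hom t (@tinj 0 s) = tinj (ract t s).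
Proof.
elim/tpow_ind: m / t => [a|m v u IH|m|m t u ht hu].
- by rewrite /= tinjZ.
- by rewrite tmul_homS IH tshift_inj btens_ract.
- by rewrite tmul_hom0l ract0l raddf0.
- by rewrite tmul_homBl ht hu -raddfB ractBl.
Qed.

Fact tmul1r : right_id tone tmul.
Proof.
move=> x; elim/tens_alg_ind: x => [m t||x1 x2 h1 h2].
- by rewrite tmul_inj tmul_hom_scalar ract1.
- by rewrite tmul0l.
- by rewrite tmulDl h1 h2.
Qed.

HB.instance Definition _ :=
  GRing.Zmodule_isPzRing.Build tens_alg tmulA tmul1l tmul1r tmulDl tmulDr.

(* The bimodule structure is multiplication by elements of T^0 = S. *)
Lemma tens_alg_scaleE (s : S) (x : tens_alg) : s *: x = @tinj 0 s * x.
Proof. by rewrite [RHS]tmul_inj. Qed.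

Lemma tens_alg_ractE (s : S) (x : tens_alg) : ract x s = x * @tinj 0 s.
Proof.
elim/tens_alg_ind: x => [m t||x1 x2 h1 h2].
- by rewrite tinj_ract -tmul_hom_scalar -tmul_inj.
- by rewrite ract0l mul0r.
- by rewrite ractDl h1 h2 mulrDl.
Qed.

Lemma tens_alg1E : 1 = @tinj 0 (1 : S) :> tens_alg.
Proof. by []. Qed.

Definition tvar (v : V) : tens_alg :=
  @tinj 1 (@btens S V (tpow 0) v (1 : S)).

Lemma tvar_mul v x : tvar v * x = tshift v x.
Proof. by rewrite [LHS]tmul_inj tmul_homS /= scale1r. Qed.

Lemma tvarE v : tvar v = tshift v 1.
Proof. by rewrite -tvar_mul mulr1. Qed.

Lemma tvarD : {morph tvar : v w / v + w}.
Proof. by move=> v w; rewrite !tvarE tshiftDl. Qed.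

Lemma tvarZ s v : tvar (s *: v) = s *: tvar v.
Proof. by rewrite tinjZ btens_scale. Qed.

Lemma tvar_ract s v : tvar (ract v s) = ract (tvar v) s.
Proof. by rewrite tvarE tshiftZ -tvar_mul tens_alg_scaleE mulr1 tens_alg_ractE. Qed.

(* [tdeg_lt m] is T^{<= m-1}; in particular [tdeg_lt 0] is 0. *)
Definition tdeg_lt m : set tens_alg :=
  [set x | forall k, (m <= k)%N -> tcoef x k = 0].

Definition tdeg_le m : set tens_alg := tdeg_lt m.+1.

(* The projection p^m, viewed as an endomorphism of T with image T^m. *)
Definition thom m (x : tens_alg) : tens_alg := tinj (tcoef x m).

Definition tpure m : set tens_alg := [set x | thom m x = x].

Lemma thomB m : {morph thom m : x y / x - y}.
Proof. by move=> x y; rewrite /thom tcoefB raddfB. Qed.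

Lemma thomZ m s x : thom m (s *: x) = s *: thom m x.
Proof. by rewrite /thom tcoefZ tinjZ. Qed.

Lemma thom_ract m x s : thom m (ract x s) = ract (thom m x) s.
Proof. by rewrite /thom tcoef_ract tinj_ract. Qed.

Lemma tcoef_shiftS v x m : tcoef (tshift v x) m.+1 = btens v (tcoef x m).
Proof.
elim/tens_alg_ind: x => [k t||x y hx hy].
- rewrite tshift_inj; have [km|km] := pselect (k = m).
    by subst k; rewrite !tinjE.
  rewrite !tinjNE //; last by case.
  by apply: (addIr (btens v 0)); rewrite -btensDr !add0r.
- rewrite tshift0 tcoef0.
  by apply: (addIr (btens v 0)); rewrite -btensDr !add0r.
- by rewrite tshiftD !tcoefD hx hy btensDr.
Qed.

Lemma tcoef_shift0 v x : tcoef (tshift v x) 0 = 0.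
Proof.
elim/tens_alg_ind: x => [k t||x y hx hy].
- by rewrite tshift_inj tinjNE.
- by rewrite tshift0.
- by rewrite tshiftD tcoefD hx hy addr0.
Qed.

Lemma tmul_hom_deg m (t : tpow m) j y :
  tdeg_lt j y -> tdeg_lt (m + j)%N (tmul_hom t y).
Proof.
move=> yj; elim/tpow_ind: m / t => [s|m v u IH|m|m t u ht hu] k.
- by rewrite add0n => jk; rewrite tcoefZ yj // scaler0.
- rewrite tmul_homS addSn; case: k => [//|k] mjk; rewrite tcoef_shiftS IH //.
  by apply: (addIr (btens v 0)); rewrite -btensDr !add0r.
- by rewrite tmul_hom0l.
- by move=> mk; rewrite tmul_homBl tcoefB ht // hu // subrr.
Qed.

Lemma tdeg_mul N j x y : tdeg_lt j y ->
  (forall m, tcoef x m != 0 -> (m + j <= N)%N) -> tdeg_lt N (x * y).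
Proof.
move=> yj xN; rewrite -[x * y]/(tmul x y) /tmul /dlift.
rewrite fsbig_finite; last exact: dsum_finite.
rewrite big_seq; apply: (big_ind (tdeg_lt N)) => //.
  by move=> a b ha hb k Nk; rewrite tcoefD ha // hb // addr0.
move=> m; rewrite in_fset_set; last exact: dsum_finite.
rewrite inE /= => /xN mjN k Nk.
by apply: (tmul_hom_deg (tcoef x m) yj); apply: leq_trans Nk.
Qed.

Lemma tdeg_ltB m x y : tdeg_lt m x -> tdeg_lt m y -> tdeg_lt m (x - y).
Proof. by move=> hx hy k mk; rewrite tcoefB hx // hy // subrr. Qed.

Lemma tdeg_ltM i j x y :
  tdeg_lt i x -> tdeg_lt j.+1 y -> tdeg_lt (i + j)%N (x * y).
Proof.
move=> hx hy; apply: (tdeg_mul hy) => m xm; rewrite addnS -addSn leq_add2r.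
by rewrite ltnNge; apply: contra xm => im; rewrite hx.
Qed.

Lemma tdeg_ltMl i j x y :
  tdeg_lt i.+1 x -> tdeg_lt j y -> tdeg_lt (i + j)%N (x * y).
Proof.
move=> hx hy; apply: (tdeg_mul hy) => m xm; rewrite leq_add2r.
by rewrite leqNgt; apply: contra xm => im; rewrite hx.
Qed.

Lemma tdeg_lt1 : tdeg_lt 1 1.
Proof. by case=> [//|k] _; rewrite tens_alg1E tinjNE. Qed.

(* The augmentation p^0 : T -> T^0 = S. *)
Definition taug (x : tens_alg) : S := tcoef x 0.

Fact taugD : {morph taug : x y / x + y}. Proof. by []. Qed.
Fact taugB : {morph taug : x y / x - y}. Proof. by []. Qed.
HB.instance Definition _ := GRing.isZmodMorphism.Build tens_alg S taug taugB.

Fact taugM : monoid_morphism taug.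
Proof.
split=> [|x y]; first by rewrite /taug tens_alg1E tinjE.
elim/tens_alg_ind: x => [m t||x1 x2 h1 h2].
- rewrite -[tinj t * y]/(tmul _ _) tmul_inj.
  elim/tpow_ind: m / t => [s|m v u IH|m|m t u ht hu].
  + by rewrite /taug tcoefZ tinjE.
  + by rewrite tmul_homS /taug tcoef_shift0 tinjNE // mul0r.
  + by rewrite tmul_hom0l !raddf0 mul0r.
  + by rewrite tmul_homBl (taugB (tmul_hom t y)) ht hu -mulrBl -taugB -raddfB.
- by rewrite mul0r raddf0 mul0r.
- by rewrite mulrDl !taugD mulrDl h1 h2.
Qed.
HB.instance Definition _ := GRing.isMonoidMorphism.Build tens_alg S taug taugM.

End TensorAlgebra.
(* The quotient B/<X> of a ring by the two-sided ideal generated by X. *)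
Section QuotientRing.
Variables (B : pzRingType) (X : set B).

Inductive ideal_gen : set B :=
  | ideal_in x of X x : ideal_gen x
  | ideal0 : ideal_gen 0
  | idealB x y of ideal_gen x & ideal_gen y : ideal_gen (x - y)
  | idealMl b x of ideal_gen x : ideal_gen (b * x)
  | idealMr x b of ideal_gen x : ideal_gen (x * b).

Definition ideal_pred : {pred B} := fun x => `[< ideal_gen x >].

Fact ideal_zmod_closed : zmod_closed ideal_pred.
Proof.
split; first by apply/asboolP; exact: ideal0.
by move=> x y /asboolP hx /asboolP hy; apply/asboolP; exact: idealB.
Qed.
HB.instance Definition _ :=
  GRing.isZmodClosed.Build B ideal_pred ideal_zmod_closed.

Definition qring : Type := Quotient.quot ideal_pred.
HB.instance Definition _ := GRing.Zmodule.on qring.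

Definition qproj : B -> qring := qpi ideal_pred.

Lemma qprojP x y : qproj x = qproj y <-> ideal_gen (x - y).
Proof. by split=> [/qpiP/asboolP|h] //; apply/qpiP/asboolP. Qed.

Lemma qprojK (a : qring) : qproj (repr a) = a. Proof. exact: qreprK. Qed.

Lemma qproj_repr x : ideal_gen (repr (qproj x) - x).
Proof. by apply/qprojP; rewrite qprojK. Qed.

Fact qprojB : {morph qproj : x y / x - y}. Proof. exact: qpiB. Qed.
HB.instance Definition _ := GRing.isZmodMorphism.Build B qring qproj qprojB.

Definition qone : qring := qproj 1.
Definition qmul (a b : qring) : qring := qproj (repr a * repr b).

Lemma qmul_proj x y : qmul (qproj x) (qproj y) = qproj (x * y).
Proof.
apply/qprojP; set x' := repr _; set y' := repr _.
have -> : x' * y' - x * y = x' * (y' - y) - (- (x' - x)) * y.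
  by rewrite mulrBr mulNr opprK mulrBl addrA subrK.
apply: idealB; first by apply/idealMl/qproj_repr.
by apply: idealMr; rewrite -sub0r; apply: idealB; [exact: ideal0 | exact: qproj_repr].
Qed.

Fact qmulA : associative qmul.
Proof.
by move=> a b c; rewrite -(qprojK a) -(qprojK b) -(qprojK c) !qmul_proj mulrA.
Qed.
Fact qmul1l : left_id qone qmul.
Proof. by move=> a; rewrite -(qprojK a) qmul_proj mul1r. Qed.
Fact qmul1r : right_id qone qmul.
Proof. by move=> a; rewrite -(qprojK a) qmul_proj mulr1. Qed.
Fact qmulDl : left_distributive qmul +%R.
Proof.
move=> a b c; rewrite -(qprojK a) -(qprojK b) -(qprojK c).
by rewrite -(raddfD qproj) !qmul_proj -(raddfD qproj) mulrDl.
Qed.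
Fact qmulDr : right_distributive qmul +%R.
Proof.
move=> a b c; rewrite -(qprojK a) -(qprojK b) -(qprojK c).
by rewrite -(raddfD qproj) !qmul_proj -(raddfD qproj) mulrDr.
Qed.
HB.instance Definition _ :=
  GRing.Zmodule_isPzRing.Build qring qmulA qmul1l qmul1r qmulDl qmulDr.

Fact qproj_monoid_morphism : monoid_morphism qproj.
Proof. by split=> // x y; rewrite [RHS]qmul_proj. Qed.
HB.instance Definition _ :=
  GRing.isMonoidMorphism.Build B qring qproj qproj_monoid_morphism.

Section Lift.
Variables (C : pzRingType) (f : {rmorphism B -> C}).
Hypothesis fX : forall x, X x -> f x = 0.

Definition qlift of (forall x, X x -> f x = 0) := fun a : qring => f (repr a).

Let f_ideal x : ideal_gen x -> f x = 0.
Proof.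
elim=> {x} [x /fX|| x y _ hx _ hy|b x _ hx|x b _ hx] //.
- exact: raddf0.
- by rewrite raddfB /= hx hy subrr.
- by rewrite rmorphM hx mulr0.
- by rewrite rmorphM hx mul0r.
Qed.

Lemma qlift_proj x : qlift fX (qproj x) = f x.
Proof.
by have /eqP := f_ideal (qproj_repr x); rewrite raddfB subr_eq0 => /eqP.
Qed.

Fact qliftB : {morph qlift fX : a b / a - b}.
Proof.
move=> a b; rewrite -(qprojK a) -(qprojK b) -(raddfB qproj) !qlift_proj.
exact: raddfB.
Qed.
HB.instance Definition _ := GRing.isZmodMorphism.Build qring C (qlift fX) qliftB.

Fact qliftM : monoid_morphism (qlift fX).
Proof.
split=> [|a b]; first by rewrite -(rmorph1 qproj) qlift_proj rmorph1.
rewrite -(qprojK a) -(qprojK b) -(rmorphM qproj) !qlift_proj.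
exact: rmorphM.
Qed.
HB.instance Definition _ := GRing.isMonoidMorphism.Build qring C (qlift fX) qliftM.

End Lift.
End QuotientRing.

(* H/(H /\ K) for two subgroups H and K of M. *)
Section Subquotient.
Variables (M : zmodType) (H K : zmodClosed M).

Definition subgrp : Type := {x : M | x \in H}.
HB.instance Definition _ := SubChoice.on subgrp.
HB.instance Definition _ := [SubChoice_isSubZmodule of subgrp by <:].

Definition sub_pred : {pred subgrp} := fun x => \val x \in K.

Fact sub_pred_zmod_closed : zmod_closed sub_pred.
Proof.
split; first by rewrite -[_ \in _]/(\val (0 : subgrp) \in K) raddf0 rpred0.
move=> x y hx hy; rewrite -[_ \in _]/(\val (x - y) \in K) raddfB.
exact: rpredB hx hy.
Qed.
HB.instance Definition _ :=
  GRing.isZmodClosed.Build subgrp sub_pred sub_pred_zmod_closed.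

Definition subquot : Type := Quotient.quot sub_pred.
HB.instance Definition _ := GRing.Zmodule.on subquot.

(* The class of x when x is in H, and 0 otherwise. *)
Definition subcls (x : M) : subquot := qpi sub_pred (insubd 0 x).

Definition subrep (a : subquot) : M := \val (repr a).

Lemma subrep_in (a : subquot) : subrep a \in H. Proof. exact: (valP (repr a)). Qed.

Lemma subrepK (a : subquot) : subcls (subrep a) = a.
Proof. by rewrite /subcls /subrep valKd qreprK. Qed.

Lemma subclsP x y : x \in H -> y \in H ->
  (subcls x = subcls y) <-> (x - y \in K).
Proof.
move=> hx hy; rewrite qpiP.
by rewrite -[_ \in sub_pred]/(\val _ \in K) raddfB /= !insubdK.
Qed.

Lemma subclsB x y : x \in H -> y \in H -> subcls (x - y) = subcls x - subcls y.
Proof.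
move=> hx hy; rewrite /subcls -[RHS]raddfB; congr qpi; apply: val_inj.
by rewrite raddfB /= !insubdK // rpredB.
Qed.

Lemma subrep_cls x : x \in H -> subrep (subcls x) - x \in K.
Proof. by move=> hx; apply/subclsP; rewrite ?subrep_in ?subrepK. Qed.

End Subquotient.
Section AssociatedGraded.
Variables (S : pzRingType) (V : bimodType S) (P : set (tens_alg V)).

(* [filt_lt m] is U(P)^{<= m-1}; in particular [filt_lt 0] is 0. *)
Definition filt_lt (m : nat) : {pred qring P} :=
  fun u => `[< exists2 t, tdeg_lt m t & qproj P t = u >].

Lemma filt_ltP m u :
  reflect (exists2 t, tdeg_lt m t & qproj P t = u) (u \in filt_lt m).
Proof. exact: asboolP. Qed.

Fact filt_lt_zmod_closed m : zmod_closed (filt_lt m).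
Proof.
split; first by apply/filt_ltP; exists 0; rewrite ?raddf0.
move=> _ _ /filt_ltP[x hx <-] /filt_ltP[y hy <-]; apply/filt_ltP.
by exists (x - y); rewrite ?raddfB //; apply: tdeg_ltB.
Qed.
HB.instance Definition _ m :=
  GRing.isZmodClosed.Build (qring P) (filt_lt m) (filt_lt_zmod_closed m).

Lemma filt_ltM i j u v :
  u \in filt_lt i -> v \in filt_lt j.+1 -> u * v \in filt_lt (i + j)%N.
Proof.
move=> /filt_ltP[x hx <-] /filt_ltP[y hy <-]; apply/filt_ltP.
by exists (x * y); rewrite ?rmorphM //; apply: tdeg_ltM.
Qed.

Lemma filt_ltMl i j u v :
  u \in filt_lt i.+1 -> v \in filt_lt j -> u * v \in filt_lt (i + j)%N.
Proof.
move=> /filt_ltP[x hx <-] /filt_ltP[y hy <-]; apply/filt_ltP.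
by exists (x * y); rewrite ?rmorphM //; apply: tdeg_ltMl.
Qed.

Lemma filt_ltS m u : u \in filt_lt m -> u \in filt_lt m.+1.
Proof.
move=> /filt_ltP[x hx <-]; apply/filt_ltP; exists x => // k mk.
by apply: hx; apply: ltnW.
Qed.

(* gr^m = U^{<= m} / U^{<= m-1} *)
Definition gr_comp m : zmodType := subquot (filt_lt m.+1) (filt_lt m).

Definition gr : Type := dsum gr_comp.
HB.instance Definition _ := GRing.Zmodule.on gr.

(* The class u + U^{<= m-1}, in degree m, of u in U^{<= m}. *)
Definition grcls m (u : qring P) : gr := dinj m (subcls (filt_lt m.+1) (filt_lt m) u).

Lemma grclsB m u v : u \in filt_lt m.+1 -> v \in filt_lt m.+1 ->
  grcls m (u - v) = grcls m u - grcls m v.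
Proof. by move=> hu hv; rewrite /grcls subclsB // raddfB. Qed.

Lemma grcls0 m : grcls m 0 = 0.
Proof. by rewrite -(subrr 0) grclsB ?rpred0 // subrr. Qed.

Lemma grclsD m u v : u \in filt_lt m.+1 -> v \in filt_lt m.+1 ->
  grcls m (u + v) = grcls m u + grcls m v.
Proof.
move=> hu hv; rewrite -[v in LHS]opprK grclsB ?rpredN // -[- v]sub0r.
by rewrite grclsB ?rpred0 // grcls0 sub0r opprK.
Qed.

Lemma grcls_eq m u v : u \in filt_lt m.+1 -> v \in filt_lt m.+1 ->
  u - v \in filt_lt m -> grcls m u = grcls m v.
Proof. by move=> hu hv huv; congr dinj; apply/subclsP. Qed.

Lemma gr_ind (Q : gr -> Prop) :
    (forall m u, u \in filt_lt m.+1 -> Q (grcls m u)) -> Q 0 ->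
    (forall x y, Q x -> Q y -> Q (x + y)) ->
  forall x, Q x.
Proof.
move=> Qc Q0 QD; apply: dsum_ind => // m a.
by rewrite -(subrepK a); apply: Qc; apply: subrep_in.
Qed.

(* The product is induced by (u, v) |-> u * v on representatives. *)
Definition gr_mul_hom i (a : gr_comp i) (y : gr) : gr :=
  dlift (fun j (b : gr_comp j) => grcls (i + j)%N (subrep a * subrep b)) y.

Definition gr_mul (x y : gr) : gr := dlift (fun i a => @gr_mul_hom i a y) x.

Let grM i j u u' v v' : u \in filt_lt i.+1 -> u' \in filt_lt i.+1 ->
  v \in filt_lt j.+1 -> v' \in filt_lt j.+1 ->
  u - u' \in filt_lt i -> v - v' \in filt_lt j ->
  grcls (i + j)%N (u * v) = grcls (i + j)%N (u' * v').
Proof.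
move=> hu hu' hv hv' huu hvv; apply: grcls_eq; rewrite -?addSn ?filt_ltM //.
have -> : u * v - u' * v' = (u - u') * v + u' * (v - v').
  by rewrite mulrBl mulrBr addrA subrK.
by apply: rpredD; [exact: filt_ltM | exact: filt_ltMl].
Qed.

Let grrepB i (a b : gr_comp i) :
  subrep (a - b) - (subrep a - subrep b) \in filt_lt i.
Proof.
have ha := subrep_in a; have hb := subrep_in b.
apply/(@subclsP _ (filt_lt i.+1)); rewrite ?subrep_in ?rpredB //.
by rewrite subclsB // !subrepK.
Qed.

Let gr_in_r i j (a : gr_comp i) (b : gr_comp j) :
  subrep a * subrep b \in filt_lt (i + j)%N.+1.
Proof. by rewrite -addSn; apply: filt_ltM; apply: subrep_in. Qed.

Let gr_mul_r i (a : gr_comp i) j :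
  {morph (fun b : gr_comp j => grcls (i + j)%N (subrep a * subrep b)) : b c / b - c}.
Proof.
move=> b c /=; rewrite -grclsB // -mulrBr.
by apply: grM; rewrite ?subrep_in ?subrr ?rpred0 ?grrepB // rpredB ?subrep_in.
Qed.

Let gr_mul_homD i (a : gr_comp i) : {morph gr_mul_hom a : x y / x + y}.
Proof. exact: dliftD (gr_mul_r a). Qed.

Let gr_mul_hom0 i (a : gr_comp i) : gr_mul_hom a 0 = 0.
Proof. exact: dlift0 (gr_mul_r a). Qed.

Let gr_mul_hom_inj i (a : gr_comp i) j (b : gr_comp j) :
  gr_mul_hom a (dinj j b) = grcls (i + j)%N (subrep a * subrep b).
Proof. exact: dlift_inj (gr_mul_r a) j b. Qed.

Let gr_mul_l y i : {morph (fun a : gr_comp i => gr_mul_hom a y) : a c / a - c}.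
Proof.
move=> a c /=; elim/dsum_ind: y => [j b||y z hy hz].
- rewrite !gr_mul_hom_inj -grclsB // -mulrBl.
  by apply: grM; rewrite ?subrep_in ?subrr ?rpred0 ?grrepB // rpredB ?subrep_in.
- by rewrite !gr_mul_hom0 subr0.
- by rewrite !gr_mul_homD hy hz opprD addrACA.
Qed.

Fact gr_mulDl : left_distributive gr_mul +%R.
Proof. by move=> x y z; apply: (@dliftD _ _ gr (fun i a => @gr_mul_hom i a z) (gr_mul_l z)). Qed.

Lemma gr_mul0l x : gr_mul 0 x = 0.
Proof. by apply: (addIr (gr_mul 0 x)); rewrite -gr_mulDl !add0r. Qed.

Let gr_mul_comp i (a : gr_comp i) y : gr_mul (dinj i a) y = gr_mul_hom a y.
Proof. exact: (@dlift_inj _ _ gr (fun i a => @gr_mul_hom i a y) (gr_mul_l y)). Qed.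

Fact gr_mulDr : right_distributive gr_mul +%R.
Proof.
move=> x y z; elim/dsum_ind: x => [i a||x1 x2 h1 h2].
- by rewrite !gr_mul_comp gr_mul_homD.
- by rewrite !gr_mul0l addr0.
- by rewrite !gr_mulDl h1 h2 addrACA.
Qed.

Lemma gr_mul0r x : gr_mul x 0 = 0.
Proof. by apply: (addIr (gr_mul x 0)); rewrite -gr_mulDr !add0r. Qed.

Lemma gr_mul_cls i j u v : u \in filt_lt i.+1 -> v \in filt_lt j.+1 ->
  gr_mul (grcls i u) (grcls j v) = grcls (i + j)%N (u * v).
Proof.
move=> hu hv; rewrite gr_mul_comp gr_mul_hom_inj.
by apply: grM; rewrite ?subrep_in // subrep_cls.
Qed.

Definition gr_one : gr := grcls 0 1.

Lemma filt1 : 1 \in filt_lt 1.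
Proof. by apply/filt_ltP; exists 1; rewrite ?rmorph1 //; apply: tdeg_lt1. Qed.

Fact gr_mulA : associative gr_mul.
Proof.
move=> x y z; elim/gr_ind: x => [i u hu||x1 x2 h1 h2]; last 2 first.
- by rewrite !gr_mul0l.
- by rewrite !gr_mulDl h1 h2.
elim/gr_ind: y => [j v hv||x1 x2 h1 h2]; last 2 first.
- by rewrite !(gr_mul0l, gr_mul0r).
- by rewrite !(gr_mulDl, gr_mulDr) h1 h2.
elim/gr_ind: z => [k w hw||x1 x2 h1 h2]; last 2 first.
- by rewrite !gr_mul0r.
- by rewrite !gr_mulDr h1 h2.
have filtM a b c d : c \in filt_lt a.+1 -> d \in filt_lt b.+1 ->
  c * d \in filt_lt (a + b)%N.+1 by rewrite -addSn; exact: filt_ltM.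
rewrite (gr_mul_cls hv hw) (gr_mul_cls hu hv).
rewrite (gr_mul_cls hu (filtM _ _ _ _ hv hw)) (gr_mul_cls (filtM _ _ _ _ hu hv) hw).
by rewrite addnA mulrA.
Qed.

Fact gr_mul1l : left_id gr_one gr_mul.
Proof.
move=> x; elim/gr_ind: x => [i u hu||x1 x2 h1 h2].
- by rewrite gr_mul_cls ?filt1 // mul1r.
- by rewrite gr_mul0r.
- by rewrite gr_mulDr h1 h2.
Qed.

Fact gr_mul1r : right_id gr_one gr_mul.
Proof.
move=> x; elim/gr_ind: x => [i u hu||x1 x2 h1 h2].
- by rewrite gr_mul_cls ?filt1 // mulr1 addn0.
- by rewrite gr_mul0l.
- by rewrite gr_mulDl h1 h2.
Qed.

HB.instance Definition _ :=
  GRing.Zmodule_isPzRing.Build gr gr_mulA gr_mul1l gr_mul1r gr_mulDl gr_mulDr.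

Lemma grclsM i j u v : u \in filt_lt i.+1 -> v \in filt_lt j.+1 ->
  grcls i u * grcls j v = grcls (i + j)%N (u * v).
Proof. exact: gr_mul_cls. Qed.

(* R_P = (+)_m p^m(P^{<= m}) *)
Definition leading : set (tens_alg V) :=
  [set x | forall m, exists2 y, P y /\ tdeg_le m y & thom m x = thom m y].

(* U(P) = T/<P> is a PBW-deformation of A(R) = T/<R>.  There is at most one
   ring morphism phi satisfying the formula; it is automatically graded and
   S-linear. *)
Definition PBW_deformation (R : set (tens_alg V)) : Prop :=
  R `<=` leading /\
  exists phi : {rmorphism qring R -> gr},
    (forall m x, tpure m x -> phi (qproj R x) = grcls m (qproj P x)) /\
    bijective phi.

End AssociatedGraded.
Arguments filt_lt {S V} P m.
Arguments grcls {S V} P m u.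
Arguments PBW_deformation {S V} P R.

(* M = M^m for a module M with homogeneous components [comp]. *)
Definition pure (G : Type) (comp : nat -> set G) (m : nat) : Prop :=
  forall x, comp m x.

Definition projective (A : pzRingType) (M : lmodType A) : Prop :=
  forall (N N' : lmodType A) (g : {linear N -> N'}) (f : {linear M -> N'}),
    (forall y, exists x, g x = y) ->
  exists h : {linear M -> N}, forall x, g (h x) = f x.

(* Tor over a graded ring A with homogeneous components A^m = [gA m], as the
   homology of N (x)_A F for the standard graded free resolution F of M: F_0
   is the free module on the homogeneous elements of M, and F_(i+1) the free
   module on the homogeneous elements of the kernel of the map out of F_i.
   [grmod] only records the homogeneous components.  When gA and M are graded,
   every map is homogeneous of degree 0, so each kernel is graded, hence spanned
   by its homogeneous elements, and F is exact. *)
Section GradedTor.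
Variables (A : pzRingType) (gA : nat -> set A).

Record grmod := GrMod {
  grmod_sort :> lmodType A;
  grcomp : nat -> set grmod_sort
}.

Section Syzygy.
Variable M : grmod.

Definition homog : choiceType := {mx : nat * M | `[< grcomp mx.1 mx.2 >]}.
Definition hdeg (b : homog) : nat := (\val b).1.
Definition hval (b : homog) : M := (\val b).2.

(* The free A-module on a basis e_b indexed by the homogeneous elements b of
   M, with e_b in the degree of b. *)
Definition free : Type := @dsum homog (fun=> A).
HB.instance Definition _ := GRing.Zmodule.on free.

Fact free_scale_finite (a : A) (f : free) : finite_set [set b | a * f b != 0].
Proof.
apply: sub_finite_set (dsum_finite f) => b /=.
by apply: contra_neq => ->; rewrite mulr0.
Qed.

Definition free_scale a f : free := @DSum homog (fun=> A) _ (free_scale_finite a f).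

Fact free_scalerA a b f : free_scale a (free_scale b f) = free_scale (a * b) f.
Proof. by apply: dsumP => i; apply: mulrA. Qed.
Fact free_scale1 : left_id 1 free_scale.
Proof. by move=> f; apply: dsumP => i; apply: mul1r. Qed.
Fact free_scalerDr : right_distributive free_scale +%R.
Proof. by move=> a f g; apply: dsumP => i; apply: mulrDr. Qed.
Fact free_scalerDl f : {morph free_scale^~ f : a b / a + b}.
Proof. by move=> a b; apply: dsumP => i; apply: mulrDl. Qed.
HB.instance Definition _ := @GRing.Zmodule_isLmodule.Build A free
  free_scale free_scalerA free_scale1 free_scalerDr free_scalerDl.

Definition free_comp (m : nat) : set free :=
  [set f | forall b : homog,
     if (hdeg b <= m)%N then gA (m - hdeg b)%N (f b) else f b = 0].

(* The A-linear map e_b |-> b. *)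
Definition free_eval : free -> M := dlift (fun b (a : A) => a *: hval b).

Let eval_aux (b : homog) : {morph (fun a : A => a *: hval b) : x y / x - y}.
Proof. by move=> x y; rewrite scalerBl. Qed.

Fact free_evalB : {morph free_eval : f g / f - g}.
Proof. exact: (@dliftB _ _ M (fun b a => a *: hval b) eval_aux). Qed.

Fact free_evalZ : scalable free_eval.
Proof.
move=> a f; elim/dsum_ind: f => [b c||f g hf hg].
- have -> : a *: (dinj b c : free) = dinj b (a * c).
    apply: dsumP => b'; rewrite -[LHS]/(a * dinj b c b').
    have [bb|bb] := pselect (b = b'); first by subst b'; rewrite !dinjE.
    by rewrite !dinjNE // mulr0.
  by rewrite /free_eval !(dlift_inj eval_aux) scalerA.
- by rewrite scaler0 -(subrr 0) free_evalB subrr scaler0.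
- have evalD : {morph free_eval : f g / f + g}.
    exact: (@dliftD _ _ M (fun b a => a *: hval b) eval_aux).
  by rewrite scalerDr !evalD hf hg scalerDr.
Qed.
HB.instance Definition _ := GRing.isZmodMorphism.Build free M free_eval free_evalB.
HB.instance Definition _ := GRing.isScalable.Build A free M *:%R free_eval free_evalZ.

Definition syz_pred : {pred free} := fun f => free_eval f == 0.

Fact syz_submod_closed : submod_closed syz_pred.
Proof.
split; first by rewrite -[_ \in _]/(_ == 0) raddf0.
move=> a f g /eqP hf /eqP hg; apply/eqP.
by rewrite linearP /= hf hg scaler0 addr0.
Qed.
HB.instance Definition _ :=
  GRing.isSubmodClosed.Build A free syz_pred syz_submod_closed.

Definition syzygy_type : Type := {f : free | f \in syz_pred}.
HB.instance Definition _ := SubChoice.on syzygy_type.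
HB.instance Definition _ := [SubChoice_isSubLmodule of syzygy_type by <:].

Definition syzygy : grmod :=
  @GrMod syzygy_type (fun m => [set f | free_comp m (\val f)]).

End Syzygy.

Variables (N : lmodType A^c) (gN : nat -> set N) (M : grmod).

Fixpoint syz (i : nat) : grmod := if i is i'.+1 then syzygy (syz i') else M.

(* F_i and the differential F_(i+1) -> F_i of the resolution. *)
Definition res (i : nat) : lmodType A := free (syz i).
Definition res_diff i (f : res i.+1) : res i := \val (free_eval f).

Definition tor_complex (i : nat) : zmodType := tensor N (res i).

Definition tor_diff i : tor_complex i.+1 -> tor_complex i :=
  tlift (fun x f => tens x (res_diff f)).

Definition tor_complex_comp i (m : nat) : set (tor_complex i) :=
  zspan [set t | exists j k x f, [/\ (j + k)%N = m, gN j x, free_comp k f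
                                   & t = tens x (f : res i)]].

Definition cycle i : {pred tor_complex i} :=
  match i with
  | 0 => predT
  | i'.+1 => fun t => tor_diff t == 0
  end.

Definition boundary i : {pred tor_complex i} :=
  fun t => `[< exists u, t = tor_diff u >].

Fact res_diff_bal i :
  balanced (fun (x : N) (f : res i.+1) => tens x (res_diff f) : tor_complex i).
Proof.
have [tDl tDr tZ] := tens_balanced N (res i).
split=> [x x' f|x f f'|x b f]; first exact: tDl.
  by rewrite /res_diff !raddfD tDr.
by rewrite /res_diff tZ !linearZ.
Qed.

Lemma tor_diffB i : {morph @tor_diff i : t u / t - u}.
Proof. exact: tliftB (res_diff_bal i). Qed.
HB.instance Definition _ i := GRing.isZmodMorphism.Build
  (tor_complex i.+1) (tor_complex i) (@tor_diff i) (@tor_diffB i).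

Fact cycle_zmod_closed i : zmod_closed (@cycle i).
Proof.
have tor_diff0 j : @tor_diff j 0 = 0.
  by have := tor_diffB (0 : tor_complex j.+1) 0; rewrite !subrr.
case: i => [|i]; first by [].
split=> [|t u].
- by apply/eqP; apply: tor_diff0.
- move=> /eqP ht /eqP hu; apply/eqP.
  by apply: (etrans (tor_diffB t u)); rewrite [X in X - _]ht [X in _ - X]hu; apply: subrr.
Qed.
HB.instance Definition _ i :=
  GRing.isZmodClosed.Build (tor_complex i) (@cycle i) (cycle_zmod_closed i).

Fact boundary_zmod_closed i : zmod_closed (@boundary i).
Proof.
split; first by apply/asboolP; exists 0; rewrite raddf0.
move=> _ _ /asboolP[t ->] /asboolP[u ->]; apply/asboolP.
by exists (t - u); rewrite raddfB.
Qed.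
HB.instance Definition _ i :=
  GRing.isZmodClosed.Build (tor_complex i) (@boundary i) (boundary_zmod_closed i).

(* Tor_i^A(N, M) and its internal grading. *)
Definition Tor i : zmodType := subquot (@cycle i) (@boundary i).

Definition Tor_comp i (m : nat) : set (Tor i) :=
  [set h | exists2 z, z \in @cycle i /\ tor_complex_comp m z
                    & h = subcls (@cycle i) (@boundary i) z].

End GradedTor.

(* A ring S as a left and as a right module over A along A -> S, in degree 0. *)
Section RestrictionOfScalars.
Variables (A S : pzRingType) (eps : {rmorphism A -> S}).

Definition lres of {rmorphism A -> S} : Type := S.
Definition rres of {rmorphism A -> S} : Type := S.
HB.instance Definition _ := GRing.Zmodule.copy (lres eps) S.
HB.instance Definition _ := GRing.Zmodule.copy (rres eps) S.

Fact lres_scalerA (a b : A) (s : S) : eps a * (eps b * s) = eps (a * b) * s.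
Proof. by rewrite rmorphM mulrA. Qed.
Fact lres_scale1 (s : S) : eps 1 * s = s. Proof. by rewrite rmorph1 mul1r. Qed.
Fact lres_scalerDr (a : A) (s t : S) : eps a * (s + t) = eps a * s + eps a * t.
Proof. exact: mulrDr. Qed.
Fact lres_scalerDl (s : S) (a b : A) : eps (a + b) * s = eps a * s + eps b * s.
Proof. by rewrite raddfD mulrDl. Qed.
HB.instance Definition _ := @GRing.Zmodule_isLmodule.Build A (lres eps)
  (fun a s => eps a * (s : S)) lres_scalerA lres_scale1 lres_scalerDr lres_scalerDl.

Fact rres_scalerA (a b : A) (s : S) : s * eps b * eps a = s * eps (b * a).
Proof. by rewrite rmorphM mulrA. Qed.
Fact rres_scale1 (s : S) : s * eps 1 = s. Proof. by rewrite rmorph1 mulr1. Qed.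
Fact rres_scalerDr (a : A) (s t : S) : (s + t) * eps a = s * eps a + t * eps a.
Proof. exact: mulrDl. Qed.
Fact rres_scalerDl (s : S) (a b : A) : s * eps (a + b) = s * eps a + s * eps b.
Proof. by rewrite raddfD mulrDr. Qed.
HB.instance Definition _ := @GRing.Zmodule_isLmodule.Build A^c (rres eps)
  (fun a s => (s : S) * eps a) rres_scalerA rres_scale1 rres_scalerDr rres_scalerDl.

Definition degree0 (m : nat) : set S := [set s | m = 0%N \/ s = 0].

Definition lres_grmod : grmod A := @GrMod A (lres eps) degree0.

End RestrictionOfScalars.

Record subbimod (S : pzRingType) (M : bimodType S) := Subbimod {
  subbimod_set :> set M;
  subbimod0 : subbimod_set 0;
  subbimodB : forall x y, subbimod_set x -> subbimod_set y -> subbimod_set (x - y);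
  subbimodZ : forall s x, subbimod_set x -> subbimod_set (s *: x);
  subbimod_ract : forall x s, subbimod_set x -> subbimod_set (ract x s)
}.

Identity Coercion fun_of_set : set >-> Funclass.

Section SubbimoduleType.
Variables (S : pzRingType) (M : bimodType S) (P : subbimod M).

Definition subbimod_pred : {pred M} := fun x => `[< P x >].

Fact subbimod_submod_closed : submod_closed subbimod_pred.
Proof.
split; first by apply/asboolP; exact: subbimod0.
move=> s x y /asboolP hx /asboolP hy; apply/asboolP.
have -> : s *: x + y = s *: x - (0 - y) by rewrite sub0r opprK.
apply: subbimodB; first exact: subbimodZ.
by apply: subbimodB => //; exact: subbimod0.
Qed.
HB.instance Definition _ :=
  GRing.isSubmodClosed.Build S M subbimod_pred subbimod_submod_closed.

Definition bimod_of : Type := {x : M | x \in subbimod_pred}.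
HB.instance Definition _ := SubChoice.on bimod_of.
HB.instance Definition _ := [SubChoice_isSubLmodule of bimod_of by <:].

Lemma bimod_ofP (x : bimod_of) : P (\val x).
Proof. by have /asboolP := valP x. Qed.

Fact bimod_of_ract_in (x : bimod_of) s : ract (\val x) s \in subbimod_pred.
Proof. by apply/asboolP/subbimod_ract/bimod_ofP. Qed.

Definition bimod_of_ract (x : bimod_of) s : bimod_of :=
  exist _ (ract (\val x) s) (bimod_of_ract_in x s).

Fact bimod_of_ractDl s : {morph bimod_of_ract^~ s : x y / x + y}.
Proof. by move=> x y; apply: val_inj; rewrite raddfD /= ractDl. Qed.
Fact bimod_of_ractDr x : {morph bimod_of_ract x : s t / s + t}.
Proof. by move=> s t; apply: val_inj; rewrite raddfD /= ractDr. Qed.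
Fact bimod_of_ract1 x : bimod_of_ract x 1 = x.
Proof. by apply: val_inj; rewrite /= ract1. Qed.
Fact bimod_of_ractM x s t :
  bimod_of_ract x (s * t) = bimod_of_ract (bimod_of_ract x s) t.
Proof. by apply: val_inj; rewrite /= ractM. Qed.
Fact bimod_of_ractZ s x t : bimod_of_ract (s *: x) t = s *: bimod_of_ract x t.
Proof. by apply: val_inj; rewrite linearZ /= ractZ. Qed.
HB.instance Definition _ := @Lmodule_isBimodule.Build S bimod_of bimod_of_ract
  bimod_of_ractDl bimod_of_ractDr bimod_of_ract1 bimod_of_ractM bimod_of_ractZ.

End SubbimoduleType.

Section HomogeneousAlgebra.
Variables (S : pzRingType) (V : bimodType S).
Local Notation T := (tens_alg V).

Section Top.
Variables (n : nat) (P : subbimod T).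

Definition top_set : set T := thom n @` P.

Fact top0 : top_set 0.
Proof. by exists 0; [exact: subbimod0 | rewrite /thom tcoef0 raddf0]. Qed.
Fact topB x y : top_set x -> top_set y -> top_set (x - y).
Proof.
by move=> [a ha <-] [b hb <-]; exists (a - b); [exact: subbimodB | exact: thomB].
Qed.
Fact topZ s x : top_set x -> top_set (s *: x).
Proof.
by move=> [a ha <-]; exists (s *: a); [exact: subbimodZ | exact: thomZ].
Qed.
Fact top_ract x s : top_set x -> top_set (ract x s).
Proof.
by move=> [a ha <-]; exists (ract a s); [exact: subbimod_ract | exact: thom_ract].
Qed.

Definition top : subbimod T := Subbimod top0 topB topZ top_ract.

End Top.

(* A(R)^m, the image of T^m. *)
Definition Acomp (R : set T) (m : nat) : set (qring R) := qproj R @` tpure m.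

(* The augmentation A(R) -> A(R)^0 = S for R = p^n(P), n > 0. *)
Section Augmentation.
Variables (n : nat) (n_gt0 : (0 < n)%N) (P : subbimod T).

Fact taug_top x : top n P x -> taug x = 0.
Proof.
by case=> y _ <-; rewrite /taug tinjNE //; apply/eqP; rewrite -lt0n.
Qed.

Definition aug : {rmorphism qring (top n P) -> S} := qlift taug_top.

(* Tor_i^A(S, S) for A = A(p^n(P)), with its internal grading. *)
Definition TorSS (i : nat) : zmodType :=
  Tor (@Acomp (top n P)) (rres aug) (lres_grmod aug) i.

Definition TorSS_comp i (m : nat) : set (TorSS i) :=
  Tor_comp (@degree0 S : nat -> set (rres aug)) m.

End Augmentation.

(* For f : W -> T, the maps id_V (x) f and f (x) id_V followed by the
   multiplication of T, which identifies V (x) T^m and T^m (x) V with T^(m+1). *)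
Definition Vtens (W : bimodType S) (f : W -> T) : btensor V W -> T :=
  tlift (fun (v : rmod V) x => tvar (v : V) * f x).

Definition tensV (W : bimodType S) (f : W -> T) : btensor W V -> T :=
  tlift (fun (x : rmod W) v => f (x : W) * tvar v).

(* A morphism of filtered bimodules alpha : R -> T^{<= n} whose component
   alpha_0 is the inclusion. *)
Record filtered_morphism (n : nat) (R : subbimod T)
    (alpha : {linear bimod_of R -> T}) : Prop := FilteredMorphism {
  filtered_ract : forall r s, alpha (ract r s) = ract (alpha r) s;
  filtered_deg : forall r, tdeg_le n (alpha r);
  filtered_0 : forall r, thom n (alpha r) = \val r
}.

(* alpha_i = p^(n-i) alpha *)
Definition component (R : subbimod T) n (alpha : bimod_of R -> T) (i : nat) :
  bimod_of R -> T := fun r => thom (n - i) (alpha r).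

(* (V (x) alpha_i - alpha_i (x) V)(u, w) *)
Definition Jdiff (R : subbimod T) n (alpha : bimod_of R -> T) (i : nat)
    (u : btensor V (bimod_of R)) (w : btensor (bimod_of R) V) : T :=
  Vtens (component n alpha i) u - tensV (component n alpha i) w.

End HomogeneousAlgebra.
Arguments TorSS {S V n} n_gt0 P i.
Arguments TorSS_comp {S V n} n_gt0 P i m.

(* Main.v *)
(* Let I = <R> and write alpha for the inverse of p^n : P -> R. The deformation is
   PBW iff every element of <P> of degree <= m has its degree m part in I, and this
   says that a relation sum t r t' = 0 among the elements of R can be rewritten, in
   the sense that sum t (alpha r) t' lies in the part of <P> generated in lower
   degree. Since T^+ = T (x) V and V is projective, hence flat, one may argue on the
   last factor by induction, which leaves the syzygies sum t r in I V, that is the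
   kernel K of A (x) R -> A (x) V. The trivial overlaps I R are always reducible.

   The classes of K modulo A^+ K are detected by Tor_3^A(S, S). Let F be the standard
   resolution. A homogeneous k in K of positive A-degree maps to a third syzygy of F,
   whose basis element in F_3 is a cycle in S (x) F_3; conversely F_2 maps, degree by
   degree, to the syzygies modulo the reducible ones. This map kills boundaries and,
   by induction on the degree, factors through S (x)_A -, and it sends the cycle of k
   to the class of k. So if Tor_3 is concentrated in degree n + 1 only the syzygies of
   that degree remain to be checked, and for these reducibility is the Jacobi
   condition; if Tor_3 = 0 nothing remains. *)
From HB Require Import structures.
Require Import Defs.
From mathcomp Require Import all_boot all_algebra.
From mathcomp Require Import boolp classical_sets.
From mathcomp Require Import zify.

Set Implicit Arguments.
Unset Strict Implicit.
Unset Printing Implicit Defensive.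

Import GRing.Theory.
Local Open Scope ring_scope.
Local Open Scope classical_set_scope.

(** * Subgroups spanned by a set *)

Section Spans.
Variables (G H : zmodType).

Lemma zspanN (X : set G) x : zspan X x -> zspan X (- x).
Proof. by move=> hx; rewrite -sub0r; apply: zspanB => //; apply: zspan0. Qed.

Lemma zspanD (X : set G) x y : zspan X x -> zspan X y -> zspan X (x + y).
Proof. by move=> hx hy; rewrite -[y]opprK; apply: zspanB => //; apply: zspanN. Qed.

Lemma zspan_sum (X : set G) (I : Type) (s : seq I) (P : pred I) (F : I -> G) :
  (forall i, P i -> zspan X (F i)) -> zspan X (\sum_(i <- s | P i) F i).
Proof. by move=> h; apply: big_ind => //; [exact: zspan0|exact: zspanD]. Qed.

Lemma zspan_map (f : G -> H) (X : set G) (Y : set H) x :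
  {morph f : y z / y - z} -> (forall y, X y -> zspan Y (f y)) ->
  zspan X x -> zspan Y (f x).
Proof.
move=> fB h; elim=> {x} [x /h||y z _ hy _ hz] //; last by rewrite fB; apply: zspanB.
by rewrite -(subrr 0) fB subrr; exact: zspan0.
Qed.

Lemma zspan_eq0 (f : G -> H) (X : set G) x :
  {morph f : y z / y - z} -> (forall y, X y -> f y = 0) -> zspan X x -> f x = 0.
Proof.
move=> fB h; elim=> {x} [x /h||y z _ hy _ hz] //; last by rewrite fB hy hz subrr.
by rewrite -(subrr 0) fB subrr.
Qed.

End Spans.

(** * Homogeneous tensors *)

Section HomogeneousTensors.
Variables (S : pzRingType) (V : bimodType S).
Local Notation T := (tens_alg V).
Implicit Types (x y : T) (s : S) (v w : V).

Definition tscal s : T := @tinj S V 0 (s : S).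

Lemma tpure_tinj m (t : tpow V m) : tpure m (tinj t).
Proof. by rewrite /tpure /= /thom tinjE. Qed.

Lemma tpureP m x : tpure m x <-> exists t : tpow V m, x = tinj t.
Proof.
split; first by move=> <-; exists (tcoef x m).
by case=> t ->; apply: tpure_tinj.
Qed.

Lemma thom_tinj_neq m k (t : tpow V m) : m <> k -> thom k (tinj t) = 0.
Proof. by move=> mk; rewrite /thom tinjNE // raddf0. Qed.

HB.instance Definition _ m := GRing.isZmodMorphism.Build T T (@thom S V m) (thomB m).

Lemma thomD m : {morph @thom S V m : x y / x + y}. Proof. exact: raddfD. Qed.

Lemma thom_pure m x : tpure m x -> thom m x = x. Proof. by []. Qed.

Lemma thom_pure_neq m k x : tpure m x -> m <> k -> thom k x = 0.
Proof. by move=> /tpureP[t ->]; exact: thom_tinj_neq. Qed.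

Lemma tpure_thom m x : tpure m (thom m x).
Proof. exact: tpure_tinj. Qed.

Lemma tpure0 m : tpure m (0 : T).
Proof. by rewrite /tpure /= raddf0. Qed.

Lemma tpureB m x y : tpure m x -> tpure m y -> tpure m (x - y).
Proof. by rewrite /tpure /= thomB => -> ->. Qed.

Lemma tpureD m x y : tpure m x -> tpure m y -> tpure m (x + y).
Proof.
move=> hx hy; rewrite -[y]opprK -[- y]sub0r.
by do 2!apply: tpureB => //; exact: tpure0.
Qed.

Lemma tens_pure_ind (Q : T -> Prop) :
    (forall m x, tpure m x -> Q x) -> Q 0 -> (forall x y, Q x -> Q y -> Q (x + y)) ->
  forall x, Q x.
Proof. by move=> h Q0 QD; apply: tens_alg_ind => // m t; apply: (h m); apply: tpure_tinj. Qed.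

Lemma tscalB : {morph tscal : s t / s - t}.
Proof. by move=> s t; exact: (@tinjB S V 0 s t). Qed.
HB.instance Definition _ := GRing.isZmodMorphism.Build S T tscal tscalB.

Lemma tscal0 : tscal 0 = 0. Proof. exact: raddf0. Qed.
Lemma tscalD s t : tscal (s + t) = tscal s + tscal t. Proof. exact: raddfD. Qed.

Lemma tscal_monoid_morphism : monoid_morphism tscal.
Proof. by split=> // s t; rewrite -[RHS]tens_alg_scaleE /tscal tinjZ. Qed.
HB.instance Definition _ := GRing.isMonoidMorphism.Build S T tscal tscal_monoid_morphism.

Lemma taug0 : @taug S V 0 = 0. Proof. exact: raddf0. Qed.

Lemma taug_scal s : taug (tscal s) = s.
Proof. exact: (@tinjE S V 0 s). Qed.

Lemma tpure_scal s : tpure 0 (tscal s). Proof. exact: tpure_tinj. Qed.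

Lemma tpure_eq_scal x : tpure 0 x -> x = tscal (taug x).
Proof. by []. Qed.

Lemma taug_pure m x : tpure m x -> (0 < m)%N -> taug x = 0.
Proof. by move=> /tpureP[t ->] m0; rewrite /taug tinjNE //; apply/eqP; rewrite -lt0n. Qed.

Lemma ractr0 (M : bimodType S) (x : M) : ract x 0 = 0.
Proof. by apply: (addIr (ract x 0)); rewrite -ractDr !add0r. Qed.

Lemma tvar0 : tvar (0 : V) = 0.
Proof. by apply: (addIr (tvar 0)); rewrite -tvarD !add0r. Qed.

Lemma tvarB : {morph @tvar S V : v w / v - w}.
Proof. by move=> v w; apply: (addIr (tvar w)); rewrite -tvarD !subrK. Qed.
HB.instance Definition _ := GRing.isZmodMorphism.Build V T (@tvar S V) tvarB.

Lemma tpure_var v : tpure 1 (tvar v). Proof. exact: tpure_tinj. Qed.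

Lemma taugM_var x v : taug (x * tvar v) = 0.
Proof.
have [_ ->] := taugM V; have -> : taug (tvar v) = 0 by exact: taug_pure (tpure_var v) _.
exact: mulr0.
Qed.

Lemma tinj_btens m v (u : tpow V m) : @tinj S V m.+1 (btens v u) = tvar v * tinj u.
Proof. by rewrite tvar_mul tshift_inj. Qed.

Lemma tpureM i j x y : tpure i x -> tpure j y -> tpure (i + j) (x * y).
Proof.
move=> /tpureP[t ->] hy; elim/tpow_ind: i / t => [s|m v u IH|m|m t u ht hu].
- by rewrite -tens_alg_scaleE /tpure /= thomZ hy.
- rewrite tinj_btens -mulrA; have /tpureP[w ->] := IH.
  by rewrite addSn -tinj_btens; apply: tpure_tinj.
- by rewrite raddf0 mul0r; apply: tpure0.
- by rewrite raddfB mulrBl; apply: tpureB.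
Qed.

Lemma thomM i j x y : tpure i x -> thom (i + j) (x * y) = x * thom j y.
Proof.
move=> hx; elim/tens_pure_ind: y => [k y hy||y z hy hz].
- have [<-|kj] := pselect (k = j).
    by rewrite !thom_pure //; apply: tpureM.
  rewrite (thom_pure_neq hy kj) mulr0.
  by apply: (thom_pure_neq (tpureM hx hy)) => /addnI.
- by rewrite raddf0 mulr0 raddf0.
- by rewrite mulrDr !raddfD /= mulrDr hy hz.
Qed.

Lemma tvar_scal v s : tvar v * tscal s = tvar (ract v s).
Proof. by rewrite -tens_alg_ractE tvar_ract. Qed.

Lemma scal_tvar v s : tscal s * tvar v = tvar (s *: v).
Proof. by rewrite -tens_alg_scaleE tvarZ. Qed.

(** [tpow] splits off the first letter, whereas the later arguments work on the last one.
    Reassociating letter by letter identifies V (x) T^m with T^m (x) V; in degree 1 the scalar on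
    the right is moved into the letter. *)
Lemma tpureS_span m x :
  tpure m.+1 x -> zspan [set z | exists y v, tpure m y /\ z = y * tvar v] x.
Proof.
move=> /tpureP[t ->] {x}.
elim: m t => [|m IH] t; elim/btensor_ind: t => [v u||t u ht hu];
  rewrite ?raddf0 ?raddfB; try exact: zspan0; try exact: zspanB.
- apply: zspan_in; exists 1, (ract v (u : S)); split; first exact: tpure_tinj.
  by rewrite mul1r tinj_btens -tvar_scal.
- rewrite tinj_btens; have := IH u.
  apply: (zspan_map (mulrBr (tvar v))) => y [z [w [hz ->]]].
  apply: zspan_in; exists (tvar v * z), w; rewrite -mulrA; split=> //.
  exact: (tpureM (tpure_var v) hz).
Qed.

Lemma taug0_span x :
  taug x = 0 -> zspan [set z | exists y v, z = y * tvar v] x.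
Proof.
suff h : zspan [set z | exists y v, z = y * tvar v] (x - tscal (taug x)).
  by move=> x0; move: h; rewrite x0 tscal0 subr0.
elim/tens_pure_ind: x => [[|m] y hy||y z hy hz].
- by rewrite -(tpure_eq_scal hy) subrr; exact: zspan0.
- rewrite (taug_pure hy) // raddf0 subr0; move: (tpureS_span hy).
  apply: (zspan_map (f := idfun)) => // ? [u [v [_ ->]]].
  by apply: zspan_in; exists u, v.
- by rewrite taug0 tscal0 subr0; exact: zspan0.
- by rewrite taugD raddfD opprD addrACA; exact: zspanD.
Qed.

Lemma tdeg_ltP m x : tdeg_lt m x <-> forall k, (m <= k)%N -> thom k x = 0.
Proof.
split=> h k mk; first by rewrite /thom h // raddf0.
by rewrite -(tinjE (tcoef x k)) -[tinj _]/(thom k x) h // tcoef0.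
Qed.

Lemma tpure_deg m k x : tpure m x -> (m < k)%N -> tdeg_lt k x.
Proof.
move=> hx mk; apply/tdeg_ltP => j kj; apply: (thom_pure_neq hx).
by apply/eqP; rewrite neq_ltn (leq_trans mk kj).
Qed.

Lemma tensP x y : (forall m, thom m x = thom m y) -> x = y.
Proof.
move=> h; apply: tensalgP => m.
by rewrite -(tinjE (tcoef x m)) -(tinjE (tcoef y m)) -/(thom m x) -/(thom m y) h.
Qed.

Lemma tdeg_lt_ind (Q : T -> Prop) k :
    (forall m x, (m < k)%N -> tpure m x -> Q x) -> Q 0 ->
    (forall x y, Q x -> Q y -> Q (x + y)) ->
  forall x, tdeg_lt k x -> Q x.
Proof.
move=> h Q0 QD x /tdeg_ltP hx.
have -> : x = \sum_(i < k) thom i x.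
  apply: tensP => m; rewrite raddf_sum /=; have [mk|km] := ltnP m k.
    rewrite (bigD1 (Ordinal mk)) //= big1 => [|i im].
      by rewrite addr0 (thom_pure (tpure_thom m x)).
    apply: (thom_pure_neq (tpure_thom i x)).
    by move=> e; case/eqP: im; apply: val_inj.
  rewrite hx // big1 // => i _; apply: (thom_pure_neq (tpure_thom i x)).
  by apply/eqP; rewrite neq_ltn (leq_trans (ltn_ord i) km).
by apply: big_ind => // i _; apply: (h i) => //; apply: tpure_thom.
Qed.

End HomogeneousTensors.

(* The right derivation T -> M with D (x * tvar v) = p x *: sigma v, which vanishes
   on T^0: it identifies T^+ with T (x) V, on which it is p (x) sigma. *)
Section RightDerivation.
Variables (S : pzRingType) (V : bimodType S).
Local Notation T := (tens_alg V).
Variables (A : pzRingType) (p : {rmorphism T -> A}) (M : lmodType A).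
Variable sigma : {additive V -> M}.
Hypothesis sigmaZ : forall s v, sigma (s *: v) = p (tscal V s) *: sigma v.

(** The map acts on the last letter but has to be computed from the first one. The second summand
    can be nonzero only if u has degree 0, and then v itself is the last letter. *)
Fixpoint rder_hom m : tpow V m -> M :=
  match m with
  | 0 => fun=> 0
  | m'.+1 => tlift (fun (v : rmod V) (u : tpow V m') =>
      p (tvar (v : V)) *: rder_hom u + sigma (ract (v : V) (taug (tinj u))))
  end.

Let rder_hom_bal m :
  {morph @rder_hom m : t u / t - u} ->
  (forall s t, @rder_hom m (s *: t) = p (tscal V s) *: rder_hom t) ->
  balanced (fun (v : rmod V) (u : tpow V m) =>
      p (tvar (v : V)) *: rder_hom u + sigma (ract (v : V) (taug (tinj u)))).
Proof.
move=> hB hZ.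
have hD : {morph @rder_hom m : t u / t + u}.
  by move=> t u; apply: (addIr (- rder_hom u)); rewrite -hB !addrK.
split=> [v w u|v t u|v s u].
- by rewrite /= tvarD raddfD scalerDl ractDl raddfD addrACA.
- by rewrite hD scalerDr (raddfD (@tinj S V m)) taugD ractDr raddfD addrACA.
- rewrite hZ scalerA -rmorphM tvar_scal -tinjZ -ractM.
  by congr (_ + sigma (ract _ _)).
Qed.

Let rder_hom_facts m :
  {morph @rder_hom m : t u / t - u} /\
  (forall s t, @rder_hom m (s *: t) = p (tscal V s) *: rder_hom t).
Proof.
elim: m => [|m [hB hZ]].
  by split=> [t u|s t]; rewrite /= ?subr0 ?scaler0.
have bal := rder_hom_bal hB hZ.
have hBS : {morph @rder_hom m.+1 : t u / t - u} := tliftB bal.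
split=> //.
move=> s t; elim/btensor_ind: t => [v u||t u ht hu].
- rewrite btens_scale /= !(tlift_tens bal) scalerDr scalerA -rmorphM.
  by rewrite scal_tvar ractZ sigmaZ.
- by rewrite scaler0 /= (tlift0 bal) scaler0.
- by rewrite scalerBr !hBS ht hu scalerBr.
Qed.

Definition rder : T -> M := dlift (fun m (t : tpow V m) => rder_hom t).

Lemma rderB : {morph rder : x y / x - y}.
Proof. by apply: dliftB => m; case: (rder_hom_facts m). Qed.
HB.instance Definition _ := GRing.isZmodMorphism.Build T M rder rderB.

Lemma rderD : {morph rder : x y / x + y}. Proof. exact: raddfD. Qed.

Lemma rder_inj m (t : tpow V m) : rder (tinj t) = rder_hom t.
Proof. by apply: dlift_inj => k; case: (rder_hom_facts k). Qed.

Lemma rder_varM v x : rder (tvar v * x) = p (tvar v) *: rder x + sigma (ract v (taug x)).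
Proof.
elim/tens_alg_ind: x => [m t||x y hx hy].
- rewrite -tinj_btens !rder_inj; have [hB hZ] := rder_hom_facts m.
  exact: (tlift_tens (rder_hom_bal hB hZ)).
- by rewrite mulr0 !raddf0 add0r ractr0 raddf0.
- by rewrite mulrDr !rderD hx hy taugD scalerDr ractDr raddfD addrACA.
Qed.

Lemma rder_scal s : rder (tscal V s) = 0.
Proof. exact: (@rder_inj 0). Qed.

Lemma rderM_var x v : rder (x * tvar v) = p x *: sigma v.
Proof.
have rder_var w : rder (tvar w) = sigma w.
  rewrite -[tvar w]mulr1 rder_varM -[1]/(tscal V 1) rder_scal scaler0 add0r.
  by rewrite taug_scal ract1.
elim/tens_alg_ind: x => [m t||x y hx hy]; last 2 first.
- by rewrite mul0r !raddf0 scale0r.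
- by rewrite mulrDl !raddfD /= hx hy scalerDl.
elim/tpow_ind: m / t => [s|m w u IH|m|m t u ht hu].
- by rewrite -[tinj _]/(tscal V s) scal_tvar rder_var sigmaZ.
- rewrite tinj_btens -mulrA rder_varM IH taugM_var ractr0 raddf0 addr0.
  by rewrite rmorphM scalerA.
- by rewrite raddf0 mul0r !raddf0 scale0r.
- by rewrite raddfB mulrBl !raddfB /= ht hu scalerBl.
Qed.

End RightDerivation.

Section Ideals.
Variables (S : pzRingType) (V : bimodType S).
Local Notation T := (tens_alg V).

(** Multiplication by a homogeneous element on either side keeps terms of this shape. With
    homogeneous outer factors each term has a definite degree as soon as X is pure. *)
Lemma ideal_gen_span (X : set T) x : ideal_gen X x ->
  zspan [set z | exists i k t y t',
    [/\ tpure i t, tpure k t', X y & z = t * y * t']] x.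
Proof.
elim=> {x} [x hx||x y _ hx _ hy|b x _ hx|x b _ hx].
- apply: zspan_in; exists 0%N, 0%N, (tscal V 1), x, (tscal V 1).
  by split; rewrite ?rmorph1 ?mul1r ?mulr1 //; exact: tpure_scal.
- exact: zspan0.
- exact: zspanB.
- elim/tens_pure_ind: b => [m b hb||b c hb hc].
  + move: hx; apply: (zspan_map (mulrBr b)) => _ [i [k [t [y [t' [ht ht' hy ->]]]]]].
    apply: zspan_in; exists (m + i)%N, k, (b * t), y, t'.
    by split; rewrite ?mulrA //; exact: tpureM.
  + by rewrite mul0r; exact: zspan0.
  + by rewrite mulrDl; exact: zspanD.
- elim/tens_pure_ind: b => [m b hb||b c hb hc].
  + move: hx; apply: (zspan_map (mulrBl b)) => _ [i [k [t [y [t' [ht ht' hy ->]]]]]].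
    apply: zspan_in; exists i, (k + m)%N, t, y, (t' * b).
    by split; rewrite ?mulrA //; exact: tpureM.
  + by rewrite mulr0; exact: zspan0.
  + by rewrite mulrDr; exact: zspanD.
Qed.

Lemma zspan_ideal (X Y : set T) x :
  (forall y, Y y -> ideal_gen X y) -> zspan Y x -> ideal_gen X x.
Proof.
by move=> h; elim=> {x} [x /h||x y _ hx _ hy] //; [exact: Defs.ideal0|exact: Defs.idealB].
Qed.

Lemma thomM_var m (x : T) v : thom m.+1 (x * tvar v) = thom m x * tvar v.
Proof.
elim/tens_pure_ind: x => [k x hx||x y hx hy].
- have hxv : tpure k.+1 (x * tvar v) by rewrite -addn1; exact: (tpureM hx (tpure_var v)).
  have [<-|km] := pselect (k = m); first by rewrite !thom_pure.
  by rewrite (thom_pure_neq hx km) mul0r (thom_pure_neq hxv) // => -[].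
- by rewrite mul0r !raddf0 mul0r.
- by rewrite mulrDl !raddfD /= mulrDl hx hy.
Qed.

Lemma thom0M_var (x : T) v : thom 0 (x * tvar v) = 0.
Proof. by rewrite -[LHS]/(tscal V (taug (x * tvar v))) taugM_var raddf0. Qed.

End Ideals.

(** * Relations and their deformations *)

Section HomogeneousRelations.
Variables (S : pzRingType) (V : bimodType S) (n : nat).
Local Notation T := (tens_alg V).
Variable R : subbimod T.
Hypothesis R_pure : forall x, R x -> tpure n x.

Lemma ideal_hspan m x : ideal_gen R x ->
  zspan [set z | exists i k t (r : bimod_of R) t',
    [/\ (i + n + k = m)%N, tpure i t, tpure k t' & z = t * \val r * t']] (thom m x).
Proof.
move/ideal_gen_span; apply: (zspan_map (thomB m)).
move=> _ [i [k [t [y [t' [ht ht' hy ->]]]]]].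
have h := tpureM (tpureM ht (R_pure hy)) ht'.
have [e|ne] := pselect ((i + n + k)%N = m); last first.
  by rewrite (thom_pure_neq h ne); exact: zspan0.
rewrite -e thom_pure //; apply: zspan_in.
have yR : y \in subbimod_pred R by apply/asboolP.
by exists i, k, t, (exist _ y yR), t'.
Qed.

Lemma ideal_thom m x : ideal_gen R x -> ideal_gen R (thom m x).
Proof.
move/(ideal_hspan m); apply: zspan_ideal => _ [i [k [t [r [t' [_ _ _ ->]]]]]].
by apply: Defs.idealMr; apply: Defs.idealMl; apply: ideal_in; exact: bimod_ofP.
Qed.

Lemma ideal_thom_lt m x : (m < n)%N -> ideal_gen R x -> thom m x = 0.
Proof.
move=> mn /(ideal_hspan m); apply: (zspan_eq0 (f := idfun)) => //.
  by move=> ? [i [k [t [r [t' [e _ _ _]]]]]]; lia.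
Qed.

Lemma ideal_thom_n x : ideal_gen R x -> R (thom n x).
Proof.
move/(ideal_hspan n); elim=> {x} [x||x y _ hx _ hy].
- move=> [i [k [t [r [t' [e ht ht' ->]]]]]].
  have i0 : i = 0%N by lia.
  have k0 : k = 0%N by lia.
  subst i k; rewrite (tpure_eq_scal ht) (tpure_eq_scal ht').
  rewrite -tens_alg_scaleE -tens_alg_ractE.
  by apply/subbimod_ract/subbimodZ/bimod_ofP.
- exact: subbimod0.
- exact: subbimodB.
Qed.

(* <R> (x) V inside T (x) V = T^+ *)
Definition idealV : set T := zspan [set z | exists y v, ideal_gen R y /\ z = y * tvar v].

Lemma idealV_thom_le m x : (m <= n)%N -> idealV x -> thom m x = 0.
Proof.
move=> mn; apply: (zspan_eq0 (thomB m)) => _ [y [v [hy ->]]].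
case: m mn => [|m] mn; first exact: thom0M_var.
by rewrite thomM_var ideal_thom_lt // mul0r.
Qed.

Lemma idealV_lmul t x : idealV x -> idealV (t * x).
Proof.
apply: (zspan_map (mulrBr t)) => _ [y [v [hy ->]]].
by apply: zspan_in; exists (t * y), v; split; [exact: Defs.idealMl|rewrite mulrA].
Qed.

Lemma ideal_mul_aug0 x y : ideal_gen R x -> taug y = 0 -> idealV (x * y).
Proof.
move=> hx /taug0_span; apply: (zspan_map (mulrBr x)) => _ [z [v ->]].
by apply: zspan_in; exists (x * z), v; rewrite mulrA; split=> //; exact: Defs.idealMr.
Qed.

Variable alpha : {linear bimod_of R -> T}.
Hypothesis alpha_ract : forall r s, alpha (ract r s) = ract (alpha r) s.
Hypothesis alpha_lt : forall r, tdeg_lt n (alpha r - \val r).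

(* A relation sum t r t' = 0 and its deformation are recorded together as the pair
   (sum t r t', sum t (alpha r) t') in T * T. *)
Definition lmul (t : T) (x : T * T) : T * T := (t * x.1, t * x.2).
Definition rmul (t : T) (x : T * T) : T * T := (x.1 * t, x.2 * t).

Lemma lmulB t : {morph lmul t : x y / x - y}.
Proof. by move=> x y; rewrite /lmul /= !mulrBr. Qed.
HB.instance Definition _ t :=
  GRing.isZmodMorphism.Build (T * T)%type (T * T)%type (lmul t) (lmulB t).

Lemma lmul0l x : lmul 0 x = 0.
Proof. by rewrite /lmul !mul0r. Qed.

Lemma rmulB t : {morph rmul t : x y / x - y}.
Proof. by move=> x y; rewrite /rmul /= !mulrBl. Qed.

Lemma lmulA t u x : lmul t (lmul u x) = lmul (t * u) x.
Proof. by rewrite /lmul /= !mulrA. Qed.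

Lemma lmul_rmul t u x : lmul t (rmul u x) = rmul u (lmul t x).
Proof. by rewrite /lmul /rmul /= !mulrA. Qed.

Lemma rmulA t u x : rmul t (rmul u x) = rmul (u * t) x.
Proof. by rewrite /rmul /= !mulrA. Qed.

Definition rpair (r : bimod_of R) : T * T := (\val r, alpha r).

Lemma rpairB : {morph rpair : r s / r - s}.
Proof. by move=> r s; rewrite /rpair !raddfB. Qed.

Lemma rpair_ract r s : rmul (tscal V s) (rpair r) = rpair (ract r s).
Proof. by rewrite /rmul /rpair /= alpha_ract !tens_alg_ractE. Qed.

Lemma rpairZ r s : lmul (tscal V s) (rpair r) = rpair (s *: r).
Proof. by rewrite /lmul /rpair !linearZ /= !tens_alg_scaleE. Qed.

Definition relpairs m : set (T * T) := zspan [set x | exists i k t r t',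
  [/\ (i + n + k = m)%N, tpure i t, tpure k t' & x = lmul t (rmul t' (rpair r))]].

Definition lrelpairs m : set (T * T) := zspan [set x | exists i t r,
  [/\ (i + n = m)%N, tpure i t & x = lmul t (rpair r)]].

Definition relpairsV m : set (T * T) := zspan [set x | exists m' y v,
  [/\ m = m'.+1, relpairs m' y & x = rmul (tvar v) y]].

(** The bound is on the formal degree i + n + k of each term. An element of <P> can have small
    degree merely because leading terms of larger formal degree cancel; the pairs serve to show that
    such cancellations can be lowered. *)
Definition deformed_lt m : set T := zspan [set z | exists i k t (r : bimod_of R) t',
  [/\ (i + n + k < m)%N, tpure i t, tpure k t' & z = t * alpha r * t']].

(** A relation is reducible if its leading part can be rewritten with a last letter split off, at
    the cost of deformed terms of lower formal degree. The second kind of generator records that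
    cost. *)
Definition reducible_gen m : set (T * T) :=
  relpairsV m `|` [set x | x.1 = 0 /\ deformed_lt m x.2].
Definition reducible m : set (T * T) := zspan (reducible_gen m).

Lemma reducible_inv m x : reducible m x ->
  exists e, [/\ relpairsV m e, e.1 = x.1 & deformed_lt m (x.2 - e.2)].
Proof.
elim=> {x} [x [hx|[x1 hx]]||x y _ [e [he1 he2 he3]] _ [f [hf1 hf2 hf3]]].
- by exists x; split=> //; rewrite subrr; exact: zspan0.
- by exists 0; split; [exact: zspan0|rewrite x1|rewrite subr0].
- by exists 0; split; [exact: zspan0|by []|rewrite subr0; exact: zspan0].
- exists (e - f); split; first exact: zspanB.
  + by rewrite -[LHS]/(e.1 - f.1) he2 hf2.
  + rewrite -[(x - y).2]/(x.2 - y.2) -[(e - f).2]/(e.2 - f.2).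
    by rewrite opprD addrACA -opprD; exact: zspanB.
Qed.

Lemma relpairs_fst m x : relpairs m x -> ideal_gen R x.1.
Proof.
elim=> {x} [x||x y _ hx _ hy]; [|exact: Defs.ideal0|exact: Defs.idealB].
move=> [i [k [t [r [t' [_ _ _ ->]]]]]] /=.
by apply: Defs.idealMl; apply: Defs.idealMr; apply: ideal_in; exact: bimod_ofP.
Qed.

Lemma relpairsV_fst m x : relpairsV m x -> idealV x.1.
Proof.
elim=> {x} [x||x y _ hx _ hy]; [|exact: zspan0|exact: zspanB].
move=> [m' [y [v [_ hy ->]]]] /=.
by apply: zspan_in; exists y.1, v; split=> //; exact: relpairs_fst hy.
Qed.

Lemma ideal_relpairs m x : ideal_gen R x -> exists b, relpairs m (thom m x, b).
Proof.
move/(ideal_hspan m); elim=> {x} [x||x y _ [b hb] _ [c hc]].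
- move=> [i [k [t [r [t' [e ht ht' ->]]]]]]; exists (t * (alpha r * t')).
  apply: zspan_in; exists i, k, t, r, t'; split=> //.
  by rewrite /lmul /rmul /= -mulrA.
- by exists 0; exact: zspan0.
- by exists (b - c); exact: (zspanB hb hc).
Qed.

Lemma relpairs_relpairsV i k t r t' : tpure i t -> tpure k t' -> (0 < k)%N ->
  relpairsV (i + n + k) (lmul t (rmul t' (rpair r))).
Proof.
case: k => // k ht /tpureS_span ht' _; elim: ht' => {t'} [t'||t' t'' _ h _ h''].
- move=> [y [v [hy ->]]]; rewrite -rmulA lmul_rmul.
  apply: zspan_in; exists (i + n + k)%N, (lmul t (rmul y (rpair r))), v.
  split=> //; first by rewrite addnS.
  by apply: zspan_in; exists i, k, t, r, y.
- by rewrite /lmul /rmul /= !mulr0; exact: zspan0.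
- rewrite (_ : lmul t (rmul (t' - t'') (rpair r)) =
      lmul t (rmul t' (rpair r)) - lmul t (rmul t'' (rpair r))); first exact: zspanB.
  by rewrite -raddfB; congr lmul; rewrite /rmul !mulrBr.
Qed.

Lemma relpairs_split m x : relpairs m x ->
  exists y z, [/\ lrelpairs m y, relpairsV m z & x = y + z].
Proof.
elim=> {x} [x||x x' _ [y [z [hy hz ->]]] _ [y' [z' [hy' hz' ->]]]].
- move=> [i [[|k] [t [r [t' [e ht ht' ->]]]]]]; last first.
    exists 0, (lmul t (rmul t' (rpair r))); split; [exact: zspan0| |by rewrite add0r].
    by rewrite -e; exact: relpairs_relpairsV.
  (* A right factor of degree 0 is a scalar, and [alpha] is right linear, so the factor is absorbed
     into r. *)
  exists (lmul t (rpair (ract r (taug t')))), 0.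
  split; [|exact: zspan0|by rewrite addr0 -rpair_ract -(tpure_eq_scal ht')].
  by apply: zspan_in; exists i, t, (ract r (taug t')); split=> //; rewrite -e addn0.
- by exists 0, 0; split; rewrite ?addr0 //; exact: zspan0.
- exists (y - y'), (z - z'); split; [exact: zspanB|exact: zspanB|].
  by rewrite opprD addrACA.
Qed.

Lemma lrelpairs_n x : lrelpairs n x -> exists r, x = rpair r.
Proof.
elim=> {x} [_ [i [t [r [ein ht ->]]]]||x y _ [r1 ->] _ [r2 ->]].
- have i0 : i = 0%N by lia.
  subst i; exists (taug t *: r).
  by rewrite -rpairZ -(tpure_eq_scal ht).
- by exists 0; rewrite /rpair !raddf0.
- by exists (r1 - r2); rewrite rpairB.
Qed.

Lemma rpair_inj (r r' : bimod_of R) : idealV (\val r - \val r') -> r = r'.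
Proof.
move=> /(idealV_thom_le (leqnn n)); rewrite thomB.
rewrite (thom_pure (R_pure (bimod_ofP r))) (thom_pure (R_pure (bimod_ofP r'))).
by move/eqP; rewrite subr_eq0 => /eqP e; exact: val_inj.
Qed.

(** Below degree n there are no terms t r, and in degree n these are just elements of R, while <R>V
    vanishes up to degree n. Nontrivial syzygies therefore start in degree n + 1. *)
Lemma lrelpairs_le m x : (m <= n)%N -> lrelpairs m x -> idealV x.1 -> x = 0.
Proof.
rewrite leq_eqVlt => /orP[/eqP -> /lrelpairs_n[r ->] hV|mn].
  have -> : r = 0 by apply: rpair_inj; rewrite (_ : \val (0 : bimod_of R) = 0) ?subr0.
  by rewrite -(subrr 0) rpairB subrr.
move=> hx _; apply: (zspan_eq0 (f := idfun)) hx => // ? [i [t [r [ein _ _]]]].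
by lia.
Qed.

Lemma relpairs_lmul e t m x : tpure e t -> relpairs m x -> relpairs (e + m) (lmul t x).
Proof.
move=> ht; apply: (zspan_map (lmulB t)) => _ [i [k [u [r [u' [<- hu hu' ->]]]]]].
apply: zspan_in; exists (e + i)%N, k, (t * u), r, u'.
by split; rewrite ?lmulA ?addnA //; exact: tpureM.
Qed.

Lemma relpairs_rscal s m x : relpairs m x -> relpairs m (rmul (tscal V s) x).
Proof.
apply: (zspan_map (rmulB _)) => _ [i [k [u [r [u' [<- hu hu' ->]]]]]].
apply: zspan_in; exists i, k, u, r, (u' * tscal V s).
split=> //; last by rewrite -lmul_rmul rmulA.
by rewrite -[k]addn0; apply: tpureM => //; exact: tpure_scal.
Qed.

Lemma deformed_lmul e t m x :
  tpure e t -> deformed_lt m x -> deformed_lt (e + m) (t * x).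
Proof.
move=> ht; apply: (zspan_map (mulrBr t)) => _ [i [k [u [r [u' [h hu hu' ->]]]]]].
apply: zspan_in; exists (e + i)%N, k, (t * u), r, u'.
by split; rewrite ?mulrA //; [lia|exact: tpureM].
Qed.

Lemma deformed_mul_var v m x : deformed_lt m x -> deformed_lt m.+1 (x * tvar v).
Proof.
apply: (zspan_map (mulrBl _)) => _ [i [k [u [r [u' [h hu hu' ->]]]]]].
apply: zspan_in; exists i, (k + 1)%N, u, r, (u' * tvar v).
by split; rewrite ?mulrA //; [lia|apply: tpureM => //; exact: tpure_var].
Qed.

Lemma deformed_le m m' x : (m <= m')%N -> deformed_lt m x -> deformed_lt m' x.
Proof.
move=> mm; apply: (zspan_map (f := idfun)) => // y [i [k [u [r [u' [h hu hu' ->]]]]]].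
by apply: zspan_in; exists i, k, u, r, u'; split=> //; lia.
Qed.

Lemma reducible_lmul e t m x : tpure e t -> reducible m x -> reducible (e + m) (lmul t x).
Proof.
move=> ht; apply: (zspan_map (lmulB t)) => y [hy|[y1 y2]]; apply: zspan_in.
- left; move: hy; apply: (zspan_map (lmulB t)) => _ [m' [y' [v [-> hy' ->]]]].
  apply: zspan_in; exists (e + m')%N, (lmul t y'), v.
  by split; rewrite ?addnS ?lmul_rmul //; exact: relpairs_lmul.
- by right; split; [rewrite /= y1 mulr0|exact: deformed_lmul].
Qed.

Lemma lrelpairs_lmul e t m x : tpure e t -> lrelpairs m x -> lrelpairs (e + m) (lmul t x).
Proof.
move=> ht; apply: (zspan_map (lmulB t)) => _ [i [u [r [<- hu ->]]]].
apply: zspan_in; exists (e + i)%N, (t * u), r.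
by split; rewrite ?lmulA ?addnA //; exact: tpureM.
Qed.

Let deformed_mulr i t r k t' j b : tpure i t -> tpure k t' -> tdeg_lt j b ->
  deformed_lt (i + n + k + j) (t * alpha r * (t' * b)).
Proof.
move=> ht ht'; move: b; apply: tdeg_lt_ind => [m b mj hb||b c hb hc].
- apply: zspan_in; exists i, (k + m)%N, t, r, (t' * b).
  by split=> //; [lia|exact: tpureM].
- by rewrite !mulr0; exact: zspan0.
- by rewrite !mulrDr; exact: zspanD.
Qed.

Let deformed_mull i t r k t' j b : tpure i t -> tpure k t' -> tdeg_lt j b ->
  deformed_lt (i + j + k + n) (t * b * t' * alpha r).
Proof.
move=> ht ht'; move: b; apply: tdeg_lt_ind => [m b mj hb||b c hb hc].
- apply: zspan_in; exists (i + m + k)%N, 0%N, (t * b * t'), r, (tscal V 1).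
  split; rewrite ?rmorph1 ?mulr1 //; [lia| |exact: tpure_scal].
  by apply: tpureM => //; exact: tpureM.
- by rewrite !(mulr0, mul0r); exact: zspan0.
- by rewrite mulrDr !mulrDl; exact: zspanD.
Qed.

Hypothesis n_gt0 : (0 < n)%N.

(* The trivial overlaps: both sides of t * rho * t' * r can be deformed. *)
Lemma ideal_lmul_reducible e t r :
  ideal_gen R t -> reducible (e + n) (lmul (thom e t) (rpair r)).
Proof.
move/(ideal_hspan e); elim=> {t} [t||t u _ ht _ hu]; last 2 first.
- by rewrite lmul0l; exact: zspan0.
- rewrite (_ : lmul (t - u) (rpair r) = lmul t (rpair r) - lmul u (rpair r)).
    exact: zspanB.
  by rewrite /lmul !mulrBl.
move=> [i [k [t1 [rho [t' [<- ht1 ht' ->]]]]]].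
(* Deforming r or deforming rho in t1 rho t' r gives the same leading part. The two deformations
   differ by two terms containing alpha r - r and alpha rho - rho, which have degree below n. *)
rewrite (_ : lmul _ _ = lmul t1 (rmul (t' * \val r) (rpair rho)) +
    (0, t1 * alpha rho * (t' * (alpha r - \val r))
        - t1 * (alpha rho - \val rho) * t' * alpha r)).
  apply: zspanD; apply: zspan_in; [left|right].
    rewrite -addnA; apply: relpairs_relpairsV => //; last by rewrite addn_gt0 n_gt0 orbT.
    by apply: tpureM => //; apply/R_pure/bimod_ofP.
  by split=> //; apply: zspanB; [exact: deformed_mulr|exact: deformed_mull].
rewrite /lmul /rmul -[RHS]/(_ + 0, _ + _) addr0 !mulrA; congr pair.
have cancel3 (a b c : T) : c = a + ((b - a) - (b - c)).
  by rewrite opprB [b - a + _]addrC subrKA addrC subrK.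
by rewrite !mulrBr !mulrBl -cancel3.
Qed.

End HomogeneousRelations.

(** * Dual bases of the projective module V and the reduction of relations *)

Section DualBasis.
Variables (S : pzRingType) (V : lmodType S).

(** With every element of V homogeneous in every degree, the free module on homogeneous elements
    becomes a free cover of V over S; the degrees carry no information here. *)
Definition all_grmod : grmod S := @GrMod S V (fun _ => setT).

Lemma free_eval_inj (A : pzRingType) (M : grmod A) (b : homog M) (a : A) :
  free_eval (dinj b a : Defs.free M) = a *: hval b.
Proof.
rewrite /free_eval; apply: (@dlift_inj _ _ M (fun b (a : A) => a *: hval b)) => c x y.
by rewrite scalerBl.
Qed.

Lemma free_evalD (A : pzRingType) (M : grmod A) :
  {morph @free_eval A M : f g / f + g}.
Proof. exact: raddfD. Qed.

Lemma free_eval0 (A : pzRingType) (M : grmod A) : free_eval (0 : Defs.free M) = 0.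
Proof. exact: raddf0. Qed.

Lemma projective_section : projective V ->
  exists psi : {linear V -> Defs.free all_grmod}, forall v, free_eval (psi v) = v.
Proof.
move=> /(_ _ _ (@free_eval S all_grmod) (idfun : {linear V -> V})).
apply=> v; have b0 : `[< @grcomp _ all_grmod (0%N, v).1 (0%N, v).2 >] by apply/asboolP.
exists (dinj (exist _ (0%N, v) b0 : homog all_grmod) (1 : S)).
by apply: (etrans (free_eval_inj _ _)); exact: scale1r.
Qed.

End DualBasis.

Section Reduction.
Variables (S : pzRingType) (V : bimodType S) (n : nat).
Local Notation T := (tens_alg V).
Variable R : subbimod T.
Hypothesis R_pure : forall x, R x -> tpure n x.
Variable alpha : {linear bimod_of R -> T}.
Hypothesis alpha_ract : forall r s, alpha (ract r s) = ract (alpha r) s.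

Local Notation GV := (@all_grmod S V).
Variable psi : {linear V -> Defs.free GV}.
Hypothesis psiK : forall v, free_eval (psi v) = v.

Section Coordinate.
Variable b : homog GV.

Definition vcoord (v : V) : T^o := tscal V (psi v b).

Lemma vcoordB : {morph vcoord : v w / v - w}.
Proof. by move=> v w; rewrite /vcoord raddfB dcoefB raddfB. Qed.
HB.instance Definition _ := GRing.isZmodMorphism.Build V T^o vcoord vcoordB.

Lemma vcoordZ s v : vcoord (s *: v) = (idfun (tscal V s) : T) *: vcoord v.
Proof.
have e : psi (s *: v) b = s * psi v b by rewrite linearZ.
by rewrite /vcoord e (rmorphM (tscal V)).
Qed.

(** On T^+ = T (x) V this takes the coordinate of the last letter at b. Flatness of V is used in
    this form: a relation between products y v passes to each coordinate. *)
Definition tcoord : T -> T^o := @rder S V T idfun T^o vcoord.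

Lemma tcoordB : {morph tcoord : x y / x - y}. Proof. exact: rderB vcoordZ. Qed.

Lemma tcoord0 : tcoord 0 = 0.
Proof. by have := tcoordB 0 0; rewrite !subrr. Qed.

Lemma tcoordM_var x v : tcoord (x * tvar v) = x * tscal V (psi v b).
Proof. exact: (rderM_var vcoordZ). Qed.

End Coordinate.

Definition var_comb : @dsum (homog GV) (fun=> T) -> T :=
  dlift (fun (b : homog GV) (y : T) => y * @tvar S V (hval b)).

Let combB (b : homog GV) : {morph (fun y : T => y * @tvar S V (hval b)) : x y / x - y}.
Proof. exact: mulrBl. Qed.

Lemma free_var_comb y (g : Defs.free GV) : exists c : @dsum (homog GV) (fun=> T),
  (forall b, c b = y * tscal V (g b)) /\ y * tvar (free_eval g) = var_comb c.
Proof.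
move: g; apply: dsum_ind => [b s||g h [c [hc ec]] [d [hd ed]]].
- exists (dinj b (y * tscal V s)); split=> [b'|].
    have [<-|bb] := pselect (b = b'); first by rewrite !dinjE.
    by rewrite !dinjNE // raddf0 mulr0.
  by rewrite free_eval_inj /var_comb (dlift_inj combB) -scal_tvar mulrA.
- exists 0; split=> [b|]; first by rewrite dcoef0 raddf0 mulr0.
  by rewrite free_eval0 raddf0 mulr0 /var_comb (dlift0 combB).
- exists (c + d); split=> [b|]; first by rewrite dcoefD hc hd raddfD mulrDr.
  by rewrite free_evalD raddfD mulrDr ec ed /var_comb (dliftD combB).
Qed.

(** The last letter of each term is expanded along the dual basis. The coefficients are scalars and
    go into the right factor of a pair of degree m; a direct sum is used because only finitely many
    of them may be nonzero. *)
Lemma relpairsV_coord m x : relpairsV n alpha m.+1 x ->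
  exists c : @dsum (homog GV) (fun=> T),
    (forall b, relpairs n alpha m (tcoord b x.1, c b)) /\ x.2 = var_comb c.
Proof.
elim=> {x} [_ [m' [y [v [[<-] hy ->]]]]||x y _ [c [hc ec]] _ [d [hd ed]]].
- have [c [hc ec]] := free_var_comb y.2 (psi v); exists c; split=> [b|].
    by rewrite /= tcoordM_var hc; exact: relpairs_rscal.
  by rewrite -ec psiK.
- exists 0; split=> [b|]; last by rewrite /var_comb (dlift0 combB).
  by rewrite /= tcoord0; exact: zspan0.
- exists (c - d); split=> [b|]; last first.
    by rewrite /var_comb (dliftB combB) -/(var_comb c) -/(var_comb d) -ec -ed.
  by rewrite /= tcoordB; exact: (zspanB (hc b) (hd b)).
Qed.

Hypothesis syzygies_reducible : forall m x,
  lrelpairs n alpha m x -> idealV R x.1 -> reducible n alpha m x.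

(* The cancelling leading terms of a relation among the deformed relations can
   be lowered in degree, first those of the form t * r and then, coordinate by
   coordinate in the last factor, the others. *)
Lemma relpairs_deformed m x : relpairs n alpha m x -> x.1 = 0 -> deformed_lt n alpha m x.2.
Proof.
elim/ltn_ind: m x => m IH x hx x0; have [y [z [hy hz e]]] := relpairs_split alpha_ract hx.
(* The leading parts cancel, so y.1 = - z.1 lies in <R>V and y is a syzygy. *)
have hyV : idealV R y.1.
  have -> : y.1 = - z.1 by apply/eqP; rewrite -addr_eq0 -[y.1 + z.1]/((y + z).1) -e x0.
  by apply: zspanN; exact: relpairsV_fst hz.
have [w [hw ew hdef]] := reducible_inv (syzygies_reducible hy hyV).
have hwz : relpairsV n alpha m (w + z) := zspanD hw hz.
have wz0 : (w + z).1 = 0 by rewrite -x0 e -[LHS]/(w.1 + z.1) ew.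
(* Trading y for w costs only terms of lower formal degree; in what remains, w + z, every term has a
   last letter. *)
have -> : x.2 = (y.2 - w.2) + (w + z).2 by rewrite e addrA subrK.
apply: zspanD hdef _; move: (w + z) hwz wz0 => d {x hx x0 y z hy hz e hyV w hw ew}.
case: m IH => [|m] IH hd d0.
  have -> : d = 0 by apply: (zspan_eq0 (f := idfun)) hd => // ? [m' [y [v []]]].
  exact: zspan0.
have [c [hc ->]] := relpairsV_coord hd.
(* The leading part is 0, hence so are its coordinates: each c b comes from a cancelling relation of
   degree m, to which the induction applies. *)
have hcd b : deformed_lt n alpha m (c b).
  apply: (IH m _ (tcoord b d.1, c b)); [by []|exact: hc|].
  by rewrite /= d0 tcoord0.
rewrite /var_comb /dlift fsbigop.fsbig_finite; last exact: dsum_finite.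
by apply: zspan_sum => b _; apply: deformed_mul_var; exact: hcd.
Qed.

End Reduction.

(** * Homogeneous elements of free modules and their syzygies *)

Section FreeModules.
Variables (A : pzRingType) (gA : nat -> set A).
Hypothesis gA0 : forall m, gA m 0.
Hypothesis gAB : forall m a b, gA m a -> gA m b -> gA m (a - b).
Variable M : grmod A.

Lemma free_scale_dinj (a c : A) (b : homog M) :
  a *: (dinj b c : Defs.free M) = dinj b (a * c).
Proof.
apply: dsumP => b'; rewrite -[LHS]/(a * dinj b c b').
have [<-|bb] := pselect (b = b'); first by rewrite !dinjE.
by rewrite !dinjNE // mulr0.
Qed.

Lemma free_comp_dinj m j (b : homog M) a :
  gA j a -> m = (j + hdeg b)%N -> free_comp gA m (dinj b a : Defs.free M).
Proof.
move=> ha -> b'; have [<-|bb] := pselect (b = b').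
  by rewrite dinjE leq_addl addnK.
by rewrite dinjNE //; case: ifP.
Qed.

Lemma free_comp0 m : free_comp gA m (0 : Defs.free M).
Proof. by move=> b; case: ifP. Qed.

Lemma free_compB m (f g : Defs.free M) :
  free_comp gA m f -> free_comp gA m g -> free_comp gA m (f - g).
Proof.
move=> hf hg b; have := hf b; have := hg b; case: ifP => _ hgb hfb.
  exact: gAB.
by rewrite -[LHS]/(f b - g b) hfb hgb subrr.
Qed.

Lemma free_compD m (f g : Defs.free M) :
  free_comp gA m f -> free_comp gA m g -> free_comp gA m (f + g).
Proof.
move=> hf hg; rewrite -[g]opprK -[- g]sub0r.
by apply: free_compB => //; apply: free_compB => //; exact: free_comp0.
Qed.

Lemma free_comp_ind (Q : Defs.free M -> Prop) m :
    (forall b a, (hdeg b <= m)%N -> gA (m - hdeg b) a -> Q (dinj b a)) -> Q 0 ->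
    (forall f g, Q f -> Q g -> Q (f + g)) ->
  forall f, free_comp gA m f -> Q f.
Proof.
move=> Qi Q0 QD f hf; rewrite [f]dsum_sum /dlift.
apply: (big_ind Q) => // b _; have := hf b; case: ifP => [bm|_ ->]; first exact: Qi.
by rewrite raddf0.
Qed.

Definition svalz (f : syzygy gA M) : Defs.free M := \val (f : syzygy_type M).

Lemma svalz_eval f : free_eval (svalz f) = 0.
Proof. exact/eqP/(valP (f : syzygy_type M)). Qed.

Lemma svalz_linear : linear svalz.
Proof. by []. Qed.
HB.instance Definition _ :=
  GRing.isLinear.Build A (syzygy gA M) (Defs.free M) *:%R svalz svalz_linear.

Lemma svalzZ a f : svalz (a *: f) = a *: svalz f. Proof. by []. Qed.
Lemma svalzD f g : svalz (f + g) = svalz f + svalz g. Proof. by []. Qed.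
Lemma svalzB f g : svalz (f - g) = svalz f - svalz g. Proof. by []. Qed.
Lemma svalz0 : svalz 0 = 0. Proof. by []. Qed.

Lemma svalz_inj : injective svalz.
Proof. exact: val_inj. Qed.

Lemma syzygy_ex (f : Defs.free M) : free_eval f = 0 -> exists g, svalz g = f.
Proof.
move=> hf; have h : f \in @syz_pred A M by apply/eqP.
by exists (exist _ f h).
Qed.

Lemma svalz_comp (b : homog (syzygy gA M)) : free_comp gA (hdeg b) (svalz (hval b)).
Proof. by case: b => [[m f] h]; have /asboolP := h. Qed.

Lemma homog_syz_ex m (f : Defs.free M) : free_eval f = 0 -> free_comp gA m f ->
  exists b : homog (syzygy gA M), hdeg b = m /\ svalz (hval b) = f.
Proof.
move=> /syzygy_ex[g <-] hf.
have h : `[< @grcomp _ (syzygy gA M) (m, g).1 (m, g).2 >] by apply/asboolP.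
by exists (exist _ (m, g) h).
Qed.

End FreeModules.

(** * Syzygies and Tor *)

Section TorSyzygies.
Variables (S : pzRingType) (V : bimodType S) (n : nat).
Hypothesis n_gt0 : (0 < n)%N.
Local Notation T := (tens_alg V).
Variable P : subbimod T.
Local Notation R := (top n P).
Local Notation A := (qring (top n P)).
Local Notation pi := (qproj (top n P)).
Local Notation eps := (aug n_gt0 P).
Local Notation gA := (@Acomp S V (top n P)).

Lemma top_pure x : R x -> tpure n x.
Proof. by case=> y _ <-; exact: tpure_thom. Qed.

Lemma aug_proj t : eps (pi t) = taug t. Proof. exact: qlift_proj. Qed.

Lemma proj0 : pi 0 = 0. Proof. exact: raddf0. Qed.
Lemma projD : {morph pi : x y / x + y}. Proof. exact: raddfD. Qed.
Lemma projM : {morph pi : x y / x * y}. Proof. exact: rmorphM. Qed.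

Lemma augM : {morph eps : a b / a * b}. Proof. exact: rmorphM. Qed.

Lemma Acomp0 m : gA m 0.
Proof. by exists 0; [exact: tpure0|rewrite raddf0]. Qed.

Lemma AcompB m a b : gA m a -> gA m b -> gA m (a - b).
Proof. by move=> [t ht <-] [u hu <-]; exists (t - u); [exact: tpureB|rewrite raddfB]. Qed.

Local Notation M0 := (lres_grmod eps).
Local Notation M1 := (syzygy gA M0).
Local Notation M2 := (syzygy gA M1).
Local Notation M3 := (syzygy gA M2).

(** The first of three comparison maps from the standard resolution to A (x) R -> A (x) V -> A. It
    lifts the evaluation F_0 -> S through A -> S. The third map, [lift2], takes values modulo
    reducible pairs only. *)
Definition lift0 : Defs.free M0 -> A^o :=
  dlift (fun (b : homog M0) (a : A) => a * pi (tscal V (hval b))).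

Let lift0_aux (b : homog M0) :
  {morph (fun a : A => a * pi (tscal V (hval b)) : A^o) : x y / x - y}.
Proof. exact: mulrBl. Qed.

Lemma lift0_dinj b a : lift0 (dinj b a) = a * pi (tscal V (hval b)).
Proof. exact: (dlift_inj lift0_aux). Qed.

Lemma lift0D : {morph lift0 : f g / f + g}. Proof. exact: dliftD lift0_aux. Qed.
Lemma lift00 : lift0 0 = 0. Proof. exact: dlift0 lift0_aux. Qed.

Lemma lift0Z a f : lift0 (a *: f) = a * lift0 f.
Proof.
move: f; apply: dsum_ind => [b c||f g hf hg].
- by rewrite free_scale_dinj !lift0_dinj mulrA.
- by rewrite scaler0 lift00 mulr0.
- by rewrite scalerDr !lift0D hf hg mulrDr.
Qed.

Lemma aug_lift0 f : eps (lift0 f) = free_eval f.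
Proof.
move: f; apply: dsum_ind => [b c||f g hf hg].
- by rewrite free_eval_inj lift0_dinj rmorphM aug_proj taug_scal.
- by rewrite lift00 free_eval0 raddf0.
- by rewrite lift0D free_evalD -hf -hg; exact: raddfD.
Qed.

Lemma lift0_comp m f : free_comp gA m f -> exists2 t, tpure m t & pi t = lift0 f.
Proof.
move: f; apply: free_comp_ind => [b _ bm [t ht <-]||f g [t ht et] [u hu eu]].
- rewrite lift0_dinj; have /asboolP hb := valP b.
  (* S sits in degree 0, so a basis element of any other degree is indexed by the value 0. *)
  have [b0|b0] : hdeg b = 0%N \/ hval b = 0 := hb; last first.
    by exists 0; [exact: tpure0|rewrite b0 tscal0 !raddf0 mulr0].
  exists (t * tscal V (hval b)); last by rewrite rmorphM.
  by rewrite -[m]addn0; apply: tpureM; [rewrite b0 subn0 in ht|exact: tpure_scal].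
- by exists 0; [exact: tpure0|rewrite lift00 raddf0].
- by exists (t + u); [exact: tpureD|rewrite raddfD /= et eu lift0D].
Qed.

(** A relation evaluates to 0 in S, so its image under [lift0] has augmentation 0, and so does any
    representative in T. *)
Lemma homog1_ex (b : homog M1) : exists y,
  [/\ tpure (hdeg b) y, taug y = 0 & pi y = lift0 (svalz (hval b))].
Proof.
have [y hy ey] := lift0_comp (svalz_comp b).
have y0 : taug y = 0.
  by rewrite -aug_proj ey aug_lift0; exact: (svalz_eval (hval b)).
by exists y.
Qed.

Variable y1 : homog M1 -> T.
Hypothesis y1P : forall b,
  [/\ tpure (hdeg b) (y1 b), taug (y1 b) = 0 & pi (y1 b) = lift0 (svalz (hval b))].

Local Notation IV := (idealV R).

(* T^+/<R>V = A (x) V *)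
Local Notation quoV := (Quotient.quot (zspan_pred
  [set z | exists y v, ideal_gen R y /\ z = y * tvar v])).
Definition qV : T -> quoV := qpi _.

Lemma qV0P x : qV x = 0 <-> IV x.
Proof. by rewrite /qV qpi0; split=> [/asboolP|h] //; apply/asboolP. Qed.

Lemma qVP x y : qV x = qV y <-> IV (x - y).
Proof. by rewrite /qV qpiP; split=> [/asboolP|h] //; apply/asboolP. Qed.

Lemma qVB : {morph qV : x y / x - y}. Proof. exact: qpiB. Qed.
HB.instance Definition _ := GRing.isZmodMorphism.Build T quoV qV qVB.

(** The choice of the representative of a does not matter: [y1 b] lies in T^+, and <R>T^+ is
    contained in <R>V. *)
Definition lift1 : Defs.free M1 -> quoV :=
  dlift (fun (b : homog M1) (a : A) => qV (repr a * y1 b)).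

Let lift1_aux (b : homog M1) : {morph (fun a : A => qV (repr a * y1 b)) : x y / x - y}.
Proof.
move=> x y /=; rewrite -qVB; apply/qVP; rewrite -!mulrBl.
have [_ + _] := y1P b; apply: ideal_mul_aug0.
by apply/qprojP; rewrite raddfB /= !qprojK.
Qed.

Lemma lift1_dinj b t : lift1 (dinj b (pi t)) = qV (t * y1 b).
Proof.
rewrite /lift1 (dlift_inj lift1_aux); apply/qVP; rewrite -mulrBl.
by have [_ + _] := y1P b; apply: ideal_mul_aug0; exact: qproj_repr.
Qed.

Lemma lift1D : {morph lift1 : f g / f + g}. Proof. exact: dliftD lift1_aux. Qed.
Lemma lift1B : {morph lift1 : f g / f - g}. Proof. exact: dliftB lift1_aux. Qed.
Lemma lift10 : lift1 0 = 0. Proof. exact: dlift0 lift1_aux. Qed.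

(** The target is only a group, so this stands for A-linearity. It uses that <R>V is stable under
    left multiplication by T. *)
Lemma lift1P f u : lift1 f = qV u -> forall t, lift1 (pi t *: f) = qV (t * u).
Proof.
have [u' h] : exists u', forall t, lift1 (pi t *: f) = qV (t * u').
  move: f; apply: dsum_ind => [b c||f g [u1 h1] [u2 h2]].
  - exists (repr c * y1 b) => t.
    by rewrite -[c in LHS]qprojK free_scale_dinj -rmorphM lift1_dinj mulrA.
  - by exists 0 => t; rewrite scaler0 lift10 mulr0 raddf0.
  - by exists (u1 + u2) => t; rewrite scalerDr lift1D h1 h2 mulrDr raddfD.
have := h 1; rewrite rmorph1 scale1r mul1r => -> e t; rewrite h; apply/qVP.
by rewrite -mulrBr; apply: idealV_lmul; apply/qVP.
Qed.

(** A single homogeneous y represents both values, which says that [lift0] and [lift1] commute with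
    the differentials. *)
Lemma lift1_comp m f : free_comp gA m f ->
  exists y, [/\ tpure m y, lift1 f = qV y & pi y = lift0 (svalz (free_eval f))].
Proof.
move: f; apply: free_comp_ind => [b _ bm [t ht <-]||f g [t [ht et et']] [u [hu eu eu']]].
- have [hy _ ey] := y1P b; exists (t * y1 b).
  rewrite lift1_dinj rmorphM /= ey free_eval_inj linearZ lift0Z; split=> //.
  by rewrite -(subnK bm); exact: tpureM.
- exists 0; split; first exact: tpure0.
    by rewrite lift10 raddf0.
  by rewrite free_eval0 !raddf0 lift00.
- exists (t + u); split; first exact: tpureD.
    by rewrite lift1D et eu raddfD.
  by rewrite free_evalD raddfD /= et' eu' raddfD lift0D.
Qed.

Lemma unit_ex : exists e : Defs.free M0,
  [/\ free_comp gA 0 e, free_eval e = 1 & lift0 e = 1].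
Proof.
have b0 : `[< @grcomp _ M0 (0%N, 1 : lres eps).1 (0%N, 1 : lres eps).2 >].
  by apply/asboolP; left.
pose b : homog M0 := exist _ (0%N, 1 : lres eps) b0.
exists (dinj b 1); split.
- apply: (free_comp_dinj Acomp0 (j := 0)) => //.
  by exists (tscal V 1); [exact: tpure_scal|rewrite !rmorph1].
- by rewrite free_eval_inj scale1r.
- by rewrite lift0_dinj mul1r !rmorph1.
Qed.

Variable e1 : Defs.free M0.
Hypothesis e1P : [/\ free_comp gA 0 e1, free_eval e1 = 1 & lift0 e1 = 1].

Lemma homog_var_ex (v : V) :
  exists b : homog M1, hdeg b = 1%N /\ svalz (hval b) = pi (tvar v) *: e1.
Proof.
have [hc he _] := e1P; apply: homog_syz_ex.
  rewrite free_evalZ he -[LHS]/(eps (pi (tvar v)) * 1) aug_proj mulr1.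
  exact: taug_pure (tpure_var v) isT.
move: e1 hc; apply: free_comp_ind => [b _ b0 [t ht <-]||f g hf hg].
- rewrite free_scale_dinj -projM.
  apply: (free_comp_dinj Acomp0 (j := 1)); last by lia.
  exists (tvar v * t) => //; have -> : 1%N = (1 + (0 - hdeg b))%N by lia.
  by apply: tpureM => //; exact: tpure_var.
- by rewrite scaler0; exact: (free_comp0 Acomp0).
- by rewrite scalerDr; exact: (free_compD Acomp0 AcompB hf hg).
Qed.

Variable bV : V -> homog M1.
Hypothesis bVP : forall v, hdeg (bV v) = 1%N /\ svalz (hval (bV v)) = pi (tvar v) *: e1.

Hypothesis n_gt1 : (1 < n)%N.

(** Both sides have degree 1 and the same class in A, and <R> is 0 in degree 1 because n > 1. *)
Lemma y1_var v : y1 (bV v) = tvar v.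
Proof.
have [hd hv] := bVP v; have [hy _ ey] := y1P (bV v); have [_ _ e10] := e1P.
rewrite hd in hy; apply/eqP; rewrite -subr_eq0.
rewrite -(thom_pure (tpureB hy (tpure_var v))); apply/eqP.
apply: (ideal_thom_lt top_pure n_gt1); apply/qprojP.
by rewrite ey hv lift0Z e10 mulr1.
Qed.

Variable psi : {linear V -> Defs.free (all_grmod V)}.
Hypothesis psiK : forall v, free_eval (psi v) = v.

Let sigma_aux (b : homog (all_grmod V)) :
  {morph (fun s : S => dinj (bV (hval b)) (pi (tscal V s)) : Defs.free M1) : x y / x - y}.
Proof. by move=> x y; rewrite -raddfB -[in RHS]raddfB tscalB. Qed.

(** The choice [bV] need not be additive. Applying it only to the elements of the dual basis, after
    expanding v by [psi], gives a map V -> F_1 that is linear over S. *)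
Definition sigma_free : Defs.free (all_grmod V) -> Defs.free M1 :=
  dlift (fun (b : homog (all_grmod V)) (s : S) =>
    dinj (bV (hval b)) (pi (tscal V s)) : Defs.free M1).

Lemma sigma_freeB : {morph sigma_free : x y / x - y}. Proof. exact: dliftB sigma_aux. Qed.
Lemma sigma_freeD : {morph sigma_free : x y / x + y}. Proof. exact: dliftD sigma_aux. Qed.
Lemma sigma_free0 : sigma_free 0 = 0. Proof. exact: dlift0 sigma_aux. Qed.
Lemma sigma_free_dinj (b : homog (all_grmod V)) s :
  sigma_free (dinj b s) = dinj (bV (hval b)) (pi (tscal V s)).
Proof. exact: (dlift_inj sigma_aux). Qed.

Definition sigma (v : V) : Defs.free M1 := sigma_free (psi v).

Lemma sigmaB : {morph sigma : v w / v - w}.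
Proof. by move=> v w; rewrite /sigma raddfB sigma_freeB. Qed.
HB.instance Definition _ := GRing.isZmodMorphism.Build V (Defs.free M1) sigma sigmaB.

Lemma sigmaZ s v : sigma (s *: v) = pi (tscal V s) *: sigma v.
Proof.
rewrite /sigma linearZ /=; move: (psi v); apply: dsum_ind => [b c||f g hf hg].
- rewrite [s *: _](free_scale_dinj s c b) !sigma_free_dinj free_scale_dinj.
  by rewrite (rmorphM (tscal V)) projM.
- by rewrite scaler0 sigma_free0 scaler0.
- by rewrite scalerDr !sigma_freeD scalerDr hf hg.
Qed.

Lemma sigma_lift v : lift1 (sigma v) = qV (tvar v).
Proof.
rewrite /sigma -[v in RHS]psiK; move: (psi v); apply: dsum_ind => [b c||f g hf hg].
- by rewrite sigma_free_dinj lift1_dinj y1_var free_eval_inj -scal_tvar.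
- by rewrite sigma_free0 lift10 free_eval0 !raddf0.
- by rewrite sigma_freeD lift1D hf hg free_evalD tvarD raddfD.
Qed.

Lemma sigma_eval v : svalz (free_eval (sigma v)) = pi (tvar v) *: e1.
Proof.
rewrite /sigma -[v in RHS]psiK; move: (psi v); apply: dsum_ind => [b c||f g hf hg].
- have [_ hv] := bVP (hval b).
  by rewrite sigma_free_dinj !free_eval_inj svalzZ hv scalerA -projM scal_tvar.
- by rewrite sigma_free0 !free_eval0 svalz0 tvar0 proj0 scale0r.
- by rewrite sigma_freeD !free_evalD svalzD hf hg tvarD projD scalerDl.
Qed.

Lemma sigma_comp v : free_comp gA 1 (sigma v).
Proof.
rewrite /sigma; move: (psi v); apply: dsum_ind => [b c||f g hf hg].
- have [hd _] := bVP (hval b); rewrite sigma_free_dinj.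
  apply: (free_comp_dinj Acomp0 (j := 0)); last by rewrite hd.
  by exists (tscal V c); first exact: tpure_scal.
- by rewrite sigma_free0; exact: (free_comp0 Acomp0).
- by rewrite sigma_freeD; exact: (free_compD Acomp0 AcompB hf hg).
Qed.

(** A comparison map in the other direction, A (x) V -> F_1, written on T: it kills <R>V by
    [f1_idealV], and [f1_lift] makes it a section of [lift1] on T^+. *)
Definition f1 : T -> Defs.free M1 := rder pi sigma.

Lemma f1B : {morph f1 : x y / x - y}. Proof. exact: rderB sigmaZ. Qed.
HB.instance Definition _ := GRing.isZmodMorphism.Build T (Defs.free M1) f1 f1B.

Lemma f1M_var y v : f1 (y * tvar v) = pi y *: sigma v.
Proof. exact: rderM_var sigmaZ _ _. Qed.

Lemma f1_mul t x : taug x = 0 -> f1 (t * x) = pi t *: f1 x.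
Proof.
move/taug0_span; elim=> {x} [_ [y [v ->]]||x y _ hx _ hy].
- by rewrite mulrA !f1M_var rmorphM scalerA.
- by rewrite mulr0 raddf0 scaler0.
- by rewrite mulrBr !f1B hx hy scalerBr.
Qed.

Lemma f1_lift x : taug x = 0 -> lift1 (f1 x) = qV x.
Proof.
move/taug0_span; elim=> {x} [_ [y [v ->]]||x y _ hx _ hy].
- by rewrite f1M_var; apply: lift1P; exact: sigma_lift.
- by rewrite !raddf0 lift10.
- by rewrite f1B lift1B hx hy raddfB.
Qed.

Lemma f1_eval x : taug x = 0 -> svalz (free_eval (f1 x)) = pi x *: e1.
Proof.
move/taug0_span; elim=> {x} [_ [y [v ->]]||x y _ hx _ hy].
- by rewrite f1M_var !linearZ /= sigma_eval scalerA rmorphM.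
- by rewrite !raddf0 scale0r.
- by rewrite f1B !raddfB /= hx hy scalerBl.
Qed.

Lemma f1_comp m x : (0 < m)%N -> tpure m x -> free_comp gA m (f1 x).
Proof.
case: m => // m _ /tpureS_span; elim=> {x} [_ [y [v [hy ->]]]||x y _ hx _ hy].
- rewrite f1M_var; move: (sigma v) (sigma_comp v).
  apply: free_comp_ind => [b _ b1 [t ht <-]||f g hf hg].
  + rewrite free_scale_dinj -rmorphM.
    apply: (@free_comp_dinj _ _ Acomp0 _ _ (m + (1 - hdeg b))%N); last by lia.
    by exists (y * t) => //; exact: tpureM.
  + by rewrite scaler0; exact: (free_comp0 Acomp0).
  + by rewrite scalerDr; exact: (free_compD Acomp0 AcompB hf hg).
- by rewrite raddf0; exact: (free_comp0 Acomp0).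
- by rewrite f1B; exact: (free_compB AcompB hx hy).
Qed.

Lemma f1_idealV x : IV x -> f1 x = 0.
Proof.
apply: (zspan_eq0 f1B) => _ [y [v [hy ->]]]; rewrite f1M_var.
by have -> : pi y = 0; [rewrite -proj0; apply/qprojP; rewrite subr0|rewrite scale0r].
Qed.

Lemma rel_taug (r : bimod_of R) : taug (\val r) = 0.
Proof. exact: taug_pure (top_pure (bimod_ofP r)) n_gt0. Qed.

Lemma ideal_proj x : ideal_gen R x <-> pi x = 0.
Proof. by rewrite -proj0 qprojP subr0. Qed.

(** The differential of [f1] at r is the class of r in A times [e1], that is 0. Thus a defining
    relation of A gives a basis element of F_2, in degree n. *)
Lemma homog_rel_ex (r : bimod_of R) :
  exists b : homog M2, hdeg b = n /\ svalz (hval b) = f1 (\val r).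
Proof.
apply: homog_syz_ex.
  apply: (@svalz_inj _ gA M0); rewrite f1_eval ?rel_taug // raddf0.
  have -> : pi (\val r) = 0 by apply/ideal_proj/ideal_in/bimod_ofP.
  exact: scale0r.
by apply: f1_comp => //; apply/top_pure/bimod_ofP.
Qed.

Variable alpha : {linear bimod_of R -> T}.
Hypothesis alpha_ract : forall r s, alpha (ract r s) = ract (alpha r) s.
Hypothesis alpha_lt : forall r, tdeg_lt n (alpha r - \val r).

Local Notation lrel := (lrelpairs n alpha).
Local Notation red := (reducible n alpha).

(** The element y given by [lift1_comp] has class 0 in A, since the differential of the relation b
    vanishes; so y lies in <R>. In its splitting, the part with a last letter lies in <R>V and is 0
    in A (x) V. *)
Lemma homog2_ex (b : homog M2) : exists x,
  lrel (hdeg b) x /\ lift1 (svalz (hval b)) = qV x.1.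
Proof.
have [y [hy ey ey0]] := lift1_comp (svalz_comp b).
have /(ideal_relpairs top_pure alpha (hdeg b))[c] : ideal_gen R y.
  by apply/ideal_proj; rewrite ey0 svalz_eval raddf0 lift00.
rewrite (thom_pure hy) => /(relpairs_split alpha_ract)[x [z [hx hz exz]]].
exists x; split=> //; rewrite ey; apply/qVP.
rewrite -[y]/((y, c).1) exz -[(x + z).1]/(x.1 + z.1) addrC addKr.
exact: relpairsV_fst hz.
Qed.

Variable pq : homog M2 -> T * T.
Hypothesis pqP : forall b, lrel (hdeg b) (pq b) /\ lift1 (svalz (hval b)) = qV (pq b).1.

Variable bR : bimod_of R -> homog M2.
Hypothesis bRP : forall r, hdeg (bR r) = n /\ svalz (hval (bR r)) = f1 (\val r).

(** In degree n a pair comes from a single element of R, and R meets <R>V in 0 only, so the choice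
    of [pq] is forced. *)
Lemma pq_rel r : pq (bR r) = rpair alpha r.
Proof.
have [hd hv] := bRP r; have [] := pqP (bR r).
rewrite hd hv f1_lift ?rel_taug // => hpq /qVP hV.
have [r' e'] := lrelpairs_n hpq; rewrite e' in hV *.
by congr rpair; apply: esym; exact: (rpair_inj top_pure hV).
Qed.

(** These are left multiples of trivial overlaps. Their reducibility makes the lift of F_2
    independent of the representatives of coefficients in A. *)
Lemma ideal_lrel_red e t m x :
  ideal_gen R t -> lrel m x -> red (e + m) (lmul (thom e t) x).
Proof.
move=> ht; apply: (zspan_map (lmulB _)) => _ [i [u [r [<- hu ->]]]].
rewrite lmulA addnA -[thom e t * u](thom_pure (tpureM (tpure_thom e t) hu)).
apply: (ideal_lmul_reducible top_pure alpha_lt n_gt0).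
by apply: Defs.idealMr; apply: ideal_thom top_pure _ _ _.
Qed.

Section Degree.
Variable m : nat.

Definition quored : zmodType := Quotient.quot (zspan_pred (reducible_gen n alpha m)).
Definition qred : T * T -> quored := qpi _.

Lemma qred0P x : qred x = 0 <-> red m x.
Proof. by rewrite /qred qpi0; split=> [/asboolP|h] //; apply/asboolP. Qed.

Lemma qredB : {morph qred : x y / x - y}. Proof. exact: qpiB. Qed.
HB.instance Definition _ := GRing.isZmodMorphism.Build (T * T)%type quored qred qredB.

(* The degree m component of the lift of F_2 to the pairs (t r, t (alpha r)). *)
Definition lift2_coef (b : homog M2) (a : A) : quored :=
  if (hdeg b <= m)%N then qred (lmul (thom (m - hdeg b) (repr a)) (pq b)) else 0.
Definition lift2 : Defs.free M2 -> quored := dlift lift2_coef.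

Lemma lift2_coef_proj b t : lift2_coef b (pi t) =
  if (hdeg b <= m)%N then qred (lmul (thom (m - hdeg b) t) (pq b)) else 0.
Proof.
rewrite /lift2_coef; case: ifP => // bm.
apply/eqP; rewrite -subr_eq0 -raddfB; apply/eqP/qred0P.
rewrite (_ : _ - _ = lmul (thom (m - hdeg b) (repr (pi t) - t)) (pq b)).
  rewrite -{1}(subnK bm); apply: ideal_lrel_red; first exact: qproj_repr.
  by case: (pqP b).
by rewrite /lmul (thomB _ (repr (pi t)) t) !mulrBl.
Qed.

Let lift2_aux (b : homog M2) : {morph lift2_coef b : x y / x - y}.
Proof.
move=> x y; rewrite -[x]qprojK -[y]qprojK -(raddfB pi) !lift2_coef_proj.
case: ifP => _; last by rewrite subr0.
by rewrite -raddfB; congr qred; rewrite /lmul thomB !mulrBl.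
Qed.

Lemma lift2_dinj b t : lift2 (dinj b (pi t)) =
  if (hdeg b <= m)%N then qred (lmul (thom (m - hdeg b) t) (pq b)) else 0.
Proof. by rewrite /lift2 (dlift_inj lift2_aux) lift2_coef_proj. Qed.

Lemma lift2B : {morph lift2 : f g / f - g}. Proof. exact: dliftB lift2_aux. Qed.
HB.instance Definition _ := GRing.isZmodMorphism.Build (Defs.free M2) quored lift2 lift2B.

Lemma lift20 : lift2 0 = 0. Proof. exact: dlift0 lift2_aux. Qed.
Lemma lift2D : {morph lift2 : f g / f + g}. Proof. exact: dliftD lift2_aux. Qed.

(** [lift2] retains degree m only, so it sees t h just when the degrees add up to m; one pair x
    attached to h then gives the value for all t. *)
Lemma lift2_comp k h : free_comp gA k h -> exists x,
  [/\ lrel k x, lift1 (svalz (free_eval h)) = qV x.1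
    & forall e t, tpure e t ->
        lift2 (pi t *: h) = if (e + k == m)%N then qred (lmul t x) else 0].
Proof.
move: h; apply: free_comp_ind => [b _ bk [t ht <-]||f g [x [hx ex lx]] [y [hy ey ly]]].
- have [hpq epq] := pqP b; exists (lmul t (pq b)); split.
  + by rewrite -(subnK bk); exact: lrelpairs_lmul.
  + by rewrite free_eval_inj linearZ /=; exact: lift1P.
  + move=> e u hu; rewrite free_scale_dinj -rmorphM lift2_dinj lmulA.
    have hut := tpureM hu ht; case: ifP => bm; last by case: eqP => //; lia.
    case: eqP => ekm.
      by rewrite thom_pure //; have <- : (e + (k - hdeg b) = m - hdeg b)%N by lia.
    by rewrite (thom_pure_neq hut) ?lmul0l ?raddf0 //; lia.
- exists 0; split; first exact: zspan0.
    by rewrite free_eval0 raddf0 lift10 raddf0.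
  by move=> e t _; rewrite scaler0 !raddf0; case: ifP.
- exists (x + y); split; first exact: zspanD.
    by rewrite free_evalD raddfD lift1D ex ey raddfD.
  move=> e t ht; rewrite scalerDr raddfD /= (lx e) // (ly e) //.
  by case: ifP; rewrite ?addr0 // => _; rewrite -!raddfD.
Qed.

Hypothesis IH : forall k x, (k < m)%N -> lrel k x -> IV x.1 -> red k x.

(** A basis element of F_3 is a relation in F_2, so its image in F_1 is 0, and the pair attached to
    it is a syzygy. *)
Lemma lift2_homog3 (b : homog M3) : exists x, [/\ lrel (hdeg b) x, IV x.1
  & forall e t, tpure e t -> lift2 (pi t *: svalz (hval b)) =
      if (e + hdeg b == m)%N then qred (lmul t x) else 0].
Proof.
have [x [hx ex lx]] := lift2_comp (svalz_comp b); exists x; split=> //.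
by apply/qV0P; rewrite -ex svalz_eval raddf0 lift10.
Qed.

(** A coefficient of degree e > 0 can contribute only by multiplying a syzygy of degree m - e, which
    is reducible by the induction hypothesis and stays so. Only the degree 0 part of the coefficient
    is left. *)
Lemma lift2_aug_homog a (b : homog M3) :
  lift2 (a *: svalz (hval b)) = lift2 (pi (tscal V (eps a)) *: svalz (hval b)).
Proof.
have [x [hx xV lx]] := lift2_homog3 b; rewrite -[a]qprojK aug_proj.
elim/tens_pure_ind: (repr a) => [[|e] t ht||t u ht hu].
- by rewrite {1}(tpure_eq_scal ht).
- rewrite (taug_pure ht isT) tscal0 proj0 scale0r lift20.
  rewrite (lx _ _ ht); case: eqP => // em; apply/qred0P; rewrite -em.
  by apply: reducible_lmul => //; apply: IH => //; lia.
- by rewrite taug0 tscal0.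
- rewrite taugD tscalD !projD !scalerDl !lift2D.
  by rewrite ht hu; reflexivity.
Qed.

Lemma lift2_aug a (f : Defs.free M3) :
  lift2 (a *: svalz (free_eval f)) =
  lift2 (pi (tscal V (eps a)) *: svalz (free_eval f)).
Proof.
move: f; apply: dsum_ind => [b c||f g hf hg].
- rewrite free_eval_inj svalzZ !scalerA lift2_aug_homog [RHS]lift2_aug_homog.
  by rewrite !augM aug_proj taug_scal.
- by rewrite free_eval0 svalz0 !scaler0.
- by rewrite free_evalD svalzD !scalerDr !lift2D hf hg.
Qed.

Local Notation N := (rres eps).

(** This is [lift2] after F_3 -> F_2. It descends to S (x)_A F_3 because coefficients act through
    their augmentation, which rests on the induction hypothesis in lower degrees. *)
Definition theta : tensor N (Defs.free M3) -> quored :=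
  tlift (fun (x : N) f => lift2 (pi (tscal V (x : S)) *: svalz (free_eval f))).

Lemma theta_balanced : balanced (fun (x : N) (f : Defs.free M3) =>
  lift2 (pi (tscal V (x : S)) *: svalz (free_eval f))).
Proof.
split=> [x y f|x f g|x a f].
- by rewrite tscalD projD scalerDl lift2D.
- by rewrite free_evalD svalzD scalerDr lift2D.
- have e : lift2 (pi (tscal V (x : S)) *: svalz (free_eval (a *: f))) =
      lift2 (pi (tscal V ((x : S) * eps a)) *: svalz (free_eval f)).
    by rewrite free_evalZ svalzZ scalerA lift2_aug augM aug_proj taug_scal.
  exact: (esym e).
Qed.

Lemma thetaE x f : theta (tens x f) = lift2 (pi (tscal V (x : S)) *: svalz (free_eval f)).
Proof. exact: tlift_tens theta_balanced _ _. Qed.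

Lemma thetaB : {morph theta : t u / t - u}. Proof. exact: tliftB theta_balanced. Qed.

Lemma theta0 : theta 0 = 0. Proof. exact: tlift0 theta_balanced. Qed.

Lemma theta_boundary (u : tor_complex gA N M0 4) : theta (tor_diff u) = 0.
Proof.
elim/tensor_ind: u => [x f||u v hu hv].
- rewrite (_ : tor_diff _ = tens x (res_diff f)); last exact: tlift_tens (res_diff_bal _ _ _ _) _ _.
  by rewrite thetaE svalz_eval svalz0 scaler0 lift20.
- by rewrite (raddf0 (@tor_diff _ gA N M0 3)) theta0.
- have e := congr1 theta (tor_diffB u v).
  by apply: (etrans e); rewrite thetaB; rewrite hu hv subrr.
Qed.

Lemma theta_comp (z : tor_complex gA N M0 3) : m <> n.+1 ->
  tor_complex_comp (@degree0 S : nat -> set N) n.+1 z -> theta z = 0.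
Proof.
move=> mn; apply: (zspan_eq0 thetaB) => _ [j [k [x [f [jk hx hf ->]]]]].
rewrite thetaE; case: hx => [j0|->]; last by rewrite tscal0 proj0 scale0r lift20.
rewrite -jk j0 add0n in mn; move: f hf.
apply: free_comp_ind => [b _ bk [t ht <-]||f g hf hg].
- have [y [_ _ ly]] := lift2_homog3 b.
  rewrite free_eval_inj svalzZ scalerA -projM.
  rewrite (ly (k - hdeg b)%N); last first.
    by rewrite -[(k - _)%N]add0n; apply: tpureM => //; exact: tpure_scal.
  by rewrite subnK //; case: eqP => // /esym.
- by rewrite free_eval0 svalz0 scaler0 lift20.
- by rewrite free_evalD svalzD scalerDr lift2D hf hg addr0.
Qed.

Lemma tens1B : {morph (fun f : Defs.free M2 => tens (1 : N) f) : f g / f - g}.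
Proof.
move=> f g /=; apply/eqP; rewrite eq_sym subr_eq.
by rewrite -(balDr (tens_balanced N (Defs.free M2))) subrK.
Qed.

Lemma tens_aug0 b t : taug t = 0 -> tens (1 : N) (dinj b (pi t) : Defs.free M2) = 0.
Proof.
move=> t0; have [tDl _ tZ] := tens_balanced N (Defs.free M2).
have -> : dinj b (pi t) = pi t *: (dinj b 1 : Defs.free M2).
  by rewrite free_scale_dinj mulr1.
rewrite -tZ (_ : (pi t : A^c) *: (1 : N) = 0).
  by apply: (addIr (tens (0 : N) (dinj b 1 : Defs.free M2))); rewrite -tDl !add0r.
by rewrite -[LHS]/(1 * eps (pi t)) aug_proj t0 mulr0.
Qed.

(** Each term t r is lifted to t times the basis element of r. As m > n, the coefficient t has
    positive degree and dies in S (x)_A F_2. *)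
Lemma lrel_ex x : (n < m)%N -> lrel m x -> exists h : Defs.free M2,
  [/\ free_comp gA m h, svalz (free_eval h) = f1 x.1,
      tens (1 : N) h = 0 & lift2 h = qred x].
Proof.
move=> nm; elim=> {x} [_ [i [t [r [ein ht ->]]]]||x y _ [f [f1' f2 f3 f4]] _ [g [g1 g2 g3 g4]]].
- have [hd hv] := bRP r; exists (dinj (bR r) (pi t)); split.
  + by apply: (free_comp_dinj Acomp0 (j := i)); [exists t|rewrite hd].
  + by rewrite free_eval_inj svalzZ hv -f1_mul ?rel_taug.
  + by apply: tens_aug0; rewrite (taug_pure ht) //; lia.
  + rewrite lift2_dinj hd pq_rel ltnW // thom_pure //.
    by rewrite -ein addnK.
- exists 0; split; [exact: (free_comp0 Acomp0)| | |by rewrite !raddf0].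
    by rewrite free_eval0 svalz0 raddf0.
  by have := tens1B 0 0; rewrite !subrr.
- exists (f - g); split; first exact: (free_compB AcompB f1' g1).
  + by rewrite free_evalB svalzB f2 g2 -f1B.
  + by rewrite tens1B f3 g3 subrr.
  + by rewrite lift2B f4 g4 -qredB.
Qed.

Lemma tor_reducible x : (n < m)%N ->
    (forall t : TorSS n_gt0 P 3, t = 0) \/
      (m <> n.+1 /\ pure (TorSS_comp n_gt0 P 3) n.+1) ->
  lrel m x -> IV x.1 -> red m x.
Proof.
move=> nm htor hx xV; have [h [h1 h2 h3 h4]] := lrel_ex nm hx.
(* Since x.1 lies in <R>V, it is killed by [f1]; so h is a relation and indexes a basis element b of
   F_3. *)
have [|b [hb1 hb2]] := @homog_syz_ex _ gA M2 m h _ h1.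
  by apply: svalz_inj; rewrite h2 f1_idealV // raddf0.
set z : tor_complex gA N M0 3 := tens (1 : N) (dinj b 1 : Defs.free M3).
have thz : theta z = qred x.
  by rewrite thetaE rmorph1 scale1r free_eval_inj scale1r hb2 h4.
(* The differential of z is 1 (x) h, which is 0 by the choice of h. *)
have zc : z \in @Defs.cycle _ gA N M0 3.
  have e : tor_diff z = tens (1 : N) (svalz (free_eval (dinj b 1 : Defs.free M3))).
    exact: (tlift_tens (@res_diff_bal _ gA N M0 2)).
  by apply/eqP; apply: (etrans e); rewrite free_eval_inj scale1r hb2.
apply/qred0P; rewrite -thz.
(* As [theta] kills boundaries, a cycle homologous to z in its kernel is enough: 0 if Tor_3
   vanishes, otherwise a representative of degree n + 1, which differs from m. *)
suff [w [wc w0 wcls]] : exists w, [/\ w \in @Defs.cycle _ gA N M0 3, theta w = 0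
    & subcls (@Defs.cycle _ gA N M0 3) (@boundary _ gA N M0 3) z = subcls _ _ w].
  have /asboolP[u eu] : z - w \in @boundary _ gA N M0 3.
    exact: (iffLR (subclsP _ zc wc) wcls).
  by have := theta_boundary u; rewrite -eu thetaB w0 subr0.
case: htor => [t0|[mn]].
  by exists 0; split; [exact: rpred0|exact: theta0|exact: (etrans (t0 _) (esym (t0 _)))].
move=> hpure.
have [w [wc wcomp] ew] :=
  hpure (subcls (@Defs.cycle _ gA N M0 3) (@boundary _ gA N M0 3) z).
by exists w; split; [exact: wc|exact: theta_comp|exact: ew].
Qed.

End Degree.

End TorSyzygies.

Lemma tor_syzygies_reducible (S : pzRingType) (V : bimodType S) (n : nat)
    (n_gt0 : (0 < n)%N) (n_gt1 : (1 < n)%N) (P : subbimod (tens_alg V))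
    (R := top n P) (alpha : {linear bimod_of R -> tens_alg V}) :
  projective V ->
  (forall r s, alpha (ract r s) = ract (alpha r) s) ->
  (forall r, tdeg_lt n (alpha r - \val r)) ->
  (forall t : TorSS n_gt0 P 3, t = 0) \/
    pure (TorSS_comp n_gt0 P 3) n.+1 /\
    (forall x, lrelpairs n alpha n.+1 x -> idealV R x.1 -> reducible n alpha n.+1 x) ->
  forall m x, lrelpairs n alpha m x -> idealV R x.1 -> reducible n alpha m x.
Proof.
move=> /projective_section[psi psiK] alpha_ract alpha_lt htor.
have [y1 y1P] := choice (homog1_ex (n_gt0 := n_gt0) (P := P)).
have [e1 e1P] := unit_ex n_gt0 P.
have [bV bVP] := choice (homog_var_ex e1P).
have [pq pqP] := choice (homog2_ex y1P alpha_ract).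
have [bR bRP] := choice (homog_rel_ex bVP n_gt1 psiK).
(* Strong induction, because [theta] in degree m is well defined only once the syzygies of lower
   degree are reducible. *)
elim/ltn_ind => m IH x hx xV; have [mn|nm] := leqP m n.
  by rewrite (lrelpairs_le (@top_pure _ _ _ P) mn hx xV); exact: zspan0.
have red_m := tor_reducible y1P e1P bVP n_gt1 psiK alpha_lt pqP bRP (fun k x km => IH k km x).
have [mn1|mn1] := eqVneq m n.+1.
  case: htor => [t0|[_ h]]; last by subst m; exact: h.
  by apply: red_m => //; left.
by apply: red_m => //; case: htor => [t0|[hp _]]; [left|right; split=> //; exact/eqP].
Qed.

(** * Leading terms *)

Section LeadingTerms.
Variables (S : pzRingType) (V : bimodType S) (n : nat).
Local Notation T := (tens_alg V).
Variable P : subbimod T.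
Hypothesis P_le : forall x, P x -> tdeg_le n x.
Local Notation R := (top n P).

Lemma proj_filt (X : set T) m x : tdeg_lt m x -> qproj X x \in filt_lt X m.
Proof. by move=> hx; apply/filt_ltP; exists x. Qed.

Lemma proj_filt_pure (X : set T) m x : tpure m x -> qproj X x \in filt_lt X m.+1.
Proof. by move=> hx; apply: proj_filt; exact: tpure_deg hx (ltnSn m). Qed.

Lemma thom_sub_lt m (x : T) : tdeg_lt m.+1 x -> tdeg_lt m (thom m x - x).
Proof.
move=> /tdeg_ltP hx; apply/tdeg_ltP => k mk; rewrite raddfB /=.
have [->|km] := eqVneq k m; first by rewrite (thom_pure (tpure_thom m x)) subrr.
rewrite (thom_pure_neq (tpure_thom m x)) ?hx ?subrr //; first by lia.
by move=> e; case/eqP: km.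
Qed.

Lemma grcls_thom (X : set T) m x : tdeg_lt m.+1 x ->
  grcls X m (qproj X (thom m x)) = grcls X m (qproj X x).
Proof.
move=> hx; apply: grcls_eq.
- exact: proj_filt_pure (tpure_thom m x).
- exact: proj_filt.
- by rewrite -raddfB; apply: proj_filt; exact: thom_sub_lt.
Qed.

(** The leading part of an element of <P> has the same class in gr^m as the element itself, namely
    0, and the isomorphism from A(R) is injective. *)
Lemma PBW_leading : PBW_deformation P R -> forall m x,
  ideal_gen P x -> tdeg_le m x -> ideal_gen R (thom m x).
Proof.
move=> [_ [phi [hphi phi_bij]]] m x hx xm.
rewrite -[thom m x]subr0; apply/qprojP; apply: (bij_inj phi_bij).
rewrite (hphi m _ (tpure_thom m x)).
rewrite raddf0 raddf0 grcls_thom // -(grcls0 P m); congr grcls.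
by rewrite -(raddf0 (qproj P)); apply/qprojP; rewrite subr0.
Qed.

Definition to_gr : T -> gr P :=
  dlift (fun m (t : tpow V m) => grcls P m (qproj P (tinj t))).

Let to_gr_aux m :
  {morph (fun t : tpow V m => grcls P m (qproj P (tinj t))) : t u / t - u}.
Proof.
move=> t u /=; rewrite (raddfB (@tinj S V m)) raddfB.
by apply: grclsB; exact: proj_filt_pure (tpure_tinj _).
Qed.

Lemma to_grB : {morph to_gr : x y / x - y}. Proof. exact: dliftB to_gr_aux. Qed.
HB.instance Definition _ := GRing.isZmodMorphism.Build T (gr P) to_gr to_grB.
Lemma to_grD : {morph to_gr : x y / x + y}. Proof. exact: dliftD to_gr_aux. Qed.
Lemma to_gr0 : to_gr 0 = 0. Proof. exact: dlift0 to_gr_aux. Qed.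

Lemma to_gr_pure m x : tpure m x -> to_gr x = grcls P m (qproj P x).
Proof. by move=> /tpureP[t ->]; exact: (dlift_inj to_gr_aux). Qed.

Lemma to_grM : monoid_morphism to_gr.
Proof.
split=> [|x y]; first by rewrite (to_gr_pure (tpure_scal V 1)).
elim/tens_pure_ind: x => [i x hx||x x' hx hx'].
- elim/tens_pure_ind: y => [j y hy||y y' hy hy'].
  + rewrite (to_gr_pure hx) (to_gr_pure hy) (to_gr_pure (tpureM hx hy)) rmorphM.
    by rewrite grclsM //; exact: proj_filt_pure.
  + by rewrite mulr0 to_gr0 mulr0.
  + by rewrite mulrDr !to_grD mulrDr hy hy'.
- by rewrite mul0r to_gr0 mul0r.
- by rewrite mulrDl !to_grD mulrDl hx hx'.
Qed.
HB.instance Definition _ := GRing.isMonoidMorphism.Build T (gr P) to_gr to_grM.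

Lemma to_gr_top x : R x -> to_gr x = 0.
Proof.
move=> [y hy <-]; rewrite (to_gr_pure (tpure_thom n y)) grcls_thom; last exact: P_le.
rewrite -(grcls0 P n); congr grcls.
by rewrite -(raddf0 (qproj P)); apply/qprojP; rewrite subr0; exact: ideal_in.
Qed.

Lemma subcls0 (M : zmodType) (H K : zmodClosed M) : subcls H K 0 = 0.
Proof. by rewrite -(subrr 0) subclsB ?rpred0 // subrr. Qed.

Lemma subclsD (M : zmodType) (H K : zmodClosed M) x y : x \in H -> y \in H ->
  subcls H K (x + y) = subcls H K x + subcls H K y.
Proof.
move=> hx hy; apply: (addIr (- subcls H K y)).
by rewrite -subclsB ?rpredD // !addrK.
Qed.

Lemma to_gr_coef x m :
  dcoef (to_gr x) m = subcls (filt_lt P m.+1) (filt_lt P m) (qproj P (thom m x)).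
Proof.
elim/tens_pure_ind: x => [k x hx||x y hx hy].
- rewrite (to_gr_pure hx); have [<-|km] := pselect (k = m).
    by rewrite (thom_pure hx) /grcls dinjE.
  by rewrite (thom_pure_neq hx km) raddf0 subcls0 /grcls dinjNE.
- by rewrite to_gr0 !raddf0 subcls0.
- rewrite to_grD dcoefD hx hy thomD (raddfD (qproj P)) subclsD //.
  + exact: proj_filt_pure (tpure_thom _ _).
  + exact: proj_filt_pure (tpure_thom _ _).
Qed.

Lemma ideal_of_thom x : (forall m, ideal_gen R (thom m x)) -> ideal_gen R x.
Proof.
move=> h; rewrite [x](@dsum_sum _ (fun m => tpow V m : zmodType)) /dlift.
apply: (big_ind (ideal_gen R)) => [|y z hy hz|m _]; [exact: Defs.ideal0| |exact: h].
by rewrite -[z]opprK -[- z]sub0r; do 2!apply: Defs.idealB => //; exact: Defs.ideal0.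
Qed.

Lemma leading_PBW :
  (forall m x, ideal_gen P x -> tdeg_le m x -> ideal_gen R (thom m x)) ->
  PBW_deformation P R.
Proof.
move=> lead; split.
  move=> _ [y hy <-] m; have [->|mn] := pselect (m = n).
    by exists y; [split=> //; exact: P_le|exact: thom_pure (tpure_thom n y)].
  exists 0; first by split; [exact: subbimod0|].
  by rewrite raddf0 (thom_pure_neq (tpure_thom n y)) // => /esym.
exists (qlift to_gr_top); split=> [m x hx|].
  exact: (etrans (qlift_proj to_gr_top x) (to_gr_pure hx)).
(* If x maps to 0, each component of x agrees modulo <P> with some t of lower degree. The difference
   is an element of <P> with that component as its leading part. *)
have inj : injective (qlift to_gr_top).
  apply: raddf_inj => a; rewrite -[a]qprojK; set x := repr a => h.
  have x0 : to_gr x = 0 := etrans (esym (qlift_proj to_gr_top x)) h.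
  rewrite -(raddf0 (qproj R)); apply/qprojP; rewrite subr0; apply: ideal_of_thom => m.
  have := to_gr_coef x m; rewrite x0 => /esym e.
  have : qproj P (thom m x) - 0 \in filt_lt P m.
    apply/(@subclsP _ (filt_lt P m.+1)); rewrite ?rpred0 //.
      exact: proj_filt_pure (tpure_thom _ _).
    by rewrite e subcls0.
  rewrite subr0 => /filt_ltP[t ht /esym/qprojP et].
  have -> : thom m x = thom m (thom m x - t).
    rewrite raddfB /= (thom_pure (tpure_thom m x)).
    by have /tdeg_ltP -> // := ht; rewrite subr0.
  apply: lead => //; apply: tdeg_ltB; first exact: tpure_deg (tpure_thom m x) (ltnSn m).
  by move=> k mk; apply: ht; exact: ltnW.
have surj y : exists a, qlift to_gr_top a = y.
  elim/gr_ind: y => [m u /filt_ltP[t ht <-]||y z [a ha] [b hb]].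
  - exists (qproj R (thom m t)); apply: etrans (qlift_proj to_gr_top _) _.
    exact: etrans (to_gr_pure (tpure_thom m t)) (grcls_thom _ ht).
  - by exists 0; rewrite raddf0.
  - by exists (a + b); rewrite -ha -hb; exact: raddfD.
have [g gK] := choice surj.
by exists g => // a; apply: inj; rewrite gK.
Qed.

Variable alpha : {linear bimod_of R -> T}.
Hypothesis alpha_ract : forall r s, alpha (ract r s) = ract (alpha r) s.
Hypothesis alpha_lt : forall r, tdeg_lt n (alpha r - \val r).
Hypothesis alpha_im : forall x, P x -> exists r, x = alpha r.

Local Notation deformed := (deformed_lt n alpha).
Local Notation relp := (relpairs n alpha).

Lemma alpha_thom r k : (n <= k)%N -> thom k (alpha r) = thom k (\val r).
Proof.
move=> nk; have /tdeg_ltP/(_ k nk)/eqP := alpha_lt r.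
by rewrite raddfB subr_eq0 => /eqP.
Qed.

Lemma alpha_le r : tdeg_le n (alpha r).
Proof.
apply/tdeg_ltP => k nk; rewrite alpha_thom; last exact: ltnW.
by apply: (thom_pure_neq (top_pure (bimod_ofP r))); lia.
Qed.

Lemma sandwich_deg i k t (b t' : T) j : tpure i t -> tpure k t' -> tdeg_lt j b ->
  tdeg_lt (i + j + k) (t * b * t').
Proof.
move=> ht ht'; move: b; apply: tdeg_lt_ind => [m b mj hb||b c hb hc].
- by apply: tpure_deg (tpureM (tpureM ht hb) ht') _; lia.
- by rewrite mulr0 mul0r.
- rewrite mulrDr mulrDl; apply/tdeg_ltP => l hl; rewrite raddfD /=.
  by move/tdeg_ltP: hb => -> //; move/tdeg_ltP: hc => -> //; rewrite addr0.
Qed.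

Lemma deformed_deg m x : deformed m x -> tdeg_lt m x.
Proof.
elim=> {x} [_ [i [k [t [r [t' [h ht ht' ->]]]]]]||x y _ hx _ hy] //; last exact: tdeg_ltB.
have := sandwich_deg ht ht' (alpha_le r); move=> hd l ml; apply: hd; lia.
Qed.

Lemma relpairs_thom m x : relp m x -> thom m x.2 = x.1.
Proof.
elim=> {x} [_ [i [k [t [r [t' [<- ht ht' ->]]]]]]||x y _ hx _ hy].
- rewrite /= (_ : t * (alpha r * t') = t * \val r * t' + t * (alpha r - \val r) * t').
    rewrite raddfD /= (thom_pure (tpureM (tpureM ht (top_pure (bimod_ofP r))) ht')).
    have /tdeg_ltP -> // := sandwich_deg ht ht' (alpha_lt r).
    by rewrite addr0 mulrA.
  by rewrite -!mulrA -mulrDr -mulrDl addrC subrK.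
- by rewrite raddf0.
- by rewrite raddfB /= hx hy.
Qed.

Lemma deformed_split m x : deformed m.+1 x ->
  exists y z, [/\ relp m y, deformed m z & x = y.2 + z].
Proof.
elim=> {x} [x||x x' _ [y [z [hy hz ->]]] _ [y' [z' [hy' hz' ->]]]].
- move=> [i [k [t [r [t' [h ht ht' ->]]]]]]; have [e|ne] := pselect ((i + n + k)%N = m).
    exists (lmul t (rmul t' (rpair alpha r))), 0.
    split; [|exact: zspan0|by rewrite addr0 /= mulrA].
    by apply: zspan_in; exists i, k, t, r, t'.
  exists 0, (t * alpha r * t'); split; [exact: zspan0| |by rewrite add0r].
  by apply: zspan_in; exists i, k, t, r, t'; split=> //; lia.
- by exists 0, 0; split; [exact: zspan0|exact: zspan0|rewrite addr0].
- exists (y - y'), (z - z'); split; [exact: zspanB|exact: zspanB|].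
  by rewrite opprD addrACA.
Qed.

Lemma ideal_deformed x : ideal_gen P x -> exists m, deformed m x.
Proof.
move/ideal_gen_span; elim=> {x} [x||x y _ [i hx] _ [j hy]].
- move=> [i [k [t [y [t' [ht ht' /alpha_im[r ->] ->]]]]]].
  by exists (i + n + k).+1; apply: zspan_in; exists i, k, t, r, t'.
- by exists 0%N; exact: zspan0.
- exists (i + j)%N; apply: zspanB.
    exact: deformed_le (leq_addr j i) hx.
  exact: deformed_le (leq_addl i j) hy.
Qed.

Hypothesis rel_def : forall m x, relp m x -> x.1 = 0 -> deformed m x.2.

(** Take an expression of x by deformed terms. While formal degrees above m occur, the leading parts
    of the top terms cancel, as x has degree at most m, and [rel_def] lowers them. Once they are at
    most m, the degree m part is a sum of terms t r t'. *)
Lemma deformed_leading m x : ideal_gen P x -> tdeg_le m x -> ideal_gen R (thom m x).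
Proof.
move=> /ideal_deformed[N hN] hm.
have h k : deformed (m.+1 + k) x -> deformed m.+1 x.
  elim: k => [|k IH]; first by rewrite addn0.
  rewrite addnS => /deformed_split[y [z [hy hz e]]]; apply: IH.
  rewrite e; apply: zspanD => //; apply: rel_def => //.
  rewrite -(relpairs_thom hy) (_ : y.2 = x - z); last by rewrite e addrK.
  rewrite raddfB /=; have /tdeg_ltP -> := deformed_deg hz; last exact: leqnn.
  by have /tdeg_ltP -> := hm; rewrite ?subr0 // leq_addr.
have [y [z [hy hz e]]] := deformed_split (h N (deformed_le (leq_addl _ _) hN)).
rewrite e raddfD /= (relpairs_thom hy).
have /tdeg_ltP -> := deformed_deg hz; last exact: leqnn.
by rewrite addr0; exact: relpairs_fst hy.
Qed.

End LeadingTerms.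

(** * The Jacobi conditions *)

Section TensorMaps.
Variables (S : pzRingType) (V W : bimodType S).
Local Notation T := (tens_alg V).

Section Lift.
Variable f : W -> T.
Hypothesis fD : {morph f : x y / x + y}.
Hypothesis fZ : forall s x, f (s *: x) = s *: f x.
Hypothesis fR : forall x s, f (ract x s) = ract (f x) s.

Lemma Vtens_balanced : balanced (fun (v : rmod V) x => tvar (v : V) * f x).
Proof.
split=> [v v' x|v x x'|v s x]; first by rewrite tvarD mulrDl.
  by rewrite fD mulrDr.
by rewrite fZ tens_alg_scaleE mulrA -[tinj _]/(tscal V s) tvar_scal.
Qed.

Lemma tensV_balanced : balanced (fun (x : rmod W) v => f (x : W) * tvar v).
Proof.
split=> [x x' v|x v v'|x s v]; first by rewrite -mulrDl -fD.
  by rewrite tvarD mulrDr.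
by rewrite tvarZ tens_alg_scaleE mulrA -tens_alg_ractE -fR.
Qed.

Lemma Vtens_btens v x : Vtens f (btens v x) = tvar v * f x.
Proof. exact: (tlift_tens Vtens_balanced). Qed.

Lemma tensV_btens x v : tensV f (btens x v) = f x * tvar v.
Proof. exact: (tlift_tens tensV_balanced). Qed.

Lemma VtensB : {morph Vtens f : t u / t - u}. Proof. exact: (tliftB Vtens_balanced). Qed.
Lemma tensVB : {morph tensV f : t u / t - u}. Proof. exact: (tliftB tensV_balanced). Qed.
Lemma Vtens0 : Vtens f 0 = 0. Proof. exact: (tlift0 Vtens_balanced). Qed.
Lemma tensV0 : tensV f 0 = 0. Proof. exact: (tlift0 tensV_balanced). Qed.

Lemma Vtens_eq0 u : (forall x, f x = 0) -> Vtens f u = 0.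
Proof.
move=> f0; elim/btensor_ind: u => [v x||t u ht hu].
- by rewrite Vtens_btens f0 mulr0.
- exact: Vtens0.
- by rewrite VtensB ht hu subrr.
Qed.

Lemma tensV_eq0 u : (forall x, f x = 0) -> tensV f u = 0.
Proof.
move=> f0; elim/btensor_ind: u => [x v||t u ht hu].
- by rewrite tensV_btens f0 mul0r.
- exact: tensV0.
- by rewrite tensVB ht hu subrr.
Qed.

End Lift.

Variable f : W -> T.
Hypothesis fD : {morph f : x y / x + y}.
Hypothesis fZ : forall s x, f (s *: x) = s *: f x.
Hypothesis fR : forall x s, f (ract x s) = ract (f x) s.

Let thomfD k : {morph (fun x => thom k (f x)) : x y / x + y}.
Proof. by move=> x y /=; rewrite fD thomD. Qed.

Let thomfZ k s x : thom k (f (s *: x)) = s *: thom k (f x).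
Proof. by rewrite fZ thomZ. Qed.

Let thomfR k x s : thom k (f (ract x s)) = ract (thom k (f x)) s.
Proof. by rewrite fR thom_ract. Qed.

Lemma thomS_Vtens k u : thom k.+1 (Vtens f u) = Vtens (fun x => thom k (f x)) u.
Proof.
elim/btensor_ind: u => [v x||t u ht hu].
- rewrite (Vtens_btens fD fZ) (Vtens_btens (thomfD k) (thomfZ k)).
  exact: (thomM k (f x) (tpure_var v)).
- by rewrite (Vtens0 fD fZ) (Vtens0 (thomfD k) (thomfZ k)) raddf0.
- by rewrite (VtensB fD fZ) (VtensB (thomfD k) (thomfZ k)) thomB ht hu.
Qed.

Lemma thomS_tensV k u : thom k.+1 (tensV f u) = tensV (fun x => thom k (f x)) u.
Proof.
elim/btensor_ind: u => [x v||t u ht hu].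
- by rewrite (tensV_btens fD fR) (tensV_btens (thomfD k) (thomfR k)) thomM_var.
- by rewrite (tensV0 fD fR) (tensV0 (thomfD k) (thomfR k)) raddf0.
- by rewrite (tensVB fD fR) (tensVB (thomfD k) (thomfR k)) thomB ht hu.
Qed.

Lemma thom0_Vtens u : thom 0 (Vtens f u) = 0.
Proof.
elim/btensor_ind: u => [v x||t u ht hu].
- rewrite (Vtens_btens fD fZ) -[LHS]/(tscal V (taug (tvar v * f x))).
  have [_ ->] := taugM V.
  by rewrite (taug_pure (tpure_var v) isT) mul0r tscal0.
- by rewrite (Vtens0 fD fZ) raddf0.
- by rewrite (VtensB fD fZ) thomB ht hu subrr.
Qed.

Lemma thom0_tensV u : thom 0 (tensV f u) = 0.
Proof.
elim/btensor_ind: u => [x v||t u ht hu].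
- by rewrite (tensV_btens fD fR) thom0M_var.
- by rewrite (tensV0 fD fR) raddf0.
- by rewrite (tensVB fD fR) thomB ht hu subrr.
Qed.

Lemma Vtens_ideal (X : set T) u :
  (forall x, ideal_gen X (f x)) -> ideal_gen X (Vtens f u).
Proof.
move=> h; elim/btensor_ind: u => [v x||t u ht hu].
- by rewrite (Vtens_btens fD fZ); exact: Defs.idealMl.
- by rewrite (Vtens0 fD fZ); exact: Defs.ideal0.
- by rewrite (VtensB fD fZ); exact: Defs.idealB.
Qed.

Lemma tensV_ideal (X : set T) u :
  (forall x, ideal_gen X (f x)) -> ideal_gen X (tensV f u).
Proof.
move=> h; elim/btensor_ind: u => [x v||t u ht hu].
- by rewrite (tensV_btens fD fR); exact: Defs.idealMr.
- by rewrite (tensV0 fD fR); exact: Defs.ideal0.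
- by rewrite (tensVB fD fR); exact: Defs.idealB.
Qed.

End TensorMaps.

Section Jacobi.
Variables (S : pzRingType) (V : bimodType S) (n : nat).
Local Notation T := (tens_alg V).
Variable P : subbimod T.
Local Notation R := (top n P).
Variable alpha : {linear bimod_of R -> T}.
Hypothesis alpha_filt : filtered_morphism n alpha.

Lemma filtered_lt r : tdeg_lt n (alpha r - \val r).
Proof.
have [_ hd h0] := alpha_filt; apply/tdeg_ltP => k; rewrite leq_eqVlt raddfB /=.
case/orP => [/eqP <-|nk]; first by rewrite h0 (thom_pure (top_pure (bimod_ofP r))) subrr.
have /tdeg_ltP -> // := hd r; rewrite (thom_pure_neq (top_pure (bimod_ofP r))) ?subrr //.
by lia.
Qed.

Let aD : {morph alpha : x y / x + y}. Proof. exact: raddfD. Qed.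
Let aZ s x : alpha (s *: x) = s *: alpha x. Proof. exact: linearZ. Qed.
Let aR x s : alpha (ract x s) = ract (alpha x) s.
Proof. by have [h _ _] := alpha_filt; exact: h. Qed.

Variables (u : btensor V (bimod_of R)) (w : btensor (bimod_of R) V).

(** The inhomogeneous difference (V (x) alpha - alpha (x) V)(x). Its components are the differences
    [Jdiff], so all Jacobi conditions merge into one equation in T. *)
Definition overlap : T := Vtens alpha u - tensV alpha w.

Lemma thomS_overlap k : thom k.+1 overlap =
  Vtens (fun r => thom k (alpha r)) u - tensV (fun r => thom k (alpha r)) w.
Proof. by rewrite /overlap thomB (thomS_Vtens aD aZ) (thomS_tensV aD aR). Qed.

Lemma thom0_overlap : thom 0 overlap = 0.
Proof. by rewrite /overlap thomB (thom0_Vtens aD aZ) (thom0_tensV aD aR) subrr. Qed.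

Lemma Jdiff_overlap i : Jdiff n alpha i u w = thom (n - i).+1 overlap.
Proof. by rewrite thomS_overlap. Qed.

Hypothesis uw : Vtens (fun r : bimod_of R => \val r) u =
                tensV (fun r : bimod_of R => \val r) w.

(** The component of degree n + 1 involves alpha_0, the inclusion, and is 0 because u and w have the
    same image there. Higher components of [alpha] vanish. *)
Lemma overlap_deg : tdeg_le n overlap.
Proof.
have [_ hd h0] := alpha_filt.
apply/tdeg_ltP => -[//|k]; rewrite ltnS leq_eqVlt thomS_overlap => /orP[/eqP <-|nk].
  have -> : (fun r => thom n (alpha r)) = (fun r : bimod_of R => \val r) by exact/funext.
  by rewrite uw subrr.
have a0 r : thom k (alpha r) = 0 by have /tdeg_ltP -> := hd r.
have tD : {morph (fun r => thom k (alpha r)) : x y / x + y}.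
  by move=> x y /=; rewrite aD thomD.
have tZ s x : thom k (alpha (s *: x)) = s *: thom k (alpha x) by rewrite aZ thomZ.
have tR x s : thom k (alpha (ract x s)) = ract (thom k (alpha x)) s.
  by rewrite aR thom_ract.
by rewrite (Vtens_eq0 tD tZ _ a0) (tensV_eq0 tD tR _ a0) subrr.
Qed.

Hypothesis n_gt0 : (0 < n)%N.

(** The conditions are the equation read in degree n, in the degrees n - i, and in degree 0, where
    [overlap] has no component. Above degree n both sides vanish. *)
Lemma JacobiP r :
  [/\ \val r = Jdiff n alpha 1 u w,
      forall i, (0 < i < n)%N -> component n alpha i r = Jdiff n alpha i.+1 u w
    & component n alpha n r = 0] <-> alpha r = overlap.
Proof.
have [_ hd h0] := alpha_filt.
split=> [[j1 ji jn]|e]; last first.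
  split=> [|i /andP[i0 iltn]|].
  - by rewrite Jdiff_overlap -e subn1 prednK.
  - by rewrite Jdiff_overlap -e /component subnSK.
  - by rewrite /component e subnn thom0_overlap.
apply: tensP => -[|k].
  by rewrite thom0_overlap -jn /component subnn.
have [nk|kn] := ltnP n k.+1.
  by have /tdeg_ltP -> // := hd r; have /tdeg_ltP -> // := overlap_deg.
have [kn1|kn1] := eqVneq k.+1 n.
  by rewrite kn1 h0 j1 Jdiff_overlap subn1 prednK.
have := ji (n - k.+1)%N; rewrite Jdiff_overlap /component => e.
have nk : (n - (n - k.+1) = k.+1)%N by lia.
have nk' : ((n - (n - k.+1).+1).+1 = k.+1)%N by lia.
by rewrite nk nk' in e; apply: e; lia.
Qed.

End Jacobi.

Section JacobiSyzygies.
Variables (S : pzRingType) (V : bimodType S) (n : nat).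
Local Notation T := (tens_alg V).
Variable P : subbimod T.
Local Notation R := (top n P).
Variable alpha : {linear bimod_of R -> T}.
Hypothesis alpha_filt : filtered_morphism n alpha.

Let aD : {morph alpha : x y / x + y}. Proof. exact: raddfD. Qed.
Let aZ s x : alpha (s *: x) = s *: alpha x. Proof. exact: linearZ. Qed.
Let aR x s : alpha (ract x s) = ract (alpha x) s.
Proof. by have [h _ _] := alpha_filt; exact: h. Qed.
Let vD : {morph (fun r : bimod_of R => \val r) : x y / x + y}. Proof. by []. Qed.
Let vZ s (x : bimod_of R) : \val (s *: x) = s *: \val x. Proof. by []. Qed.
Let vR (x : bimod_of R) s : \val (ract x s) = ract (\val x) s. Proof. by []. Qed.

Lemma lrelpairs_Vtens x : lrelpairs n alpha n.+1 x ->
  exists u, x = (Vtens (fun r : bimod_of R => \val r) u, Vtens alpha u).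
Proof.
elim=> {x} [_ [i [t [r [ein ht ->]]]]||x y _ [u ->] _ [u' ->]].
- have i1 : i = 1%N by lia.
  subst i; have : exists v, t = tvar v.
    elim: (tpureS_span ht) => {ht} [_ [y [v [hy ->]]]||t1 t2 _ [v ->] _ [v' ->]].
    + by exists (taug y *: v); rewrite {1}(tpure_eq_scal hy) scal_tvar.
    + by exists 0; rewrite tvar0.
    + by exists (v - v'); rewrite tvarB.
  move=> [v ->]; exists (btens v r).
  by rewrite (Vtens_btens vD vZ) (Vtens_btens aD aZ).
- by exists 0; rewrite (Vtens0 vD vZ) (Vtens0 aD aZ).
- by exists (u - u'); rewrite (VtensB vD vZ) (VtensB aD aZ).
Qed.

Lemma tensV_relpairsV w :
  relpairsV n alpha n.+1 (tensV (fun r : bimod_of R => \val r) w, tensV alpha w).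
Proof.
elim/btensor_ind: w => [r v||t u ht hu].
- rewrite (tensV_btens vD vR) (tensV_btens aD aR).
  apply: zspan_in; exists n, (rpair alpha r), v; split=> //.
  apply: zspan_in; exists 0%N, 0%N, (tscal V 1), r, (tscal V 1).
  split; rewrite ?addn0 //; try exact: tpure_scal.
  by rewrite /lmul /rmul rmorph1 /= !mulr1 !mul1r.
- by rewrite (tensV0 vD vR) (tensV0 aD aR); exact: zspan0.
- by rewrite (tensVB vD vR) (tensVB aD aR); exact: (zspanB ht hu).
Qed.

Lemma idealV_tensV x : idealV R x ->
  exists w, thom n.+1 x = tensV (fun r : bimod_of R => \val r) w.
Proof.
elim=> {x} [_ [y [v [hy ->]]]||x y _ [w hw] _ [w' hw']].
- have yR : thom n y \in subbimod_pred R.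
    by apply/asboolP; exact: (ideal_thom_n (@top_pure _ _ n P)).
  exists (btens (exist _ (thom n y) yR : bimod_of R) v).
  by rewrite (tensV_btens vD vR) thomM_var.
- by exists 0; rewrite raddf0 (tensV0 vD vR).
- by exists (w - w'); rewrite thomB hw hw' (tensVB vD vR).
Qed.

(** A syzygy of degree n + 1 comes from an element (u, w) of X. Passing from V (x) R to R (x) V
    splits off a last letter; the error is [overlap], by assumption a single deformed relation of
    formal degree n. *)
Lemma Jacobi_reducible :
  (forall u w, Vtens (fun r : bimod_of R => \val r) u =
               tensV (fun r : bimod_of R => \val r) w ->
     exists r, alpha r = overlap alpha u w) ->
  forall x, lrelpairs n alpha n.+1 x -> idealV R x.1 -> reducible n alpha n.+1 x.
Proof.
move=> J _ /lrelpairs_Vtens[u ->] /= uV.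
have [w hw] := idealV_tensV uV.
have uw : Vtens (fun r : bimod_of R => \val r) u =
    tensV (fun r : bimod_of R => \val r) w.
  rewrite -hw (thomS_Vtens vD vZ); congr (Vtens _ u); apply/funext => r.
  by rewrite (thom_pure (top_pure (bimod_ofP r))).
have [r er] := J u w uw.
rewrite (_ : (_, _) = (tensV (fun r : bimod_of R => \val r) w, tensV alpha w) +
    (0, alpha r)); last first.
  by rewrite er /overlap uw -[RHS]/(_ + 0, _ + _) addr0 addrC subrK.
apply: zspanD; apply: zspan_in; [left; exact: tensV_relpairsV|right; split=> //].
apply: zspan_in; exists 0%N, 0%N, (tscal V 1), r, (tscal V 1).
split; rewrite ?addn0 //; try exact: tpure_scal.
by rewrite rmorph1 /= mulr1 mul1r.
Qed.

End JacobiSyzygies.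

(** * The inverse of the projection of P onto R *)

Section Construction.
Variables (S : pzRingType) (V : bimodType S) (n : nat).
Local Notation T := (tens_alg V).
Variable P : subbimod T.
Hypothesis P_le : forall x, P x -> tdeg_le n x.
Local Notation R := (top n P).
Hypothesis lead : forall m x, ideal_gen P x -> tdeg_le m x -> ideal_gen R (thom m x).

(** As <R> is 0 in degrees below n, the leading part of x vanishes and its degree drops; the descent
    ends at 0. *)
Lemma ideal_low x : ideal_gen P x -> tdeg_lt n x -> x = 0.
Proof.
move=> hx; elim: {-2}n (leqnn n) => [|m IH] mn hm.
  by apply: tensP => k; rewrite raddf0; have /tdeg_ltP -> := hm.
apply: IH; first exact: ltnW.
apply/tdeg_ltP => k; rewrite leq_eqVlt => /orP[/eqP <-|mk].
  rewrite -(thom_pure (tpure_thom m x)).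
  exact: ideal_thom_lt (@top_pure _ _ n P) _ _ mn (lead hx hm).
by have /tdeg_ltP -> := hm.
Qed.

Lemma ideal_low_eq x y : ideal_gen P x -> ideal_gen P y -> tdeg_le n x -> tdeg_le n y ->
  thom n x = thom n y -> x = y.
Proof.
move=> hx hy xn yn exy; apply/eqP; rewrite -subr_eq0; apply/eqP.
apply: ideal_low; first exact: Defs.idealB.
apply/tdeg_ltP => k; rewrite raddfB leq_eqVlt => /orP[/eqP <-|nk] /=.
  by rewrite exy subrr.
by have /tdeg_ltP -> // := xn; have /tdeg_ltP -> // := yn; rewrite subrr.
Qed.

(** The degree n part of x lies in R, so it is that of some y in P. Then x - y is an element of <P>
    of degree below n, which is 0. *)
Lemma ideal_le_in x : ideal_gen P x -> tdeg_le n x -> P x.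
Proof.
move=> hx xn; have [y hy e] := ideal_thom_n (@top_pure _ _ n P) (lead hx xn).
rewrite (thom_pure (tpure_thom n x)) in e.
by rewrite (ideal_low_eq hx (ideal_in hy) xn (P_le hy)).
Qed.

(** The projection from P to R is injective by [ideal_low_eq], and [alpha] is its inverse.
    Uniqueness of preimages turns a mere choice of them into a bimodule map. *)
Lemma filtered_morphism_ex : exists alpha : {linear bimod_of R -> T},
  filtered_morphism n alpha /\ forall x, P x <-> exists r, x = alpha r.
Proof.
have h (r : bimod_of R) : exists x, P x /\ thom n x = \val r.
  by have [x hx e] := bimod_ofP r; exists x.
have [f hf] := choice h.
have f_eq x r : P x -> thom n x = \val r -> f r = x.
  move=> hx ex; have [hfr er] := hf r.
  by apply: ideal_low_eq; rewrite ?er //; try exact: ideal_in; exact: P_le.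
have f_lin : linear f.
  move=> a r s; have [hr er] := hf r; have [hs es] := hf s.
  apply: f_eq; last by rewrite thomD thomZ er es linearP.
  rewrite -[f s]opprK -[- f s]sub0r; apply: subbimodB; first exact: subbimodZ.
  by apply: subbimodB => //; exact: subbimod0.
pose fL := GRing.isLinear.Build S (bimod_of R) T *:%R f f_lin.
pose alpha : {linear bimod_of R -> T} := HB.pack f fL.
exists alpha; split; first split=> [r s|r|r].
- have [hr er] := hf r; apply: f_eq; first exact: subbimod_ract.
  by rewrite thom_ract er.
- by apply: P_le; case: (hf r).
- by case: (hf r).
- move=> x; split=> [hx|[r ->]]; last by case: (hf r).
  have xR : thom n x \in subbimod_pred R by apply/asboolP; exists x.
  by exists (exist _ (thom n x) xR); apply: esym; exact: f_eq.
Qed.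

End Construction.

(** An r in R with value (V (x) alpha_1 - alpha_1 (x) V)(x) expresses the membership condition and
    also supplies the argument of alpha_i in the other conditions. *)
Theorem theorem5p8 (S : pzRingType) (V : bimodType S) (n : nat) (n_ge2 : (2 <= n)%N)
    (P : subbimod (tens_alg V)) (P_le : forall x, P x -> tdeg_le n x) :
  let R := top n P in
  projective V ->
  projective (bimod_of R) ->
  pure (TorSS_comp (ltnW n_ge2) P 3) n.+1 ->
  PBW_deformation P R <->
  exists alpha : {linear bimod_of R -> tens_alg V},
    [/\ filtered_morphism n alpha,
        forall x, P x <-> exists r, x = alpha r
      & (forall t : TorSS (ltnW n_ge2) P 3, t = 0) \/
        (forall u w, Vtens (fun r : bimod_of R => \val r) u =
                     tensV (fun r : bimod_of R => \val r) w ->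
           exists r : bimod_of R,
             [/\ \val r = Jdiff n alpha 1 u w,
                 forall i, (0 < i < n)%N ->
                   component n alpha i r = Jdiff n alpha i.+1 u w
               & component n alpha n r = 0])].
Proof.
move=> R V_proj _ tor_pure.
split=> [pbw|[alpha [alpha_filt alpha_im jac]]].
  have lead := PBW_leading pbw.
  have [alpha [alpha_filt alpha_im]] := filtered_morphism_ex P_le lead.
  (* For a PBW-deformation the Jacobi conditions hold whether or not Tor_3 vanishes: [overlap] is an
     element of <P> of degree at most n, hence of P. *)
  exists alpha; split=> //; right=> u w uw.
  have [aR aD aZ] : [/\ forall x s, alpha (ract x s) = ract (alpha x) s,
      {morph alpha : x y / x + y} & forall s x, alpha (s *: x) = s *: alpha x].
    by split; [case: alpha_filt|exact: raddfD|move=> s x; exact: linearZ].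
  have aP r : ideal_gen P (alpha r) by apply: ideal_in; apply/alpha_im; exists r.
  have /alpha_im[r e] : P (overlap alpha u w).
    apply: (ideal_le_in P_le lead); last exact: overlap_deg.
    by apply: Defs.idealB; [exact: Vtens_ideal|exact: tensV_ideal].
  by exists r; apply/(JacobiP alpha_filt uw (ltnW n_ge2)).
have alpha_ract := filtered_ract alpha_filt.
have alpha_lt := filtered_lt alpha_filt.
have alpha_in x : P x -> exists r, x = alpha r by move/alpha_im.
have [psi psiK] := projective_section V_proj.
apply: (leading_PBW P_le) => m x.
apply: (deformed_leading alpha_lt alpha_in).
apply: (relpairs_deformed alpha_ract psiK).
apply: (tor_syzygies_reducible (n_gt0 := ltnW n_ge2) n_ge2 V_proj alpha_ract alpha_lt).
case: jac => [tor0|jac]; [left; exact: tor0|right; split; first exact: tor_pure].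
apply: (Jacobi_reducible alpha_filt) => u w uw.
by have [r /(JacobiP alpha_filt uw (ltnW n_ge2))] := jac u w uw; exists r.
Qed.
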